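(* Let $\Lambda \subseteq \Gamma$ be an inclusion of $C^*$-simple discrete groups. Consider the following conditions: (i) The inclusion $C^*_\lambda(\Lambda) \subseteq C^*_\lambda(\Gamma)$ is $C^*$-irreducible. (ii) There is a topologically free boundary action $\Gamma \curvearrowright X$ such that, for each probability measure $\mu$ on $X$, the weak$^*$ closure of the orbit $\Lambda.\mu$ contains a point mass $\delta_x$, for some $x \in X$ on which $\Gamma$ acts freely. (iii) $\tau_0$ belongs to the weak$^*$ closure of $\{s.\varphi : s \in \Lambda\}$, for each state $\varphi$ on $C^*_\lambda(\Gamma)$. (iv) $\tau_0$ belongs to the weak$^*$ closure of $\mathrm{conv}\{s.\varphi : s \in \Lambda\}$, for each state $\varphi$ on $C^*_\lambda(\Gamma)$. (v) $\Gamma$ has the Powers' averaging property relatively to $\Lambda$: for all $\varepsilon>0$ and for all $s_1,\dots,s_n \in \Gamma \setminus \{e\}$ there exist $t_1,\dots,t_m \in \Lambda$ such that $\big\|\frac{1}{m}\sum_{k=1}^m u_{t_k^{-1} s_j t_k}\big\| < \varepsilon$ for $j=1,\dots,n$. (vi) The inclusion $C^*_\lambda(\Lambda) \subseteq C^*_\lambda(\Gamma)$ has the relative Dixmier property. Then (ii) $\Rightarrow$ (iii) $\Rightarrow$ (iv) $\Leftrightarrow$ (v) $\Rightarrow$ (vi) $\Rightarrow$ (i), and (i) $\Rightarrow$ (vi) if $[\Gamma:\Lambda] < \infty$.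
   Context: For a discrete group $\Gamma$, $C^*_\lambda(\Gamma)$ is the reduced group $C^*$-algebra, $t \mapsto u_t$ is the canonical (left-regular) unitary representation of $\Gamma$ in $C^*_\lambda(\Gamma)$, and $\tau_0$ is the canonical trace on $C^*_\lambda(\Gamma)$. $\Gamma$ is $C^*$-simple if $C^*_\lambda(\Gamma)$ is simple. For a subgroup $\Lambda\subseteq\Gamma$ one regards $C^*_\lambda(\Lambda)\subseteq C^*_\lambda(\Gamma)$ as the sub-$C^*$-algebra generated by $\{u_t : t\in\Lambda\}$. If $\varphi$ is a state on $C^*_\lambda(\Gamma)$ and $s \in \Gamma$, then $s.\varphi$ is the state $(s.\varphi)(x) = \varphi(u_s^* x u_s)$. A boundary action $\Gamma \curvearrowright X$ is an action by homeomorphisms on a compact Hausdorff space $X$ that is minimal and strongly proximal (the weak$^*$ closure of the $\Gamma$-orbit of every probability measure on $X$ contains a point mass). It is topologically free if for each $t\in\Gamma\setminus\{e\}$ the set of fixed points of $t$ has empty interior. $\Gamma$ acts freely on $x\in X$ if $t.x\ne x$ for all $t\in\Gamma\setminus\{e\}$. $\Lambda.\mu$ is the orbit of $\mu$ under the induced action of $\Lambda$ on (Radon) probability measures on $X$. A unital inclusion $\mathcal{B} \subseteq \mathcal{A}$ of $C^*$-algebras is $C^*$-irreducible if each intermediate $C^*$-algebra $\mathcal{B} \subseteq \mathcal{D} \subseteq \mathcal{A}$ (including $\mathcal{B}$ and $\mathcal{A}$) is simple. It has the relative Dixmier property if, for all $a \in \mathcal{A}$, the norm closure of the convex hull of $\{u^*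 a u : u \in \mathcal{B} \text{ unitary}\}$ intersects $\mathbb{C}\cdot 1_{\mathcal{B}}$. *)

(* Defs.v *)
From HB Require Import structures.
From mathcomp Require Import all_boot all_order all_algebra finmap.
From mathcomp Require Import all_classical all_reals all_analysis.
From mathcomp Require Import complex ring lra.
From mathcomp Require Import showcase.summability.

Set Implicit Arguments.
Unset Strict Implicit.
Unset Printing Implicit Defensive.

Import Order.TTheory GRing.Theory Num.Theory.
Import numFieldNormedType.Exports.
Import ComplexField.Normc.

Local Open Scope classical_set_scope.
Local Open Scope ring_scope.
Local Open Scope complex_scope.

(* R[i] as a normed space over itself: the topology is the usual one on C. *)
HB.instance Definition _ (R : realType) := NormedModule.copy R[i] (R[i]^o).

Lemma partial_sum_reindex (I : choiceType) (V : zmodType) (e e' : I -> I)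
    (x : I -> V) : cancel e e' -> cancel e' e ->
  partial_sum (x \o e) @ totally `<=` partial_sum x @ totally.
Proof.
move=> eK e'K U [A _ AU]; exists (e @` A)%fset => // B /= AB.
have {}AB : (A `<=` e' @` B)%fset.
  apply/fsubsetP => i iA; rewrite -(eK i) in_imfset//=.
  by apply: (fsubsetP AB); rewrite in_imfset.
have := AU _ AB; congr (U _); rewrite /partial_sum.
rewrite -(big_seq_fsetE _ _ xpredT (x \o e)) -(big_seq_fsetE _ _ xpredT x).
rewrite big_imfset/=; last by move=> i j _ _ /(can_inj e'K).
by apply: eq_bigr => i _; rewrite e'K.
Qed.

Section SquareSummable.
Context (R : realType) (I : choiceType).
Local Notation C := R[i].

Definition sqnorm (f : I -> C) : \bar R :=
  \esum_(t in [set: I]) ((normc (f t)) ^+ 2)%:E.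

Definition square_summable : {pred I -> C} := fun f => (sqnorm f < +oo)%E.

Lemma normc_ge0 (z : C) : 0 <= normc z.
Proof. by case: z => a b /=; rewrite sqrtr_ge0. Qed.

Lemma sqnorm_ge0 f : (0 <= sqnorm f)%E.
Proof. by apply: esum_ge0 => t _; rewrite lee_fin sqr_ge0. Qed.

Lemma esumZ_le (c : R) (a : I -> \bar R) : 0 <= c -> (forall t, 0 <= a t)%E ->
  (\esum_(t in [set: I]) (c%:E * a t) <= c%:E * \esum_(t in [set: I]) a t)%E.
Proof.
move=> c0 a0; apply: ge_ereal_sup => _ [A [finA _] <-].
rewrite -ge0_mule_fsumr//; apply: lee_pmul => //.
  by rewrite fsume_ge0//.
by apply: ereal_sup_ubound; exists A => //; split.
Qed.

Lemma sqnormZ_le (c : C) f :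
  (sqnorm (c *: f) <= (normc c ^+ 2)%:E * sqnorm f)%E.
Proof.
apply: le_trans (esumZ_le _ _); rewrite ?sqr_ge0//.
  by apply: le_esum => t _; rewrite -EFinM lee_fin normcM exprMn.
by move=> t; rewrite lee_fin sqr_ge0.
Qed.

Lemma sqnormD_le (s : R) f g : 0 < s ->
  (sqnorm (f + g)%R <= (1 + s)%:E * sqnorm f + (1 + s^-1)%:E * sqnorm g)%E.
Proof.
move=> s0.
have s1 : 0 <= 1 + s by rewrite addr_ge0// ltW.
have s2 : 0 <= 1 + s^-1 by rewrite addr_ge0// invr_ge0 ltW.
apply: le_trans (leeD (esumZ_le s1 _) (esumZ_le s2 _)).
- rewrite -esumD; last 2 first.
  + by move=> t _; rewrite mule_ge0 ?lee_fin ?sqr_ge0.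
  + by move=> t _; rewrite mule_ge0 ?lee_fin ?sqr_ge0.
  apply: le_esum => t _; rewrite -!EFinM -EFinD lee_fin.
  have := le_normcD (f t) (g t).
  set a := normc (f t); set b := normc (g t) => fg.
  have a0 : 0 <= a by exact: normc_ge0.
  have b0 : 0 <= b by exact: normc_ge0.
  apply: (@le_trans _ _ ((a + b) ^+ 2)).
    by rewrite ler_pXn2r ?nnegrE ?normc_ge0 ?addr_ge0.
  have : 0 <= s^-1 * (s * a - b) ^+ 2.
    by rewrite mulr_ge0 ?sqr_ge0// invr_ge0 ltW.
  have -> : s^-1 * (s * a - b) ^+ 2 = s * a ^+ 2 - 2 * (a * b) + s^-1 * b ^+ 2.
    by field; rewrite gt_eqF.
  by lra.
- by move=> t; rewrite lee_fin sqr_ge0.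
- by move=> t; rewrite lee_fin sqr_ge0.
Qed.


Lemma sqnorm0 : sqnorm 0 = 0%E.
Proof. by apply: esum1 => t _; rewrite normc0 expr0n. Qed.

Lemma square_summable_submod : submod_closed square_summable.
Proof.
split=> [|c f g]; rewrite /square_summable !unfold_in ?sqnorm0 ?ltry// => lf lg.
have lcf : (sqnorm (c *: f) < +oo)%E.
  apply: le_lt_trans (sqnormZ_le _ _) _.
  by rewrite lte_mul_pinfty// lee_fin sqr_ge0.
apply: le_lt_trans (sqnormD_le _ _ ltr01) _.
by rewrite lte_add_pinfty// lte_mul_pinfty// lee_fin addr_ge0// invr_ge0.
Qed.

HB.instance Definition _ :=
  GRing.isSubmodClosed.Build C (I -> C) square_summable square_summable_submod.

Record ell2 := Ell2 { ell2_fun :> I -> C; _ : square_summable ell2_fun }.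

HB.instance Definition _ := [isSub for ell2_fun].
HB.instance Definition _ := [Choice of ell2 by <:].
HB.instance Definition _ := [SubChoice_isSubLmodule of ell2 by <:].

Definition ell2norm (x : ell2) : R := Num.sqrt (fine (sqnorm x)).

Lemma ell2_fin_num (x : ell2) : sqnorm x \is a fin_num.
Proof. by rewrite ge0_fin_numE ?sqnorm_ge0//; case: x. Qed.

Lemma ell2norm_sqr x : (ell2norm x ^+ 2)%:E = sqnorm x.
Proof. by rewrite sqr_sqrtr ?fine_ge0 ?sqnorm_ge0// fineK ?ell2_fin_num. Qed.

Lemma ell2norm_ge0 x : 0 <= ell2norm x. Proof. exact: sqrtr_ge0. Qed.

Lemma normc_le_ell2norm (x : ell2) t : normc (x t) <= ell2norm x.
Proof.
rewrite -(@ler_pXn2r _ 2)// ?nnegrE ?normc_ge0 ?ell2norm_ge0//.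
rewrite -lee_fin ell2norm_sqr -(@esum_set1 _ _ t (fun t => (normc (x t) ^+ 2)%:E)).
  rewrite /sqnorm esum_mkcond; apply: le_esum => s _.
  by case: ifP => //; rewrite lee_fin sqr_ge0.
by rewrite lee_fin sqr_ge0.
Qed.

Lemma ell2norm0_eq0 x : ell2norm x = 0 -> x = 0.
Proof.
move=> x0; apply: val_inj; apply/funext => t /=; apply: eq0_normc.
by apply/eqP; rewrite eq_le normc_ge0 andbT -x0 normc_le_ell2norm.
Qed.

Lemma ell2normZ_le (c : C) x : ell2norm (c *: x) <= normc c * ell2norm x.
Proof.
rewrite -(@ler_pXn2r _ 2)// ?nnegrE ?mulr_ge0 ?normc_ge0 ?ell2norm_ge0//.
by rewrite exprMn -lee_fin (EFinM (normc c ^+ 2)) !ell2norm_sqr; exact: sqnormZ_le.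
Qed.

Lemma ell2normZ (c : C) x : ell2norm (c *: x) = normc c * ell2norm x.
Proof.
apply/eqP; rewrite eq_le ell2normZ_le/=.
have [->|c0] := eqVneq c 0; first by rewrite normc0 mul0r ell2norm_ge0.
have nc0 : 0 < normc c.
  by rewrite lt_neqAle normc_ge0 andbT eq_sym; apply: contra c0 => /eqP/eq0_normc->.
rewrite mulrC -ler_pdivlMr// mulrC -normcV.
by apply: le_trans (ell2normZ_le _ _); rewrite scalerA mulVf// scale1r.
Qed.

Lemma ell2normD x y : ell2norm (x + y) <= ell2norm x + ell2norm y.
Proof.
have [/ell2norm0_eq0->|x0] := eqVneq (ell2norm x) 0.
  by rewrite add0r lerDr ell2norm_ge0.
have [/ell2norm0_eq0->|y0] := eqVneq (ell2norm y) 0.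
  by rewrite addr0 lerDl ell2norm_ge0.
have xp : 0 < ell2norm x by rewrite lt_neqAle eq_sym x0 ell2norm_ge0.
have yp : 0 < ell2norm y by rewrite lt_neqAle eq_sym y0 ell2norm_ge0.
rewrite -(@ler_pXn2r _ 2)// ?nnegrE ?addr_ge0 ?ell2norm_ge0//.
rewrite -lee_fin ell2norm_sqr.
apply: le_trans (@sqnormD_le (ell2norm y / ell2norm x) _ _ (divr_gt0 yp xp)) _.
rewrite -!ell2norm_sqr -!EFinM -EFinD lee_fin le_eqVlt; apply/orP; left.
by apply/eqP; field; rewrite x0.
Qed.

Let cnorm (x : ell2) : C := (ell2norm x)%:C.

Let cnormD x y : cnorm (x + y) <= cnorm x + cnorm y.
Proof. by rewrite -rmorphD lecR ell2normD. Qed.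

Let cnormZ (c : C) x : cnorm (c *: x) = `|c| * cnorm x.
Proof. by rewrite /cnorm ell2normZ rmorphM. Qed.

Let cnorm0_eq0 x : cnorm x = 0 -> x = 0.
Proof. by case=> /ell2norm0_eq0. Qed.

HB.instance Definition _ :=
  Lmodule_isNormed.Build C ell2 cnormD cnormZ cnorm0_eq0.

Lemma ell2_normE (x : ell2) : `|x| = (ell2norm x)%:C. Proof. by []. Qed.

(* Linear in the first variable; the sum over I is the limit along the finite
   subsets of I, and converges absolutely. *)
Definition dotp (x y : ell2) : C :=
  lim (partial_sum (fun t => x t * (y t)^*) @ totally).

Definition delta_fun (i : I) : I -> C := fun t => (t == i)%:R.

Lemma square_summable_delta i : square_summable (delta_fun i).
Proof.
rewrite /square_summable /sqnorm (_ : esum _ _ = 1%E) ?ltry//.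
rewrite -[RHS](@esum_set1 _ _ i (fun=> 1%E)) ?lee01// [RHS]esum_mkcond.
apply: eq_esum => t _; rewrite /delta_fun; have [->|ti] := eqVneq t i.
  by rewrite ifT ?inE// normc1 expr1n.
rewrite ifF; first by rewrite normc0 expr0n.
by apply/negbTE; apply: contra ti; rewrite inE => /= ->.
Qed.

Definition delta i : ell2 := Ell2 (square_summable_delta i).

Lemma dotp_deltal (i : I) (y : ell2) :
  dotp (delta i) y = (y i)^*.
Proof.
have tF := @totally_filter I; rewrite /dotp; apply: cvg_lim; first exact: norm_hausdorff.
move=> U /nbhs_singleton Ui; exists [fset i]%fset => // A /= iA.
have {}iA : i \in A by apply: (fsubsetP iA); rewrite inE.
suff -> : partial_sum (fun t => delta i t * (y t)^*) A = (y i)^* by [].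
rewrite /partial_sum (bigD1 [` iA]%fset)//= big1 => [|j ji].
  by rewrite /delta_fun eqxx mul1r addr0.
rewrite /delta_fun; have [jE|] := eqVneq; last by rewrite mul0r.
by move: ji; rewrite -val_eqE/= jE eqxx.
Qed.

End SquareSummable.
Arguments square_summable {R I}.
Arguments ell2 : clear implicits.
Arguments delta {R I}.

Section BoundedOperators.
Context (R : realType) (I : choiceType).
Local Notation C := R[i].
Local Notation H := (ell2 R I).

Definition bounded_linear : {pred H -> H} := fun f =>
  `[< linear f /\ exists M : R, forall x, ell2norm (f x) <= M * ell2norm x >].

Lemma bounded_linear_submod : submod_closed bounded_linear.
Proof.
split=> [|c f g].
  have f0 x : (0 : H -> H) x = 0 by [].
  apply/asboolP; split; first by move=> a x y; rewrite !f0 scaler0 addr0.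
  exists 0 => x; rewrite mul0r f0.
  by rewrite -(scale0r (0 : H)) ell2normZ normc0 mul0r.
move=> /asboolP[lf [M fM]] /asboolP[lg [N gN]]; apply/asboolP; split.
  move=> a x y; rewrite !fctE lf lg !scalerDr !scalerA addrACA.
  by rewrite (mulrC a).
exists (normc c * M + N) => x; rewrite !fctE mulrDl.
apply: le_trans (ell2normD _ _) _; rewrite lerD// ell2normZ -mulrA.
by rewrite ler_wpM2l ?normc_ge0.
Qed.

HB.instance Definition _ :=
  GRing.isSubmodClosed.Build C (H -> H) bounded_linear bounded_linear_submod.

Record bop := Bop { bop_fun :> H -> H; _ : bounded_linear bop_fun }.

HB.instance Definition _ := [isSub for bop_fun].
HB.instance Definition _ := [Choice of bop by <:].
HB.instance Definition _ := [SubChoice_isSubLmodule of bop by <:].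

Lemma bop_linear (T : bop) : linear T.
Proof. by case: T => f /= /asboolP[]. Qed.

HB.instance Definition _ (T : bop) :=
  GRing.isLinear.Build C H H *:%R T (bop_linear T).

Lemma bop_bounded (T : bop) :
  exists2 M : R, 0 <= M & forall x, ell2norm (T x) <= M * ell2norm x.
Proof.
case: T => f /= /asboolP[_ [M fM]]; exists `|M| => // x.
by apply: le_trans (fM x) _; rewrite ler_wpM2r ?ell2norm_ge0// ler_norm.
Qed.

Lemma bopD (T S : bop) x : (T + S) x = T x + S x. Proof. by []. Qed.
Lemma bopZ c (T : bop) x : (c *: T) x = c *: T x. Proof. by []. Qed.

Lemma bounded_linear_id : bounded_linear (@id H).
Proof. by apply/asboolP; split=> //; exists 1 => x; rewrite mul1r. Qed.

Lemma bounded_linear_comp (T S : bop) : bounded_linear (T \o S).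
Proof.
apply/asboolP; split=> [a x y|]; first by rewrite /= !linearP.
have [M M0 TM] := bop_bounded T; have [N N0 SN] := bop_bounded S.
exists (M * N) => x /=; apply: le_trans (TM _) _.
by rewrite -mulrA ler_wpM2l.
Qed.

Let bop1 : bop := Bop bounded_linear_id.
Let bopM (T S : bop) : bop := Bop (bounded_linear_comp T S).

Let bopMA : associative bopM. Proof. by move=> T S U; apply: val_inj. Qed.
Let bop1M : left_id bop1 bopM. Proof. by move=> T; apply: val_inj. Qed.
Let bopM1 : right_id bop1 bopM. Proof. by move=> T; apply: val_inj. Qed.
Let bopMDl : left_distributive bopM +%R.
Proof. by move=> T S U; apply: val_inj. Qed.
Let bopMDr : right_distributive bopM +%R.
Proof.
by move=> T S U; apply: val_inj; apply/funext => x /=; rewrite linearD.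
Qed.

HB.instance Definition _ :=
  GRing.Zmodule_isPzRing.Build bop bopMA bop1M bopM1 bopMDl bopMDr.

Lemma bopME (T S : bop) x : (T * S) x = T (S x). Proof. by []. Qed.
Lemma bop1E x : (1 : bop) x = x. Proof. by []. Qed.

Definition opnorm (T : bop) : R :=
  sup [set ell2norm (T x) | x in [set x | ell2norm x <= 1]].

Lemma ell2norm0 : ell2norm (0 : H) = 0.
Proof. by rewrite -(scale0r (0 : H)) ell2normZ normc0 mul0r. Qed.

Lemma opnorm_has_sup (T : bop) :
  has_sup [set ell2norm (T x) | x in [set x | ell2norm x <= 1]].
Proof.
split; first by exists (ell2norm (T 0)), 0 => //=; rewrite ell2norm0.
have [M M0 TM] := bop_bounded T.
exists M => _ [x /= x1 <-]; apply: le_trans (TM x) _.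
by rewrite -[leRHS]mulr1 ler_wpM2l.
Qed.

Lemma opnorm_ub (T : bop) x : ell2norm x <= 1 -> ell2norm (T x) <= opnorm T.
Proof. by move=> x1; apply: ub_le_sup; [case: (opnorm_has_sup T)|exists x]. Qed.

Lemma opnorm_le (T : bop) M :
  (forall x, ell2norm x <= 1 -> ell2norm (T x) <= M) -> opnorm T <= M.
Proof.
move=> TM; apply: ge_sup => [|_ [x /= x1 <-]]; last exact: TM.
by case: (opnorm_has_sup T).
Qed.

Lemma opnorm_ge0 (T : bop) : 0 <= opnorm T.
Proof.
apply: le_trans (ell2norm_ge0 (T 0)) _.
by apply: opnorm_ub; rewrite ell2norm0.
Qed.

Lemma opnorm0_eq0 (T : bop) : opnorm T = 0 -> T = 0.
Proof.
move=> T0; apply: val_inj; apply/funext => x /=; rewrite -[RHS]/(0 : H).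
have [->|x0] := eqVneq x 0; first by rewrite linear0.
have n0 : ell2norm x != 0 by apply: contra x0 => /eqP/ell2norm0_eq0->.
have c0 : (ell2norm x)%:C != 0 by rewrite fmorph_eq0.
have : ell2norm (T ((ell2norm x)%:C^-1 *: x)) <= 0.
  rewrite -T0; apply: opnorm_ub; rewrite ell2normZ normcV.
  by rewrite /= expr0n addr0 sqrtr_sqr ger0_norm ?ell2norm_ge0// mulVf.
rewrite linearZ => le0; have /ell2norm0_eq0/eqP :
    ell2norm ((ell2norm x)%:C^-1 *: T x) = 0.
  by apply/eqP; rewrite eq_le le0 ell2norm_ge0.
by rewrite scaler_eq0 invr_eq0 (negPf c0)/= => /eqP.
Qed.

Lemma opnormD (T S : bop) : opnorm (T + S) <= opnorm T + opnorm S.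
Proof.
apply: opnorm_le => x x1; apply: le_trans (ell2normD (T x) (S x)) _.
by apply: lerD; apply: opnorm_ub.
Qed.

Lemma opnormZ_le c (T : bop) : opnorm (c *: T) <= normc c * opnorm T.
Proof.
apply: opnorm_le => x x1; rewrite -[(c *: T) x]/(c *: T x) ell2normZ.
by apply: ler_wpM2l; [exact: normc_ge0|exact: opnorm_ub].
Qed.

Lemma opnormZ c (T : bop) : opnorm (c *: T) = normc c * opnorm T.
Proof.
apply/eqP; rewrite eq_le opnormZ_le/=.
have [->|c0] := eqVneq c 0; first by rewrite normc0 mul0r opnorm_ge0.
have nc0 : 0 < normc c.
  by rewrite lt_neqAle normc_ge0 andbT eq_sym; apply: contra c0 => /eqP/eq0_normc->.
rewrite mulrC -ler_pdivlMr// mulrC -normcV.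
by apply: le_trans (opnormZ_le _ _); rewrite scalerA mulVf// scale1r.
Qed.

Let cnorm (T : bop) : C := (opnorm T)%:C.

Let cnormD T S : cnorm (T + S) <= cnorm T + cnorm S.
Proof. by rewrite -rmorphD lecR opnormD. Qed.

Let cnormZ (c : C) T : cnorm (c *: T) = `|c| * cnorm T.
Proof. by rewrite /cnorm opnormZ rmorphM. Qed.

Let cnorm0_eq0 T : cnorm T = 0 -> T = 0.
Proof. by case=> /opnorm0_eq0. Qed.

HB.instance Definition _ :=
  Lmodule_isNormed.Build C bop cnormD cnormZ cnorm0_eq0.

Lemma bop_normE (T : bop) : `|T| = (opnorm T)%:C. Proof. by []. Qed.

(* The adjoint; it exists and is unique because ell2 is a Hilbert space. *)
Definition adj (T : bop) : bop :=
  xget 0 [set S : bop | forall x y, dotp (T x) y = dotp x (S y)].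

Lemma adj_unique (T S : bop) :
  (forall x y, dotp (T x) y = dotp x (S y)) -> adj T = S.
Proof.
move=> TS; apply: xget_unique => // S' TS'; apply: val_inj.
apply/funext => y; apply: val_inj; apply/funext => i /=.
by apply: (can_inj (@conjcK _)); rewrite -!dotp_deltal -TS -TS'.
Qed.

Definition unitary_op (U : bop) := adj U * U = 1 /\ U * adj U = 1.

Definition star_subalgebra (D : set bop) :=
  [/\ D 0,
      forall (c : C) x y, D x -> D y -> D (c *: x + y),
      forall x y, D x -> D y -> D (x * y) &
      forall x, D x -> D (adj x)].

Definition cstar_subalgebra (D : set bop) := star_subalgebra D /\ closed D.

Definition cstar_generated (G : set bop) : set bop :=
  smallest cstar_subalgebra G.

Definition closed_ideal (D J : set bop) :=
  [/\ J `<=` D, J 0,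
      forall (c : C) x y, J x -> J y -> J (c *: x + y),
      forall a x, D a -> J x -> J (a * x) /\ J (x * a) &
      closed J].

Definition simple_cstar (D : set bop) :=
  D <> [set 0] /\ forall J, closed_ideal D J -> J = [set 0] \/ J = D.

Definition cstar_irreducible (B A : set bop) :=
  forall D, cstar_subalgebra D -> B `<=` D -> D `<=` A -> simple_cstar D.

Definition convex_hull (V : lmodType C) (G : set V) : set V :=
  smallest (@convex_set C V) G.

Definition relative_dixmier (B A : set bop) :=
  forall a, A a -> exists c : C,
    closure (convex_hull
      [set adj u * a * u | u in [set u | B u /\ unitary_op u]]) (c *: (1 : bop)).

(* A functional on A is represented by a function on all bounded operators, only
   whose values on A matter. *)
Definition is_state (A : set bop) (phi : bop -> C) :=
  [/\ forall (c : C) x y, A x -> A y -> phi (c *: x + y) = c * phi x + phi y,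
      forall x, A x -> 0 <= phi (adj x * x) &
      phi 1 = 1].

Definition in_weakstar_closure (A : set bop) (S : set (bop -> C))
    (phi : bop -> C) :=
  closure ([set sigL A psi | psi in S] : set {ptws A -> C}) (sigL A phi).

End BoundedOperators.

Section ReducedGroupAlgebra.
Context (R : realType) (G : groupType).
Local Notation C := R[i].
Local Notation H := (ell2 R G).
Local Notation B := (bop R G).

Definition lshift_fun (t : G) (x : H) : G -> C := fun s => x (t^-1 * s)%g.

Lemma sqnorm_lshift t x : sqnorm (lshift_fun t x) = sqnorm x.
Proof.
rewrite /sqnorm (@reindex_esum _ _ _ [set: G] [set: G] (fun s => (t * s)%g)).
  by apply: eq_esum => s _; rewrite /lshift_fun mulKg.
split => //; first by move=> s s' _ _ /mulgI.
by move=> s _; exists (t^-1 * s)%g => //; rewrite mulVKg.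
Qed.

Lemma square_summable_lshift t x : square_summable (lshift_fun t x).
Proof.
by rewrite /square_summable sqnorm_lshift; case: x.
Qed.

Definition lshift_ell2 (t : G) (x : H) : H :=
  Ell2 (square_summable_lshift t x).

Lemma bounded_linear_lshift t : bounded_linear (lshift_ell2 t).
Proof.
apply/asboolP; split; first by move=> a x y; apply: val_inj.
by exists 1 => x; rewrite mul1r /ell2norm sqnorm_lshift.
Qed.

(* (u_t x)(s) = x (t^-1 s), so that u_t maps delta s to delta (t s). *)
Definition lreg (t : G) : B := Bop (bounded_linear_lshift t).

Lemma lreg_delta t s : lreg t (delta s) = delta (t * s)%g.
Proof.
apply: val_inj; apply/funext => r /=; rewrite /lshift_fun/= /delta_fun.
by congr (_%:R); congr nat_of_bool; apply/eqP/eqP => [<-|->];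
  rewrite ?mulVKg ?mulKg.
Qed.

Lemma dotp_lreg (t : G) (x y : H) :
  dotp (lreg t x) y = dotp x (lreg t^-1%g y).
Proof.
rewrite /dotp; congr (lim _).
pose f s := x s * (lreg t^-1%g y s)^*.
have -> : (fun s => lreg t x s * (y s)^*) = f \o (fun s => t^-1 * s)%g.
  by apply/funext => s; rewrite /f /= /lshift_fun/= invgK mulVKg.
have eK : cancel (fun s => t^-1 * s)%g (fun s => t * s)%g.
  by move=> s; rewrite mulVKg.
have e'K : cancel (fun s => t * s)%g (fun s => t^-1 * s)%g.
  by move=> s; rewrite mulKg.
apply/seteqP; split; first exact: partial_sum_reindex eK e'K.
rewrite [X in partial_sum X @ _ `<=` _](_ : _ =
  (f \o (fun s => t^-1 * s)%g) \o (fun s => t * s)%g); last first.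
  by apply/funext => s /=; rewrite mulKg.
exact: partial_sum_reindex e'K eK.
Qed.

Lemma adj_lreg (t : G) :
  adj (lreg t) = lreg t^-1%g.
Proof. by apply: adj_unique => x y; rewrite dotp_lreg. Qed.

(* For a subgroup L, C*_lambda(L) as a subalgebra of C*_lambda(G). *)
Definition reduced_cstar (L : set G) : set B :=
  cstar_generated [set lreg t | t in L].

Definition canonical_trace (x : B) : C := dotp (x (delta 1%g)) (delta 1%g).

Lemma trace_lreg (t : G) :
  canonical_trace (lreg t) = (t == 1%g)%:R.
Proof.
rewrite /canonical_trace lreg_delta dotp_deltal /= /delta_fun mulg1.
by case: eqP => _; rewrite ?rmorph1 ?rmorph0.
Qed.

Definition shift_functional (s : G) (phi : B -> C) : B -> C :=
  fun x => phi (adj (lreg s) * x * lreg s).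

Definition powers_averaging (L : set G) :=
  forall (e : R) (n : nat) (s : 'I_n -> G), 0 < e ->
    (forall j, s j <> 1%g) ->
  exists (m : nat) (t : 'I_m.+1 -> G), (forall k, L (t k)) /\
    forall j,
      `| m.+1%:R^-1 *: \sum_(k < m.+1) lreg ((t k)^-1 * s j * t k)%g | < e%:C.

End ReducedGroupAlgebra.
Arguments canonical_trace {R G}.

Definition cstar_simple (R : realType) (G : groupType) :=
  simple_cstar (@reduced_cstar R G [set: G]).

Definition finite_index (G : groupType) (L : set G) :=
  finite_set [set [set (g * h)%g | h in L] | g in [set: G]].

Section Boundary.
Context (R : realType) (G : groupType) (X : ptopologicalType).

Definition borel := g_sigma_algebraType (@open X).

Definition radon (mu : probability borel R) :=
  forall A : set borel, measurable A ->
    mu A = ereal_sup [set mu K | K in [set K | compact (K : set X) /\ K `<=` A]].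

(* The weak* topology is that of the functionals on C(X) given by integration. *)
Definition integral_functional (mu : probability borel R) :
    {ptws continuousType X R -> R} := fun f => \int[mu]_x (f x).

Definition weakstar_closure_measures (S : set (probability borel R)) :
    set (probability borel R) :=
  [set mu | closure [set integral_functional nu | nu in S]
              (integral_functional mu)].

Variable act : G -> X -> X.

Definition continuous_action :=
  [/\ forall x, act 1%g x = x,
      forall s t x, act (s * t)%g x = act s (act t x) &
      forall s, continuous (act s)].

Definition minimal_action :=
  forall Y : set X, closed Y -> (forall s, act s @` Y `<=` Y) ->
    Y = set0 \/ Y = setT.

Definition measure_orbit (L : set G) (mu : probability borel R) :
    set (probability borel R) :=
  [set nu | exists2 s, L s &
     forall A : set borel, measurable A -> nu A = mu (act s @^-1` A)].

Definition strongly_proximal :=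
  forall mu, radon mu -> exists x : borel,
    weakstar_closure_measures (measure_orbit [set: G] mu) \d_x.

Definition boundary_action :=
  [/\ compact [set: X], hausdorff_space X, continuous_action,
      minimal_action & strongly_proximal].

Definition topologically_free :=
  forall t, t <> 1%g -> interior [set x | act t x = x] = set0.

Definition acts_freely_on (x : X) := forall t, t <> 1%g -> act t x <> x.

End Boundary.

(* Main.v *)
(* A state restricted to the functions on an orbit in X is a finitely additive
   measure; pushing the associated Radon measure towards a free point makes the
   state small on the given unitaries, which is (iii).  (iv) => (v) is a
   separation argument: if no average of x is small, some state is bounded below
   on all conjugates of x.  Averages of a tend to the trace of a, hence (vi), and
   a nonzero ideal contains a^* a, whose trace is nonzero, hence (i).

   For finite index, simplicity of the algebra of Lambda first yields Powers'
   averaging in Lambda.  Take an extreme point x of the functionals below a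
   minimal invariant sublinear functional.  By extremality suitable boundary
   states factor through the Poisson-type map T |-> (k |-> x(k.T)), so they vanish
   off the stabilizer H of x.  The group H is amenable, so by simplicity the trace
   is dominated by vector states extending the trivial character of H, and this
   forces any finite set of nontrivial elements to be conjugate into the
   complement of H.  Next, irreducibility makes the Lambda-classes of nontrivial
   elements infinite, since a finite class yields a nonscalar central element of
   an intermediate algebra.  So u_s has averages of small 2-norm; their parts in
   the finitely many cosets of Lambda are made small in norm by averaging in
   Lambda, using the Kadison-Schwarz inequality. *)
Require Import Defs.
From HB Require Import structures.
From mathcomp Require Import all_boot all_order all_algebra finmap.
From mathcomp Require Import all_classical all_reals all_analysis.
From mathcomp Require Import complex ring lra.
From mathcomp Require Import showcase.summability measurable_realfun.

Set Implicit Arguments.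
Unset Strict Implicit.
Unset Printing Implicit Defensive.

Import Order.TTheory GRing.Theory Num.Theory.
Import numFieldNormedType.Exports.
Import ComplexField.Normc.

Local Open Scope classical_set_scope.
Local Open Scope ring_scope.
Local Open Scope complex_scope.

(** * Hahn-Banach and Krein-Milman theorems through minimal sublinear functionals *)

Section Sublinear.
Context (R : realType) (V : lmodType R[i]).
Implicit Types (p r : V -> R) (f : V -> R) (Cn : V -> R -> Prop).

(** States are handled as real-linear functionals below [nsup], the top of the numerical range of
    the real part. A compact convex set of states is replaced by its support function, and
    compactness by Zorn's lemma on sublinear functionals: Hahn-Banach extension, extreme points and
    minimal invariant sets then come from one argument. The functionals must live on all bounded
    operators and not only on the reduced algebra, because they are evaluated at multiplication
    operators by functions on the group: indicators pulled back from X, or symbols built from a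
    state. To extend a state, an element of the algebra with nonnegative quadratic form has to be a
    square within the algebra, hence the square roots. When simplicity is used no boundary is given,
    and the orbit of the extreme point takes its place. Simplicity is a statement about ideals, so
    the amenability of the stabilizer must be turned from an invariant mean into a state extending
    its trivial character; Kesten's theorem on random walks does this. *)

Definition real_linear f :=
  (forall x y, f (x + y) = f x + f y) /\
  (forall (a : R) x, f (a%:C *: x) = a * f x).

Definition sublinear p :=
  (forall x y, p (x + y) <= p x + p y) /\
  (forall (a : R) x, 0 <= a -> p (a%:C *: x) = a * p x).

Lemma real_linearN f x : real_linear f -> f (- x) = - f x.
Proof.
by move=> [_ fZ]; rewrite -scaleN1r -[-1]/((-1)%R) -(rmorphN1 (real_complex R)) fZ mulN1r.
Qed.

Lemma real_linearB f x y : real_linear f -> f (x - y) = f x - f y.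
Proof. by move=> lf; rewrite lf.1 real_linearN. Qed.

Lemma real_linear0 f : real_linear f -> f 0 = 0.
Proof. by move=> lf; rewrite -(subrr 0) real_linearB// subrr. Qed.

Lemma real_linear_sum f (I : Type) (s : seq I) (F : I -> V) : real_linear f ->
  f (\sum_(i <- s) F i) = \sum_(i <- s) f (F i).
Proof.
move=> lf; elim: s => [|a s IH]; first by rewrite !big_nil real_linear0.
by rewrite !big_cons lf.1 IH.
Qed.

Lemma sublinear0 p : sublinear p -> p 0 = 0.
Proof. by move=> [_ pZ]; rewrite -(scale0r (0 : V)) -(rmorph0 (real_complex R)) pZ// mul0r. Qed.

Lemma sublinear_sum p (I : Type) (s : seq I) (F : I -> V) : sublinear p ->
  p (\sum_(i <- s) F i) <= \sum_(i <- s) p (F i).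
Proof.
move=> sp; elim: s => [|a s IH]; first by rewrite !big_nil sublinear0.
by rewrite !big_cons; apply: le_trans (sp.1 _ _) _; rewrite lerD2l.
Qed.

Lemma sublinearN p x : sublinear p -> - p (- x) <= p x.
Proof. by move=> sp; rewrite lerNl -subr_ge0 opprK addrC -(sublinear0 sp) -(subrr x) sp.1. Qed.

Section SupFamily.
Context (I : Type) (D : set I) (F : I -> V -> R).
Hypotheses (D0 : D !=set0) (lF : forall i, D i -> real_linear (F i)).
Hypothesis ubF : forall v, has_ubound [set F i v | i in D].

Lemma sup_family_ub i v : D i -> F i v <= sup [set F i v | i in D].
Proof. by move=> Di; apply: ub_le_sup; [exact: ubF|exists i]. Qed.

Lemma sup_family_le v (M : R) : (forall i, D i -> F i v <= M) -> sup [set F i v | i in D] <= M.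
Proof.
move=> FM; apply: ge_sup; first by have [i Di] := D0; exists (F i v), i.
by move=> _ [i Di <-]; exact: FM.
Qed.

Lemma sup_family_sublinear : sublinear (fun v => sup [set F i v | i in D]).
Proof.
split=> [v w|a v].
  by apply: sup_family_le => i Di; rewrite (lF Di).1; apply: lerD; exact: sup_family_ub.
have Z (b : R) u : 0 <= b ->
    sup [set F i (b%:C *: u) | i in D] <= b * sup [set F i u | i in D].
  by move=> b0; apply: sup_family_le => i Di; rewrite (lF Di).2 ler_wpM2l// sup_family_ub.
rewrite le_eqVlt => /orP[/eqP<-|a0]; apply/eqP; rewrite eq_le Z ?(ltW a0)//=.
  have [i Di] := D0; apply: le_trans (sup_family_ub _ Di).
  by rewrite (lF Di).2 !mul0r.
rewrite -ler_pdivlMl//; apply: le_trans (Z a^-1 _ _); last by rewrite invr_ge0 ltW.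
by rewrite scalerA -rmorphM mulVf ?gt_eqF// rmorph1 scale1r.
Qed.

End SupFamily.

Lemma le_mul_inf (A : set R) (a y : R) : A !=set0 -> has_lbound A -> 0 <= a ->
  (forall e, A e -> y <= a * e) -> y <= a * inf A.
Proof.
move=> A0 lA; rewrite le_eqVlt => /orP[/eqP<- H|a0 H].
  by have [e Ae] := A0; move: (H _ Ae); rewrite !mul0r.
by rewrite -ler_pdivrMl//; apply: lb_le_inf => // e Ae; rewrite ler_pdivrMl// H.
Qed.

Definition inf_chain (A : set (V -> R)) : V -> R :=
  fun v => inf [set f v | f in A].

Lemma chain_lbound p (A : set (V -> R)) v :
  (forall f, A f -> sublinear f /\ forall u, f u <= p u) ->
  has_lbound [set f v | f in A].
Proof.
move=> AS; exists (- p (- v)) => _ [f Af <-]; have [sf fp] := AS _ Af.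
by apply: le_trans (sublinearN _ sf); rewrite lerN2.
Qed.

(** An infimum of sublinear functionals is rarely subadditive; here any two members can be replaced
    by the smaller one, so a single member serves both arguments. *)
Lemma inf_chain_sublinear p (A : set (V -> R)) : A !=set0 ->
  (forall f, A f -> sublinear f /\ forall u, f u <= p u) ->
  total_on A (fun f g => forall v, f v <= g v) ->
  sublinear (inf_chain A).
Proof.
move=> A0 AS Atot; have lb v := @chain_lbound p A v AS.
have ne v : [set f v | f in A] !=set0 by case: A0 => f Af; exists (f v), f.
have le v f : A f -> inf_chain A v <= f v by move=> Af; apply: ge_inf => //; exists f.
split=> [x y|a x a0].
  rewrite -lerBlDr; apply: lb_le_inf => // _ [f Af <-].
  rewrite lerBlDr -lerBlDl; apply: lb_le_inf => // _ [g Ag <-].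
  rewrite lerBlDl; have [fg|gf] := Atot _ _ Af Ag.
    by apply: le_trans (le _ _ Af) _; apply: le_trans ((AS _ Af).1.1 _ _) _; rewrite lerD2l.
  by apply: le_trans (le _ _ Ag) _; apply: le_trans ((AS _ Ag).1.1 _ _) _; rewrite lerD2r.
apply/eqP; rewrite eq_le; apply/andP; split.
  by apply: le_mul_inf => // _ [f Af <-]; rewrite -(AS _ Af).1.2//; exact: le.
apply: lb_le_inf => // _ [f Af <-]; rewrite (AS _ Af).1.2//.
by rewrite ler_wpM2l// le.
Qed.

(** Zorn's lemma for the reversed pointwise order. [Q] is a condition stable under infima of chains:
    nothing for Hahn-Banach, a face condition for extreme points, invariance for minimal invariant
    functionals. *)
Lemma minimal_sublinear (Q : (V -> R) -> Prop) p :
  (forall A : set (V -> R), A !=set0 ->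
    (forall f, A f -> [/\ sublinear f, Q f & forall u, f u <= p u]) ->
    total_on A (fun f g => forall v, f v <= g v) -> Q (inf_chain A)) ->
  sublinear p -> Q p ->
  exists r, [/\ sublinear r, Q r, forall v, r v <= p v &
    forall s, sublinear s -> Q s -> (forall v, s v <= r v) -> s = r].
Proof.
move=> QA sp Qp.
pose T := {f : V -> R | [/\ sublinear f, Q f & forall u, f u <= p u]}.
pose ord (f g : T) := `[< forall v, sval g v <= sval f v >].
have [||||t tmax] := @Zorn T ord.
- by move=> t; apply/asboolP.
- move=> r s t /asboolP rs /asboolP st; apply/asboolP => v.
  exact: le_trans (st v) (rs v).
- move=> [s sP] [t tP] /asboolP/= st /asboolP/= ts.
  by apply: eq_exist; apply/funext => v; apply/eqP; rewrite eq_le ts st.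
- move=> A Atot; have [[t0 At0]|A0] := pselect (A !=set0); last first.
    have pP : [/\ sublinear p, Q p & forall u, p u <= p u] by [].
    by exists (exist _ p pP : T) => s As; case: A0; exists s.
  pose B : set (V -> R) := [set sval t | t in A].
  have BP f : B f -> [/\ sublinear f, Q f & forall u, f u <= p u].
    by move=> [[g gP] _ <-].
  have B0 : B !=set0 by exists (sval t0), t0.
  have BS f : B f -> sublinear f /\ forall u, f u <= p u by move=> /BP[].
  have Btot : total_on B (fun f g => forall v, f v <= g v).
    move=> _ _ [s As <-] [t At <-].
    by have [/asboolP|/asboolP] := Atot _ _ As At; [right|left].
  have le v f : B f -> inf_chain B v <= f v.
    by move=> Bf; apply: ge_inf; [exact: chain_lbound BS|exists f].
  have iP : [/\ sublinear (inf_chain B), Q (inf_chain B) &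
      forall u, inf_chain B u <= p u].
    split; first exact: inf_chain_sublinear BS _.
      exact: QA.
    move=> u; have [f Bf] := B0; apply: le_trans (le _ _ Bf) _.
    by have [] := BP _ Bf.
  exists (exist _ (inf_chain B) iP : T) => s As; apply/asboolP => v /=; apply: le.
  by exists s.
case: t tmax => r [sr Qr rp] /= rmax; exists r; split=> // s ss Qs sr'.
have sP : [/\ sublinear s, Q s & forall u, s u <= p u].
  by split=> // u; apply: le_trans (sr' u) (rp u).
by have /(congr1 sval)/= := rmax (exist _ s sP : T) (asboolT sr').
Qed.

(** A convex cone of constraints: [Cn v c] asks the functional [f] to be found for [c <= f v]. *)
Definition cone Cn :=
  [/\ Cn 0 0, forall v w c d, Cn v c -> Cn w d -> Cn (v + w) (c + d) &
      forall (a : R) v c, 0 < a -> Cn v c -> Cn (a%:C *: v) (a * c)].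

(** When the constraints are compatible with [p], the linear minorants of this functional are
    exactly those of [p] that meet every constraint in [Cn]. *)
Definition inf_cone p Cn v := inf [set p (v + w.1) - w.2 | w in [set w | Cn w.1 w.2]].

Section InfCone.
Context p Cn (sp : sublinear p) (cC : cone Cn) (Cp : forall v c, Cn v c -> c <= p v).

Let lb v : has_lbound [set p (v + w.1) - w.2 | w in [set w : V * R | Cn w.1 w.2]].
Proof.
exists (- p (- v)) => _ [[w c] /= Cw <-].
rewrite lerBrDl lerBlDr; apply: le_trans (Cp Cw) _.
by apply: le_trans (sp.1 _ _); rewrite addrAC subrr add0r.
Qed.

Lemma inf_cone_le v w c : Cn w c -> inf_cone p Cn v <= p (v + w) - c.
Proof. by move=> Cw; apply: ge_inf => //; exists (w, c). Qed.

Lemma inf_cone_lep v : inf_cone p Cn v <= p v.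
Proof. by case: cC => C0 _ _; have := inf_cone_le v C0; rewrite addr0 subr0. Qed.

Lemma le_mul_inf_cone a y v : 0 <= a ->
  (forall w c, Cn w c -> y <= a * (p (v + w) - c)) -> y <= a * inf_cone p Cn v.
Proof.
move=> a0 H; apply: le_mul_inf => //; last by move=> _ [[w c] Cw <-]; exact: H.
by case: cC => C0 _ _; exists (p (v + 0) - 0), (0, 0).
Qed.

Lemma le_inf_cone y v :
  (forall w c, Cn w c -> y <= p (v + w) - c) -> y <= inf_cone p Cn v.
Proof.
by move=> H; rewrite -(mul1r (inf_cone _ _ _)); apply: le_mul_inf_cone => // w c Cw; rewrite mul1r H.
Qed.

Lemma inf_cone_sublinear : sublinear (inf_cone p Cn).
Proof.
have [C0 CD CZ] := cC; split=> [x y|a x].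
  rewrite -lerBlDr; apply: le_inf_cone => w c Cw.
  rewrite lerBlDr -lerBlDl; apply: le_inf_cone => w' c' Cw'.
  rewrite lerBlDl; apply: le_trans (inf_cone_le _ (CD _ _ _ _ Cw Cw')) _.
  rewrite addrACA [leRHS]addrACA -opprD lerD2r; exact: (sp.1 (x + w) (y + w')).
rewrite le_eqVlt => /orP[/eqP<-|a0].
  rewrite rmorph0 scale0r mul0r; apply/eqP; rewrite eq_le; apply/andP; split.
    by rewrite -(sublinear0 sp) inf_cone_lep.
  by apply: le_inf_cone => w c Cw; rewrite add0r subr_ge0 Cp.
have aC : a%:C != 0 by rewrite fmorph_eq0 gt_eqF.
apply/eqP; rewrite eq_le; apply/andP; split.
  apply: le_mul_inf_cone; first exact: ltW.
  move=> w c Cw; apply: le_trans (inf_cone_le _ (CZ _ _ _ a0 Cw)) _.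
  by rewrite -scalerDr (sp.2 _ _ (ltW a0)) mulrBr lexx.
apply: le_inf_cone => w c Cw.
have ai0 : 0 < a^-1 by rewrite invr_gt0.
have := inf_cone_le x (CZ _ _ _ ai0 Cw).
rewrite -(ler_pM2l a0) => /le_trans; apply; rewrite mulrBr mulVKf ?gt_eqF//.
by rewrite -(sp.2 _ _ (ltW a0)) scalerDr scalerA -rmorphM mulfV ?gt_eqF// rmorph1 scale1r.
Qed.

End InfCone.

(** The constraint [p w <= f w] and its multiples: the minorants of [p] that attain [p] at [w]. *)
Definition ray p w : V -> R -> Prop :=
  fun v c => exists2 t : R, 0 <= t & v = t%:C *: w /\ c = t * p w.

Lemma ray_cone p w : cone (ray p w).
Proof.
split; first by exists 0; rewrite // rmorph0 scale0r mul0r.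
  move=> _ _ _ _ [s s0 [-> ->]] [t t0 [-> ->]]; exists (s + t); first exact: addr_ge0.
  by rewrite rmorphD scalerDl mulrDl.
move=> a _ _ a0 [s s0 [-> ->]]; exists (a * s); first by rewrite mulr_ge0// ltW.
by rewrite rmorphM scalerA mulrA.
Qed.

Lemma ray_le p w v c : sublinear p -> ray p w v c -> c <= p v.
Proof. by move=> sp [t t0 [-> ->]]; rewrite sp.2. Qed.

Lemma ray1 p w : ray p w w (p w).
Proof. by exists 1; rewrite ?ler01// rmorph1 scale1r mul1r. Qed.

(* Replacing [r] by [inf_cone r (ray r w)] passes to the face where [w] is
   maximal, so a functional that cannot be decreased in this way is linear. *)
Lemma minimal_linear r : sublinear r ->
  (forall w, inf_cone r (ray r w) = r) -> real_linear r.
Proof.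
move=> sr min.
have rD x y : r (x + y) = r x + r y.
  apply/eqP; rewrite eq_le sr.1/= -lerBrDr -{1}(min y).
  by apply: inf_cone_le (ray1 r y) => //; [move=> v c; exact: ray_le].
have rN x : r (- x) = - r x.
  by apply/eqP; rewrite -addr_eq0 -rD addNr sublinear0.
split=> // a x; have [a0|a0] := leP 0 a; first exact: sr.2.
rewrite -[a]opprK rmorphN scaleNr rN sr.2 ?mulNr// oppr_ge0; exact: ltW.
Qed.

(** A minimal sublinear functional below [inf_cone p Cn] cannot be lowered by any ray, so it is
    linear; lying below [inf_cone p Cn] gives both the bound and the constraints. *)
Theorem cone_extension p Cn : sublinear p -> cone Cn ->
  (forall v c, Cn v c -> c <= p v) ->
  exists f, [/\ real_linear f, forall v, f v <= p v & forall v c, Cn v c -> c <= f v].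
Proof.
move=> sp cC Cp; have sp' := inf_cone_sublinear sp cC Cp.
have [//|f [sf _ fp' fmin]] := @minimal_sublinear (fun=> True) _ _ sp' I.
have lf : real_linear f.
  apply: minimal_linear => // w; apply: fmin => //.
    by apply: inf_cone_sublinear => //; [exact: ray_cone|move=> ? ?; exact: ray_le].
  by apply: inf_cone_lep => //; [exact: ray_cone|move=> ? ?; exact: ray_le].
exists f; split=> // v; first by apply: le_trans (fp' v) _; exact: inf_cone_lep.
move=> c Cv; rewrite -[f v]opprK -real_linearN// lerNr.
apply: le_trans (fp' _) _; apply: le_trans (inf_cone_le sp Cp _ Cv) _.
by rewrite addNr sublinear0// add0r.
Qed.

(** Extremality among the linear minorants of [p], with [f] and [g] standing for the two parts
    already multiplied by their weights; no division by [a] is needed. *)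
Definition extreme p x := forall (a : R) f g, 0 <= a <= 1 ->
  real_linear f -> real_linear g ->
  (forall v, f v <= a * p v) -> (forall v, g v <= (1 - a) * p v) ->
  (forall v, f v + g v = x v) -> forall v, f v = a * x v.

(** The linear minorants of [r] form a face of those of [p]; exchanging the roles of [f] and [g]
    gives the bound on [g]. *)
Let face p r := forall (a : R) f g, 0 <= a <= 1 ->
  real_linear f -> real_linear g ->
  (forall v, f v <= a * p v) -> (forall v, g v <= (1 - a) * p v) ->
  (forall v, f v + g v <= r v) -> forall v, f v <= a * r v.

(** Passing to the minorants that are maximal at [w] keeps the face condition, so a minimal
    functional with this condition is linear: the face is a single point. *)
Lemma extreme_exists p : sublinear p ->
  exists x, [/\ real_linear x, forall v, x v <= p v & extreme p x].
Proof.
move=> sp; have [||r [sr fr rp rmin]] := @minimal_sublinear (face p) p _ sp.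
- move=> A A0 AP Atot a f g a01 lf lg fp gp fgA v.
  have AS h : A h -> sublinear h /\ forall u, h u <= p u by move=> /AP[].
  apply: le_mul_inf => //; first by case: A0 => h Ah; exists (h v), h.
  + exact: chain_lbound AS.
  + by case/andP: a01.
  move=> _ [h Ah <-]; have [_ fh _] := AP _ Ah.
  apply: (fh a f g) => // u; apply: le_trans (fgA u) _.
  by apply: ge_inf; [exact: chain_lbound AS|exists h].
- by move=> a f g.
have rl w v c : ray r w v c -> c <= r v by exact: ray_le.
have lr : real_linear r.
  apply: minimal_linear => // w; have cw := ray_cone r w; have rw := @rl w.
  apply: rmin => //; first exact: inf_cone_sublinear.
    move=> a f g a01 lf lg fp gp fgA v.
    have fgr u : f u + g u <= r u.
      by apply: le_trans (fgA u) _; exact: inf_cone_lep.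
    have fr' := fr a f g a01 lf lg fp gp fgr.
    have gr' u : g u <= (1 - a) * r u.
      apply: (fr (1 - a) g f) => //; first by lra.
        by move=> z; rewrite subKr.
      by move=> z; rewrite addrC.
    (* The constraint at [- w] gives [r w <= f w + g w], while the face condition bounds the two
       terms by [a * r w] and [(1 - a) * r w]. *)
    have fw : f w = a * r w.
      have : f (- w) + g (- w) <= - r w.
        apply: le_trans (fgA _) _.
        apply: le_trans (inf_cone_le sr rw _ (ray1 r w)) _.
        by rewrite addNr sublinear0// add0r.
      rewrite !real_linearN// => fgw; have := fr' w; have := gr' w; lra.
    apply: le_mul_inf_cone => //; first by case/andP: a01.
    move=> _ _ [t t0 [-> ->]]; have := fr' (v + t%:C *: w).
    by rewrite lf.1 lf.2 fw mulrBr lerBrDr mulrCA.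
  by move=> v; exact: inf_cone_lep.
exists r; split=> // a f g a01 lf lg fp gp fg v.
have fgr u : f u + g u <= r u by rewrite fg.
have fr' := fr a f g a01 lf lg fp gp fgr.
have gr' u : g u <= (1 - a) * r u.
  apply: (fr (1 - a) g f) => //; first by lra.
    by move=> z; rewrite subKr.
  by move=> z; rewrite addrC fg.
by have := fr' v; have := gr' v; have := fg v; lra.
Qed.

End Sublinear.

(** * Modulus, real part and conjugation of complex numbers *)

Section ComplexModulus.
Context (R : realType).
Implicit Types z w : R[i].

Lemma sqr_normcE z : normc z ^+ 2 = complex.Re z ^+ 2 + complex.Im z ^+ 2.
Proof. by case: z => a b /=; rewrite sqr_sqrtr// addr_ge0 ?sqr_ge0. Qed.

Lemma normcR (a : R) : normc a%:C = `|a|.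
Proof. by rewrite /= expr0n addr0 sqrtr_sqr. Qed.

Lemma normcJr z : normc (conjc z) = normc z.
Proof. by case: z => a b /=; rewrite sqrrN. Qed.

Lemma normc_real_ge0 (a : R) : 0 <= a -> normc a%:C = a.
Proof. by move=> a0; rewrite normcR ger0_norm. Qed.

Lemma mulcJ z : z * conjc z = (normc z ^+ 2)%:C.
Proof.
rewrite sqr_normcE; case: z => a b /=; apply/eqP; rewrite eq_complex /=.
by apply/andP; split; apply/eqP; ring.
Qed.

Lemma Re_le_normc z : complex.Re z <= normc z.
Proof.
rewrite (le_trans (ler_norm _))// -(@ler_pXn2r _ 2)// ?nnegrE ?normc_ge0//.
by rewrite sqr_normcE real_normK ?num_real// lerDl sqr_ge0.
Qed.

Lemma ReN z : complex.Re (- z) = - complex.Re z.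
Proof. by case: z. Qed.

Lemma ReD z w : complex.Re (z + w) = complex.Re z + complex.Re w.
Proof. by case: z; case: w. Qed.

Lemma ReM (a : R) z : complex.Re (a%:C * z) = a * complex.Re z.
Proof. by case: z => b c /=; rewrite mul0r subr0. Qed.

Lemma ReJ z : complex.Re (conjc z) = complex.Re z.
Proof. by case: z. Qed.

Lemma conjcMr (a : R) z : conjc (a%:C * z) = a%:C * conjc z.
Proof.
by case: z => b c; apply/eqP; rewrite eq_complex /=; apply/andP; split; apply/eqP; ring.
Qed.

Lemma Re_iM z : complex.Re ('i%C * z) = - complex.Im z.
Proof. by case: z => a b /=; rewrite mul0r mul1r sub0r. Qed.

Lemma normc_le_ReIm z : normc z <= `|complex.Re z| + `|complex.Im z|.
Proof.
rewrite -(@ler_pXn2r _ 2)// ?nnegrE ?normc_ge0 ?addr_ge0// sqr_normcE.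
rewrite sqrrD !real_normK ?num_real// addrAC lerDl.
by rewrite mulrn_wge0// mulr_ge0.
Qed.

Lemma normcB z w : normc (z - w) = normc (w - z).
Proof. by rewrite -normcN opprB. Qed.

Lemma polarization_scalar z w :
  z * conjc w = 4^-1%:C * ((normc (z + w) ^+ 2)%:C - (normc (z - w) ^+ 2)%:C
    + 'i * (normc (z + 'i * w) ^+ 2)%:C - 'i * (normc (z - 'i * w) ^+ 2)%:C).
Proof.
rewrite !sqr_normcE; case: z => a b; case: w => c d /=; apply/eqP; rewrite eq_complex /=.
by apply/andP; split; apply/eqP; field.
Qed.

End ComplexModulus.

(** * Unconditional summation of complex families *)

Section HasSum.
Context (R : realType) (I : choiceType).
Local Notation C := R[i].
Implicit Types (f g : I -> C) (s t c : C).

Definition has_sum f s := forall e : R, 0 < e ->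
  exists A : {fset I}, forall B : {fset I}, (A `<=` B)%fset ->
    normc (\sum_(i <- B) f i - s) < e.

Lemma has_sum_lim f s : has_sum f s -> lim (partial_sum f @ totally) = s.
Proof.
move=> fs; have tF := @totally_filter I.
apply: cvg_lim; first exact: norm_hausdorff.
apply/cvgrPdist_lt => e e0.
have eE : e = (complex.Re e)%:C by rewrite RRe_real// gtr0_real.
have {}e0 : 0 < complex.Re e by rewrite -ltcR -eE.
have [A AB] := fs _ e0; exists A => // B /= /AB.
by rewrite distrC eE -[ `|_| ]/((normc _)%:C) ltcR /partial_sum (big_seq_fsetE _ _ xpredT f).
Qed.

Lemma has_sumD f g s t : has_sum f s -> has_sum g t -> has_sum (f + g) (s + t).
Proof.
move=> fs gt e e0; have e2 : 0 < e / 2 by rewrite divr_gt0.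
have [A fA] := fs _ e2; have [B gB] := gt _ e2; exists (A `|` B)%fset => D.
rewrite fsubUset => /andP[/fA fD /gB gD].
rewrite big_split/= opprD addrACA (splitr e).
by apply: le_lt_trans (le_normcD _ _) _; exact: ltrD.
Qed.

Lemma has_sumZ f s c : has_sum f s -> has_sum (fun i => c * f i) (c * s).
Proof.
move=> fs e e0; have n0 : 0 < normc c + 1 by rewrite ltr_wpDl// normc_ge0.
have [A fA] := fs _ (divr_gt0 e0 n0); exists A => B /fA H.
rewrite -mulr_sumr -mulrBr normcM.
apply: (@le_lt_trans _ _ ((normc c + 1) * normc (\sum_(i <- B) f i - s))).
  by rewrite ler_wpM2r ?normc_ge0// lerDl.
by rewrite -ltr_pdivlMl// mulrC.
Qed.

Lemma has_sumJ f s : has_sum f s -> has_sum (fun i => conjc (f i)) (conjc s).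
Proof.
move=> fs e /fs[A fA]; exists A => B /fA.
by rewrite -(normcJr (_ - s)) rmorphB rmorph_sum.
Qed.

End HasSum.

(** * The inner product of l2 and the density of finitely supported vectors *)

Section HilbertSpace.
Context (R : realType) (I : choiceType).
Local Notation C := R[i].
Local Notation H := (ell2 R I).
Implicit Types (x y z : H) (c : C).

Lemma fsum_sqr_le (f : I -> C) (B : {fset I}) :
  ((\sum_(i <- B) normc (f i) ^+ 2)%:E <= sqnorm f)%E.
Proof.
rewrite -sumEFin fsbig_seq//=; apply: ereal_sup_ubound.
by exists [set` B].
Qed.

Lemma sqnorm_le (f : I -> C) (M : R) :
  (forall B : {fset I}, \sum_(i <- B) normc (f i) ^+ 2 <= M) -> (sqnorm f <= M%:E)%E.
Proof.
move=> fM; apply: ge_ereal_sup => _ [A [finA _] <-].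
by rewrite fsbig_finite//= sumEFin lee_fin fM.
Qed.

Lemma square_summable_le (f : I -> C) (M : R) :
  (forall B : {fset I}, \sum_(i <- B) normc (f i) ^+ 2 <= M) -> square_summable f.
Proof. by move=> /sqnorm_le fM; apply: le_lt_trans fM _; rewrite ltry. Qed.

Lemma ell2_sum_le x (B : {fset I}) : \sum_(i <- B) normc (x i) ^+ 2 <= ell2norm x ^+ 2.
Proof. by rewrite -lee_fin ell2norm_sqr fsum_sqr_le. Qed.

Lemma ell2norm_le x (M : R) : 0 <= M ->
  (forall B : {fset I}, \sum_(i <- B) normc (x i) ^+ 2 <= M ^+ 2) -> ell2norm x <= M.
Proof.
move=> M0 xM; rewrite -(@ler_pXn2r _ 2)// ?nnegrE ?ell2norm_ge0//.
by rewrite -lee_fin ell2norm_sqr sqnorm_le.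
Qed.

Lemma ler_sum_fset (F : I -> R) (A B : {fset I}) : (forall i, 0 <= F i) ->
  (A `<=` B)%fset -> \sum_(i <- A) F i <= \sum_(i <- B) F i.
Proof.
move=> F0 AB; rewrite [leRHS](big_fsetID _ (mem A)) /=.
have -> : [fset x in B | x \in A]%fset = A.
  by apply/fsetP => i; rewrite !inE andb_idl// => iA; apply: (fsubsetP AB).
by rewrite lerDl sumr_ge0.
Qed.

Lemma ell2_sum_ge x (e : R) : 0 < e ->
  exists A : {fset I}, ell2norm x ^+ 2 - e < \sum_(i <- A) normc (x i) ^+ 2.
Proof.
move=> e0; have lt : ((ell2norm x ^+ 2 - e)%:E < sqnorm x)%E.
  by rewrite -ell2norm_sqr lte_fin ltrBlDr ltrDl.
have [_ [A [finA _] <-]] := ereal_sup_gt lt.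
by rewrite fsbig_finite//= sumEFin lte_fin => ltA; exists (fset_set A).
Qed.

Lemma has_sum_sqr x : has_sum (fun t => (normc (x t) ^+ 2)%:C) (ell2norm x ^+ 2)%:C.
Proof.
move=> e /(ell2_sum_ge x)[A ltA]; exists A => B AB.
rewrite -rmorph_sum -rmorphB normcR distrC ger0_norm ?subr_ge0 ?ell2_sum_le//.
rewrite ltrBlDl -ltrBlDr; apply: lt_le_trans ltA _.
by apply: ler_sum_fset => // i; rewrite sqr_ge0.
Qed.

Lemma eq_has_sum (f g : I -> C) s : (forall i, f i = g i) -> has_sum f s -> has_sum g s.
Proof. by move=> /funext->. Qed.

(** [dotp] is a [lim], which is meaningless without convergence. Polarization writes each term
    through four squares, and the families of squares are summable. *)
Lemma dotpP x y : has_sum (fun t => x t * conjc (y t)) (dotp x y).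
Proof.
suff [s xys] : exists s, has_sum (fun t => x t * conjc (y t)) s.
  by rewrite -[dotp x y]/(lim _) (has_sum_lim xys).
have S z := @has_sum_sqr z.
eexists; apply: eq_has_sum; last first.
  apply: (has_sumZ 4^-1%:C).
  apply: (has_sumD (has_sumD (has_sumD (S (x + y)) (has_sumZ (-1) (S (x - y))))
    (has_sumZ 'i%C (S (x + 'i%C *: y)))) (has_sumZ (- 'i%C) (S (x - 'i%C *: y)))).
by move=> t; rewrite polarization_scalar !fctE mulN1r mulNr.
Qed.

Lemma dotp_has_sum x y s : has_sum (fun t => x t * conjc (y t)) s -> dotp x y = s.
Proof. exact: has_sum_lim. Qed.

Lemma dotpDl x y z : dotp (x + y) z = dotp x z + dotp y z.
Proof.
apply: dotp_has_sum; apply: eq_has_sum (has_sumD (dotpP x z) (dotpP y z)) => t.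
by rewrite fctE -mulrDl.
Qed.

Lemma dotpZl c x z : dotp (c *: x) z = c * dotp x z.
Proof.
apply: dotp_has_sum; apply: eq_has_sum (has_sumZ c (dotpP x z)) => t.
by rewrite mulrA.
Qed.

Lemma dotpC x y : dotp y x = conjc (dotp x y).
Proof.
apply: dotp_has_sum; apply: eq_has_sum (has_sumJ (dotpP x y)) => t.
by rewrite rmorphM /= conjcK mulrC.
Qed.

Lemma dotpDr x y z : dotp z (x + y) = dotp z x + dotp z y.
Proof. by rewrite dotpC dotpDl rmorphD /= -!dotpC. Qed.

Lemma dotpZr c x z : dotp z (c *: x) = conjc c * dotp z x.
Proof. by rewrite dotpC dotpZl rmorphM /= -dotpC. Qed.

Lemma dotpNl x z : dotp (- x) z = - dotp x z.
Proof. by rewrite -scaleN1r dotpZl mulN1r. Qed.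

Lemma dotpNr x z : dotp z (- x) = - dotp z x.
Proof. by rewrite dotpC dotpNl rmorphN /= -dotpC. Qed.

Lemma dotp0l z : dotp 0 z = 0.
Proof. by rewrite -(scale0r (0 : H)) dotpZl mul0r. Qed.

Lemma dotp0r z : dotp z 0 = 0.
Proof. by rewrite dotpC dotp0l conjc0. Qed.

Lemma dotp_suml (J : Type) (s : seq J) (F : J -> H) z :
  dotp (\sum_(j <- s) F j) z = \sum_(j <- s) dotp (F j) z.
Proof.
elim: s => [|a s IH]; first by rewrite !big_nil dotp0l.
by rewrite !big_cons dotpDl IH.
Qed.

Lemma dotpxx x : dotp x x = (ell2norm x ^+ 2)%:C.
Proof.
apply: dotp_has_sum; apply: eq_has_sum (has_sum_sqr x) => t; exact/esym/mulcJ.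
Qed.

Lemma Re_dotpC x y : complex.Re (dotp y x) = complex.Re (dotp x y).
Proof. by rewrite dotpC ReJ. Qed.

Lemma ell2normD_sqr x y :
  ell2norm (x + y) ^+ 2 = ell2norm x ^+ 2 + ell2norm y ^+ 2 + 2 * complex.Re (dotp x y).
Proof.
have := congr1 (@complex.Re R) (dotpxx (x + y)).
rewrite dotpDl !dotpDr !ReD !dotpxx (Re_dotpC x y) /= => <-; ring.
Qed.

Lemma ell2normN x : ell2norm (- x) = ell2norm x.
Proof. by rewrite -scaleN1r ell2normZ normcN normc1 mul1r. Qed.

Lemma cauchy_schwarz x y : normc (dotp x y) <= ell2norm x * ell2norm y.
Proof.
have [/ell2norm0_eq0->|y0] := eqVneq (ell2norm y) 0.
  by rewrite dotp0r normc0 mulr_ge0 ?ell2norm_ge0.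
have yp : 0 < ell2norm y by rewrite lt_neqAle eq_sym y0 ell2norm_ge0.
set d := dotp x y; set b := ell2norm y; set a := ell2norm x.
(* [c *: y] is the orthogonal projection of [x] on the line of [y]. *)
pose c := (b ^- 2)%:C * d.
have : 0 <= ell2norm (x - c *: y) ^+ 2 by rewrite sqr_ge0.
rewrite ell2normD_sqr ell2normN ell2normZ dotpNr dotpZr -/d -/a -/b ReN.
have -> : complex.Re (conjc c * d) = b ^- 2 * normc d ^+ 2.
  by rewrite /c conjcMr -mulrA ReM [conjc d * d]mulrC mulcJ.
rewrite /c normcM normc_real_ge0 ?invr_ge0 ?sqr_ge0// => H0.
rewrite -(@ler_pXn2r _ 2)// ?nnegrE ?normc_ge0 ?mulr_ge0 ?ell2norm_ge0//.
rewrite exprMn -ler_pdivrMr ?exprn_gt0//; move: H0.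
have -> : (b ^- 2 * normc d * b) ^+ 2 = normc d ^+ 2 / b ^+ 2 by field.
rewrite [b ^- 2 * _]mulrC; lra.
Qed.

Lemma Re_dotp_le x y : complex.Re (dotp x y) <= ell2norm x * ell2norm y.
Proof. exact: le_trans (Re_le_normc _) (cauchy_schwarz x y). Qed.

Lemma ell2_sumE (J : Type) (s : seq J) (F : J -> H) t :
  (\sum_(j <- s) F j) t = \sum_(j <- s) F j t.
Proof.
elim: s => [|a s IH]; first by rewrite !big_nil.
by rewrite !big_cons -IH.
Qed.

Definition finvec (B : {fset I}) (a : I -> C) : H := \sum_(i <- B) a i *: delta i.

Lemma finvecE (B : {fset I}) a t : finvec B a t = if t \in B then a t else 0.
Proof.
rewrite ell2_sumE; case: ifPn => tB; last first.
  rewrite big_seq big1// => i iB; rewrite -[LHS]/(a i * (t == i)%:R).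
  by case: eqP => [ti|_]; [move: tB; rewrite ti iB|rewrite mulr0].
rewrite (big_fsetD1 t)//= big_seq big1 => [|i].
  by rewrite -[X in X + _]/(a t * (t == t)%:R) eqxx mulr1 addr0.
rewrite !inE => /andP[ti _]; rewrite -[LHS]/(a i * (t == i)%:R).
by rewrite eq_sym (negPf ti) mulr0.
Qed.

Lemma dotp_finvecl (B : {fset I}) a y : dotp (finvec B a) y = \sum_(i <- B) a i * conjc (y i).
Proof.
by rewrite dotp_suml; apply: eq_bigr => i _; rewrite dotpZl dotp_deltal.
Qed.

Lemma finvec_norm (B : {fset I}) a :
  ell2norm (finvec B a) ^+ 2 = \sum_(i <- B) normc (a i) ^+ 2.
Proof.
apply: complexI; rewrite -dotpxx dotp_finvecl rmorph_sum big_seq [RHS]big_seq.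
by apply: eq_bigr => i iB; rewrite finvecE iB mulcJ.
Qed.

Lemma finvec_normB x (A : {fset I}) :
  ell2norm (x - finvec A x) ^+ 2 = ell2norm x ^+ 2 - \sum_(i <- A) normc (x i) ^+ 2.
Proof.
have -> : \sum_(i <- A) normc (x i) ^+ 2 = complex.Re (dotp x (finvec A x)).
  rewrite -Re_dotpC dotp_finvecl -[LHS]/(complex.Re ((_)%:C)) rmorph_sum.
  by congr complex.Re; apply: eq_bigr => i _; rewrite mulcJ.
rewrite ell2normD_sqr ell2normN dotpNr ReN finvec_norm.
have -> : \sum_(i <- A) normc (x i) ^+ 2 = complex.Re (dotp x (finvec A x)).
  rewrite -Re_dotpC dotp_finvecl -[LHS]/(complex.Re ((_)%:C)) rmorph_sum.
  by congr complex.Re; apply: eq_bigr => i _; rewrite mulcJ.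
by ring.
Qed.

Lemma finvec_dense x (e : R) : 0 < e ->
  exists A : {fset I}, ell2norm (x - finvec A x) < e.
Proof.
move=> e0; have [A] := ell2_sum_ge x (exprn_gt0 2 e0); exists A.
rewrite -(@ltr_pXn2r _ 2)// ?nnegrE ?ell2norm_ge0 ?ltW// finvec_normB; lra.
Qed.

Lemma eq0_small (a K : R) : 0 <= a -> (forall e, 0 < e -> a <= K * e) -> a = 0.
Proof.
move=> a0 H; apply/eqP; rewrite eq_le a0 andbT leNgt; apply/negP => ap.
have k0 : 0 < `|K| + 1 by rewrite ltr_wpDl.
have := H _ (divr_gt0 ap k0); rewrite mulrA ler_pdivlMr// mulrC ler_pM2r//.
by have := ler_norm K; lra.
Qed.

End HilbertSpace.

(** * Operator norm, adjoints, completeness and multiplication operators *)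

Section Operators.
Context (R : realType) (I : choiceType).
Local Notation C := R[i].
Local Notation H := (ell2 R I).
Local Notation B := (bop R I).
Implicit Types (x y z : H) (c : C) (T S : B).

Lemma bop_ext T S : (forall x, T x = S x) -> T = S.
Proof. by move=> TS; apply: val_inj; apply/funext. Qed.

Lemma ell2_ext x y : (forall i, x i = y i) -> x = y.
Proof. by move=> xy; apply: val_inj; apply/funext. Qed.

Lemma bopN T x : (- T) x = - T x. Proof. by []. Qed.

Lemma bop_sumE (J : Type) (s : seq J) (F : J -> B) x :
  (\sum_(j <- s) F j) x = \sum_(j <- s) F j x.
Proof.
elim: s => [|a s IH]; first by rewrite !big_nil.
by rewrite !big_cons -IH.
Qed.

Lemma bopZl c T S : (c *: T) * S = c *: (T * S).
Proof. by apply: bop_ext. Qed.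

Lemma bopZr c T S : T * (c *: S) = c *: (T * S).
Proof. by apply: bop_ext => x; rewrite !(bopME, bopZ) linearZ. Qed.

Lemma opnorm_bound T x : ell2norm (T x) <= opnorm T * ell2norm x.
Proof.
have [/ell2norm0_eq0->|x0] := eqVneq (ell2norm x) 0.
  by rewrite linear0 ell2norm0 mulr0.
have xp : 0 < ell2norm x by rewrite lt_neqAle eq_sym x0 ell2norm_ge0.
have := @opnorm_ub _ _ T ((ell2norm x)^-1%:C *: x).
rewrite linearZ/= !ell2normZ normc_real_ge0 ?invr_ge0 ?ell2norm_ge0//.
by rewrite mulVf// => /(_ (lexx _)); rewrite ler_pdivrMl// mulrC.
Qed.

Lemma opnorm_le_bound T (M : R) : 0 <= M ->
  (forall x, ell2norm (T x) <= M * ell2norm x) -> opnorm T <= M.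
Proof.
move=> M0 TM; apply: opnorm_le => x x1; apply: le_trans (TM x) _.
by rewrite -[leRHS]mulr1 ler_wpM2l.
Qed.

Lemma opnormM T S : opnorm (T * S) <= opnorm T * opnorm S.
Proof.
apply: opnorm_le_bound => [|x]; first by rewrite mulr_ge0 ?opnorm_ge0.
rewrite bopME; apply: le_trans (opnorm_bound _ _) _.
by rewrite -mulrA ler_wpM2l ?opnorm_ge0// opnorm_bound.
Qed.

Lemma opnormN T : opnorm (- T) = opnorm T.
Proof. by rewrite -scaleN1r opnormZ normcN normc1 mul1r. Qed.

Lemma opnormB T S : opnorm (T - S) = opnorm (S - T).
Proof. by rewrite -opnormN opprB. Qed.

Lemma opnorm0 : opnorm (0 : B) = 0.
Proof. by rewrite -(scale0r (0 : B)) opnormZ normc0 mul0r. Qed.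

Lemma opnorm1_le : opnorm (1 : B) <= 1.
Proof. by apply: opnorm_le_bound => // x; rewrite bop1E mul1r. Qed.

Lemma opnorm_sum (J : Type) (s : seq J) (F : J -> B) :
  opnorm (\sum_(j <- s) F j) <= \sum_(j <- s) opnorm (F j).
Proof.
elim: s => [|a s IH]; first by rewrite !big_nil opnorm0.
by rewrite !big_cons; apply: le_trans (opnormD _ _) _; rewrite lerD2l.
Qed.

Let adj_fun T y : I -> C := fun i => conjc (dotp (T (delta i)) y).

Let dotp_adj_fun T y (D : {fset I}) (a : I -> C) :
  dotp (T (finvec D a)) y = \sum_(i <- D) a i * conjc (adj_fun T y i).
Proof.
rewrite linear_sum dotp_suml; apply: eq_bigr => i _.
by rewrite linearZ dotpZl /adj_fun conjcK.
Qed.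

(** Testing [T] on the finite vector whose coordinates are the candidate coordinates themselves
    gives [s <= M * n] with [s = n ^+ 2], hence [n <= M]. *)
Let adj_fun_le T y (D : {fset I}) :
  \sum_(i <- D) normc (adj_fun T y i) ^+ 2 <= (opnorm T * ell2norm y) ^+ 2.
Proof.
set s := \sum_(i <- D) _.
have s0 : 0 <= s by apply: sumr_ge0 => i _; rewrite sqr_ge0.
have sE : s%:C = dotp (T (finvec D (adj_fun T y))) y.
  by rewrite dotp_adj_fun rmorph_sum; apply: eq_bigr => i _; rewrite mulcJ.
have : s <= opnorm T * ell2norm y * ell2norm (finvec D (adj_fun T y)).
  rewrite -[s]/(complex.Re s%:C) sE; apply: le_trans (Re_dotp_le _ _) _.
  by rewrite mulrAC ler_wpM2r ?ell2norm_ge0// opnorm_bound.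
have : ell2norm (finvec D (adj_fun T y)) ^+ 2 = s by exact: finvec_norm.
have := ell2norm_ge0 (finvec D (adj_fun T y)).
set n := ell2norm (finvec _ _); set M := opnorm T * ell2norm y => n0 ns sM.
have M0 : 0 <= M by rewrite mulr_ge0 ?opnorm_ge0 ?ell2norm_ge0.
have [nE|n0'] := eqVneq n 0; first by rewrite -ns nE expr0n /= sqr_ge0.
have np : 0 < n by rewrite lt_neqAle eq_sym n0'.
have nM : n <= M by rewrite -(ler_pM2r np) -expr2 ns.
by rewrite -ns ler_pXn2r.
Qed.

(** [adj] is a choice with default 0, so its rules rest on this existence. The two sides agree on
    finitely supported vectors, which are dense. *)
Lemma adj_exists T : exists S : B, forall x y, dotp (T x) y = dotp x (S y).
Proof.
have Ss y : square_summable (adj_fun T y) by exact: square_summable_le (adj_fun_le T y).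
pose S y : H := Ell2 (Ss y).
have Sle y : ell2norm (S y) <= opnorm T * ell2norm y.
  apply: ell2norm_le => [|D]; first by rewrite mulr_ge0 ?opnorm_ge0 ?ell2norm_ge0.
  exact: adj_fun_le.
have Sl : bounded_linear S.
  apply/asboolP; split; last by exists (opnorm T).
  move=> c x y; apply: ell2_ext => i.
  rewrite -[LHS]/(conjc _) dotpDr dotpZr -[RHS]/(c * conjc _ + conjc _).
  by rewrite rmorphD rmorphM /= conjcK.
exists (Bop Sl) => x y; rewrite -[Bop Sl y]/(S y).
apply/eqP; rewrite -subr_eq0; apply/eqP/eq0_normc.
apply: (@eq0_small _ _ (2 * (opnorm T * ell2norm y))); first exact: normc_ge0.
move=> e /(finvec_dense x)[D xD].
have TD : dotp (T (finvec D x)) y = dotp (finvec D x) (S y).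
  by rewrite dotp_adj_fun dotp_finvecl.
rewrite -(subrK (finvec D x) x); set z := x - _ in xD *.
rewrite linearD (dotpDl (T z)) (dotpDl z) TD opprD addrACA subrr addr0.
apply: le_trans (le_normcD _ _) _; rewrite normcN -mulrA [leRHS]mulr_natl mulr2n.
have ze : opnorm T * ell2norm y * ell2norm z <= opnorm T * ell2norm y * e.
  by apply: ler_wpM2l; [rewrite mulr_ge0 ?opnorm_ge0 ?ell2norm_ge0|exact: ltW].
apply: lerD; apply: le_trans (cauchy_schwarz _ _) _; apply: le_trans ze.
  by rewrite mulrAC ler_wpM2r ?ell2norm_ge0// opnorm_bound.
by rewrite mulrC ler_wpM2r ?ell2norm_ge0.
Qed.

Lemma adjP T x y : dotp (T x) y = dotp x (adj T y).
Proof.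
have [S TS] := adj_exists T.
by rewrite (adj_unique TS).
Qed.

Lemma adjP' T x y : dotp (adj T x) y = dotp x (T y).
Proof. by rewrite dotpC -adjP -dotpC. Qed.

Lemma adjK T : adj (adj T) = T.
Proof. by apply: adj_unique => x y; rewrite adjP'. Qed.

Lemma adjD T S : adj (T + S) = adj T + adj S.
Proof. by apply: adj_unique => x y; rewrite !bopD dotpDl dotpDr !adjP. Qed.

Lemma adjZ c T : adj (c *: T) = conjc c *: adj T.
Proof. by apply: adj_unique => x y; rewrite !bopZ dotpZl dotpZr conjcK adjP. Qed.

Lemma adjM T S : adj (T * S) = adj S * adj T.
Proof. by apply: adj_unique => x y; rewrite !bopME !adjP. Qed.

Lemma adj1 : adj 1 = 1 :> B.
Proof. by apply: adj_unique. Qed.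

Lemma adj0 : adj 0 = 0 :> B.
Proof. by apply: adj_unique => x y; rewrite dotp0l dotp0r. Qed.

Lemma adjN T : adj (- T) = - adj T.
Proof. by apply: adj_unique => x y; rewrite !bopN dotpNl dotpNr adjP. Qed.

Lemma adjB T S : adj (T - S) = adj T - adj S.
Proof. by rewrite adjD adjN. Qed.

Lemma adjZr (a : R) T : adj (a%:C *: T) = a%:C *: adj T.
Proof. by rewrite adjZ conjc_real. Qed.

Lemma adj_sum (J : Type) (s : seq J) (F : J -> B) :
  adj (\sum_(j <- s) F j) = \sum_(j <- s) adj (F j).
Proof.
elim: s => [|a s IH]; first by rewrite !big_nil adj0.
by rewrite !big_cons adjD IH.
Qed.

Lemma opnorm_adj_le T : opnorm (adj T) <= opnorm T.
Proof.
apply: opnorm_le_bound => [|x]; first exact: opnorm_ge0.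
have [->|x0] := eqVneq (ell2norm (adj T x)) 0.
  by rewrite mulr_ge0 ?opnorm_ge0 ?ell2norm_ge0.
have xp : 0 < ell2norm (adj T x) by rewrite lt_neqAle eq_sym x0 ell2norm_ge0.
rewrite -(ler_pM2r xp) -expr2 -[leLHS]/(complex.Re (_ ^+ 2)%:C) -dotpxx adjP'.
rewrite -Re_dotpC; apply: le_trans (Re_dotp_le _ _) _.
by rewrite mulrAC ler_wpM2r ?ell2norm_ge0// opnorm_bound.
Qed.

Lemma opnorm_adj T : opnorm (adj T) = opnorm T.
Proof. by apply/eqP; rewrite eq_le opnorm_adj_le/= -{1}(adjK T) opnorm_adj_le. Qed.

Lemma dotp_adjM T x : dotp (adj T (T x)) x = (ell2norm (T x) ^+ 2)%:C.
Proof. by rewrite adjP' dotpxx. Qed.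

(** The intervals of radius [d n] around [u n] meet pairwise, so the supremum of their left ends
    lies in all of them; [d] need not tend to 0. *)
Let real_limit (u : nat -> R) (d : nat -> R) :
  (forall n m, (n <= m)%N -> `|u m - u n| <= d n) -> exists l, forall n, `|l - u n| <= d n.
Proof.
move=> ud; pose E := [set u n - d n | n in [set: nat]].
have ub n m : u m - d m <= u n + d n.
  have [nm|/ltnW mn] := leqP n m.
    by have := ud _ _ nm; have := ud _ _ (leqnn m); rewrite subrr normr0 ler_norml; lra.
  by have := ud _ _ mn; have := ud _ _ (leqnn n); rewrite subrr normr0 ler_norml; lra.
exists (sup E) => n; rewrite ler_distl.
have E0 : E !=set0 by exists (u 0%N - d 0%N), 0%N.
apply/andP; split.
  by apply: ub_le_sup; [exists (u 0%N + d 0%N) => _ [m _ <-]|exists n].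
by apply: ge_sup => // _ [m _ <-].
Qed.

Let complex_limit (u : nat -> C) (d : nat -> R) :
  (forall n m, (n <= m)%N -> normc (u m - u n) <= d n) ->
  exists l, forall n, normc (l - u n) <= 2 * d n.
Proof.
move=> ud.
have Rele (z : C) : `|complex.Re z| <= normc z.
  by rewrite ler_norml Re_le_normc andbT lerNl -ReN -(normcN z) Re_le_normc.
have Imle (z : C) : `|complex.Im z| <= normc z.
  rewrite -normrN -Re_iM (le_trans (Rele _))// normcM.
  by rewrite [normc 'i]/= expr0n expr1n add0r sqrtr1 mul1r.
have [a aP] : exists a, forall n, `|a - complex.Re (u n)| <= d n.
  apply: real_limit => n m nm; apply: le_trans (ud _ _ nm).
  by rewrite -ReN -ReD Rele.
have [b bP] : exists b, forall n, `|b - complex.Im (u n)| <= d n.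
  apply: real_limit => n m nm; apply: le_trans (ud _ _ nm).
  by apply: le_trans (Imle _); case: (u m); case: (u n).
exists (a +i* b) => n; apply: le_trans (normc_le_ReIm _) _.
rewrite mulr2n mulrDl mul1r; have := aP n; have := bP n.
by case: (u n) => p q /= qb pa; apply: lerD.
Qed.

Lemma bop_complete (T : nat -> B) (e : nat -> R) :
  (forall n m, (n <= m)%N -> opnorm (T m - T n) <= e n) ->
  (forall d, 0 < d -> exists m0, forall m, (m0 <= m)%N -> e m < d) ->
  exists S, forall n, opnorm (S - T n) <= e n.
Proof.
move=> Te e_small.
have e0 n : 0 <= e n by apply: le_trans (Te n n (leqnn n)); exact: opnorm_ge0.
have Tx n m x : (n <= m)%N -> ell2norm (T m x - T n x) <= e n * ell2norm x.
  move=> nm; apply: le_trans (opnorm_bound (T m - T n) x) _.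
  by rewrite ler_wpM2r ?ell2norm_ge0// Te.
have lim x i : exists l, forall n, normc (l - T n x i) <= 2 * (e n * ell2norm x).
  apply: complex_limit => n m nm; apply: le_trans (Tx _ _ x nm).
  exact: (normc_le_ell2norm (T m x - T n x) i).
pose L x i := projT1 (cid (lim x i)).
have LP x i n : normc (L x i - T n x i) <= 2 * (e n * ell2norm x).
  exact: (projT2 (cid (lim x i))).
have small (a b K : R) n : 0 <= K -> (forall m, (n <= m)%N -> a <= b + K * e m) -> a <= b.
  move=> K0 ab; rewrite -subr_le0 leNgt; apply/negP => d0.
  have K1 : 0 < K + 1 by rewrite ltr_wpDl.
  have [m0 em] := e_small _ (divr_gt0 d0 K1).
  have /ab := leq_maxl n m0; have := em _ (leq_maxr n m0); have := e0 (maxn n m0).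
  rewrite ltr_pdivlMr//; nra.
(* The coordinatewise bound [LP] loses a factor and does not sum over [D]. It is only applied to
   [T m] with [m] large, where its contribution vanishes, and the uniform bound [Tx] does the
   rest. *)
have Lfin x n (D : {fset I}) :
    \sum_(i <- D) normc (L x i - T n x i) ^+ 2 <= (e n * ell2norm x) ^+ 2.
  rewrite -(finvec_norm D (fun i => L x i - T n x i)).
  rewrite ler_pXn2r ?nnegrE ?mulr_ge0 ?ell2norm_ge0//.
  apply: (small _ _ ((size D)%:R * (2 * ell2norm x)) n).
    by rewrite !mulr_ge0 ?ell2norm_ge0.
  move=> m nm.
  have -> : finvec D (fun i => L x i - T n x i) =
     finvec D (fun i => L x i - T m x i) + finvec D (fun i => (T m x - T n x) i).
    rewrite /finvec -big_split; apply: eq_bigr => i _ /=; rewrite -scalerDl.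
    by congr (_ *: _); rewrite addrA subrK.
  apply: le_trans (ell2normD _ _) _; rewrite addrC; apply: lerD.
    apply: le_trans (Tx _ _ x nm); rewrite -(@ler_pXn2r _ 2)// ?nnegrE ?ell2norm_ge0//.
    by rewrite finvec_norm ell2_sum_le.
  rewrite /finvec.
  have : ell2norm (\sum_(i <- D) (L x i - T m x i) *: delta i) <=
      \sum_(i <- D) 2 * (e m * ell2norm x).
    elim: (enum_fset D) => [|i s IH]; first by rewrite !big_nil ell2norm0.
    rewrite !big_cons; apply: le_trans (ell2normD _ _) _; apply: lerD => //.
    rewrite ell2normZ (_ : ell2norm (delta i) = 1) ?mulr1//.
    by apply/eqP; rewrite -(@eqrXn2 _ 2)// ?ell2norm_ge0// expr1n; apply/eqP/complexI;
      rewrite -dotpxx dotp_deltal -[delta i i]/((i == i)%:R) eqxx conjc1.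
  move=> /le_trans; apply; rewrite big_const_seq count_predT iter_addr addr0 -[leLHS]mulr_natl.
  by rewrite [e m * _]mulrC !mulrA.
have Ls x : square_summable (L x).
  rewrite (_ : L x = ((fun i => L x i - T 0%N x i) : I -> C) + T 0%N x); last first.
    by apply/funext => i; rewrite fctE subrK.
  have [_ sD] := @square_summable_submod R I.
  rewrite -[X in X + _]scale1r; apply: sD; first exact: square_summable_le (Lfin x 0%N).
  by case: (T 0%N x).
pose S x : H := Ell2 (Ls x).
have ST x n : ell2norm (S x - T n x) <= e n * ell2norm x.
  by apply: ell2norm_le => [|D]; [rewrite mulr_ge0 ?ell2norm_ge0|exact: Lfin].
have Sl : bounded_linear S.
  apply/asboolP; split; last first.
    exists (e 0%N + opnorm (T 0%N)) => x; rewrite mulrDl.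
    have -> : ell2norm (S x) = ell2norm ((S x - T 0%N x) + T 0%N x) by rewrite subrK.
    by apply: le_trans (ell2normD _ _) _; apply: lerD; [exact: ST|exact: opnorm_bound].
  move=> c x y; apply/eqP; rewrite -subr_eq0; apply/eqP/ell2norm0_eq0/eqP.
  rewrite eq_le ell2norm_ge0 andbT.
  apply: (small _ _ (ell2norm (c *: x + y) + normc c * ell2norm x + ell2norm y) 0%N).
    by rewrite !addr_ge0 ?mulr_ge0 ?normc_ge0 ?ell2norm_ge0.
  move=> m _; rewrite add0r.
  have -> : S (c *: x + y) - (c *: S x + S y) = (S (c *: x + y) - T m (c *: x + y))
      - c *: (S x - T m x) - (S y - T m y).
    have -> : T m (c *: x + y) = c *: T m x + T m y by exact: linearP.
    rewrite scalerBr !opprB -[RHS]addrA.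
    by rewrite (addrACA (c *: T m x)) -opprD [RHS]addrA subrK.
  rewrite !mulrDl; apply: le_trans (ell2normD _ _) _; apply: lerD; last first.
    by rewrite ell2normN mulrC; exact: ST.
  apply: le_trans (ell2normD _ _) _; apply: lerD; first by rewrite mulrC; exact: ST.
  by rewrite ell2normN ell2normZ -mulrA ler_wpM2l ?normc_ge0// mulrC; exact: ST.
by exists (Bop Sl) => n; apply: opnorm_le_bound => // x; exact: ST.
Qed.

Definition bounded_real (F : I -> R) := exists M, forall i, `|F i| <= M.

(** A choice, so that [F] need not carry a proof of boundedness; the rules below assume
    [bounded_real] instead. *)
Definition mulop (F : I -> R) : B :=
  xget 0 [set T : B | forall x i, T x i = (F i)%:C * x i].

Lemma mulopE F x i : bounded_real F -> mulop F x i = (F i)%:C * x i.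
Proof.
move=> [M FM].
have M0 : 0 <= M by apply: le_trans (FM i).
have le y (D : {fset I}) :
    \sum_(j <- D) normc ((F j)%:C * y j) ^+ 2 <= (M * ell2norm y) ^+ 2.
  rewrite exprMn; apply: (@le_trans _ _ (M ^+ 2 * \sum_(j <- D) normc (y j) ^+ 2)).
    rewrite mulr_sumr; apply: ler_sum => j _; rewrite normcM exprMn normcR.
    by rewrite ler_wpM2r ?sqr_ge0// ler_pXn2r ?nnegrE.
  by rewrite ler_wpM2l ?sqr_ge0// ell2_sum_le.
pose f y : H := Ell2 (square_summable_le (le y)).
have fl : bounded_linear f.
  apply/asboolP; split.
    by move=> c y z; apply: ell2_ext => j; rewrite /= !fctE /= mulrDr mulrCA.
  by exists M => y; apply: ell2norm_le => [|D]; [rewrite mulr_ge0 ?ell2norm_ge0|exact: le].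
have := @xgetPex _ 0 [set T : B | forall x i, T x i = (F i)%:C * x i].
by apply; exists (Bop fl).
Qed.

End Operators.

(** * Norm closure and star subalgebras *)

Section Closure.
Context (R : realType) (I : choiceType).
Local Notation B := (bop R I).

Lemma bop_closureP (D : set B) (T : B) :
  closure D T <-> forall e : R, 0 < e -> exists2 S, D S & opnorm (T - S) < e.
Proof.
split=> [DT e e0|DT U /nbhs_ballP[e /= e0 eU]].
  have [S [DS]] : D `&` ball T e%:C !=set0.
    by apply: DT; apply: nbhsx_ballx; rewrite ltcR.
  by rewrite -ball_normE /= -[ `|_| ]/((opnorm _)%:C) ltcR => TS; exists S.
have eE : e = (complex.Re e)%:C by rewrite RRe_real// gtr0_real.
have {}e0 : 0 < complex.Re e by rewrite -ltcR -eE.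
have [S DS TS] := DT _ e0; exists S; split=> //; apply: eU.
by rewrite -ball_normE /= eE -[ `|_| ]/((opnorm _)%:C) ltcR.
Qed.

Lemma bop_closedP (D : set B) : closed D <->
  forall T, (forall e : R, 0 < e -> exists2 S, D S & opnorm (T - S) < e) -> D T.
Proof.
split=> [cD T TD|H T /bop_closureP]; last exact: H.
by apply: cD; apply/bop_closureP.
Qed.

Section StarSubalgebra.
Variables (D : set B) (sD : star_subalgebra D).

Lemma star0 : D 0. Proof. by case: sD. Qed.

Lemma starZ (c : R[i]) T : D T -> D (c *: T).
Proof. by case: sD => D0 DP _ _ DT; rewrite -[_ *: _]addr0; exact: DP. Qed.

Lemma starD T S : D T -> D S -> D (T + S).
Proof. by case: sD => _ DP _ _ DT; rewrite -[T]scale1r; exact: DP. Qed.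

Lemma starB T S : D T -> D S -> D (T - S).
Proof. by move=> DT DS; apply: starD => //; rewrite -scaleN1r; exact: starZ. Qed.

Lemma starM T S : D T -> D S -> D (T * S).
Proof. by case: sD => _ _ DM _; exact: DM. Qed.

Lemma star_adj T : D T -> D (adj T).
Proof. by case: sD => _ _ _; exact. Qed.

Lemma star_sum (J : Type) (s : seq J) (F : J -> B) :
  (forall j, D (F j)) -> D (\sum_(j <- s) F j).
Proof. by move=> DF; elim/big_ind: _ => //; [exact: star0|exact: starD]. Qed.

End StarSubalgebra.

End Closure.

(** * Square roots and negative parts inside a C*-algebra *)

Section SquareRoot.
Context (R : realType) (I : choiceType).
Local Notation B := (bop R I).
Local Notation half := (2^-1%:C : R[i]).
Implicit Types (h y T S : B) (D : set B).

(** A fixed point [y] of this iteration satisfies [(1 - y) * (1 - y) = 1 - h]; the iterates are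
    polynomials in [h] converging to one minus the square root of [1 - h]. *)
Fixpoint sqrt_seq h n : B :=
  if n is m.+1 then half *: (h + sqrt_seq h m * sqrt_seq h m) else 0.

Let c_ : nat -> R := fix c n := if n is m.+1 then (1 + c m ^+ 2) / 2 else 0.

Let cS n : c_ n.+1 = (1 + c_ n ^+ 2) / 2. Proof. by []. Qed.

Let c01 n : 0 <= c_ n <= 1.
Proof.
elim: n => [|n /andP[c0 c1]]; first by rewrite lexx ler01.
by rewrite cS; apply/andP; split; nra.
Qed.

Let c_rate n : 1 - c_ n <= 2 / (n.+2)%:R.
Proof.
elim: n => [|n IH]; first by rewrite subr0 divff.
have /andP[c0 c1] := c01 n.
have n0 : 0 < n.+2%:R :> R by rewrite ltr0n.
have -> : (n.+3)%:R = n.+2%:R + 1 :> R by rewrite -natr1.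
move: IH; rewrite cS; set N := n.+2%:R in n0 *.
have n1 : 2 <= N by rewrite /N ler_nat.
have n2 : 0 < N + 1 by lra.
rewrite !ler_pdivlMr//.
(* [t] is the slack in the induction hypothesis; written with it, the required difference is a sum
   of nonnegative terms. *)
set c := c_ n in c0 c1 * => IH; pose t := 2 - (1 - c) * N.
have t0 : 0 <= t by rewrite /t; lra.
rewrite -subr_ge0 -(pmulr_rge0 _ (exprn_gt0 2 n0)).
have -> : N ^+ 2 * (2 - (1 - (1 + c ^+ 2) / 2) * (N + 1)) =
    2 + (N + 1) * (t * (N - 2) + t ^+ 2 / 2) by rewrite /t; field.
have N2 : 0 <= N - 2 by lra.
apply: addr_ge0 => //; apply: mulr_ge0; first exact: ltW.
by apply: addr_ge0; [exact: mulr_ge0|rewrite mulr_ge0 ?sqr_ge0 ?invr_ge0].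
Qed.

Let halfnorm T : opnorm (half *: T) = opnorm T / 2.
Proof. by rewrite opnormZ normc_real_ge0 ?invr_ge0 ?ler0n// mulrC. Qed.

Let halfD T : half *: T + half *: T = T.
Proof.
by rewrite -scalerDl -rmorphD (_ : 2^-1 + 2^-1 = 1 :> R) ?rmorph1 ?scale1r//; lra.
Qed.

Lemma sqrB_split (T S : B) : T * T - S * S = T * (T - S) + (T - S) * S.
Proof. by rewrite mulrBr mulrBl addrA subrK. Qed.

(* Comparison with the scalar iteration c' = (1 + c^2) / 2, which increases to 1. *)
Lemma sqrt_fixpoint h : opnorm h <= 1 ->
  exists y, y + y = h + y * y /\
    forall D, closed D -> D 0 -> (forall S, D S -> D (half *: (h + S * S))) -> D y.
Proof.
move=> h1; pose y := sqrt_seq h.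
have yS n : y n.+1 = half *: (h + y n * y n) by [].
have yc n : opnorm (y n) <= c_ n.
  elim: n => [|n IH]; first by rewrite opnorm0.
  rewrite yS halfnorm cS ler_wpM2r ?invr_ge0 ?ler0n//.
  apply: le_trans (opnormD _ _) _; apply: lerD => //.
  by apply: le_trans (opnormM _ _) _; rewrite expr2 ler_pM ?opnorm_ge0.
have ydiff n : opnorm (y n.+1 - y n) <= c_ n.+1 - c_ n.
  elim: n => [|n IH].
    rewrite subr0 yS halfnorm mulr0 addr0 cS expr0n /= addr0 subr0.
    by rewrite ler_wpM2r ?invr_ge0 ?ler0n.
  rewrite {1}(yS n.+1) {1}(yS n) -scalerBr halfnorm opprD addrACA subrr add0r.
  rewrite sqrB_split.
  have -> : c_ n.+2 - c_ n.+1 =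
      (c_ n.+1 * (c_ n.+1 - c_ n) + (c_ n.+1 - c_ n) * c_ n) / 2.
    by have := cS n; rewrite (cS n.+1); move: (c_ n.+1) (c_ n) => b a ->; field.
  rewrite ler_wpM2r ?invr_ge0 ?ler0n//; apply: le_trans (opnormD _ _) _.
  apply: lerD; apply: le_trans (opnormM _ _) _.
    exact: (ler_pM (opnorm_ge0 _) (opnorm_ge0 _) (yc n.+1) IH).
  exact: (ler_pM (opnorm_ge0 _) (opnorm_ge0 _) IH (yc n)).
have ycauchy n k : opnorm (y (n + k)%N - y n) <= c_ (n + k)%N - c_ n.
  elim: k => [|k IH]; first by rewrite addn0 !subrr opnorm0.
  rewrite addnS; set k' := (n + k)%N in IH *.
  have -> : y k'.+1 - y n = (y k'.+1 - y k') + (y k' - y n) by rewrite addrA subrK.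
  have -> : c_ k'.+1 - c_ n = (c_ k'.+1 - c_ k') + (c_ k' - c_ n) by rewrite addrA subrK.
  by apply: le_trans (opnormD _ _) _; apply: lerD => //; exact: ydiff.
have [n m nm|d d0|z zP] := @bop_complete _ _ y (fun n => 1 - c_ n).
- rewrite -(subnKC nm); apply: le_trans (ycauchy _ _) _.
  by have /andP[_] := c01 (n + (m - n))%N; lra.
- have [k kd] : exists k : nat, 2 / d < k%:R.
    by exists (Num.truncn (2 / d)).+1; rewrite truncnS_gt.
  exists k => m km; apply: le_lt_trans (c_rate m) _.
  rewrite ltr_pdivrMr ?ltr0n// -ltr_pdivrMl// mulrC; apply: lt_le_trans kd _.
  by rewrite ler_nat; apply: leq_trans km _; rewrite -addn2 leq_addr.
have small e : 0 < e -> exists n, 1 - c_ n < e.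
  move=> e0; have [k kd] : exists k : nat, 2 / e < k%:R.
    by exists (Num.truncn (2 / e)).+1; rewrite truncnS_gt.
  exists k; apply: le_lt_trans (c_rate k) _.
  rewrite ltr_pdivrMr ?ltr0n// -ltr_pdivrMl// mulrC; apply: lt_le_trans kd _.
  by rewrite ler_nat -addn2 leq_addr.
exists z; split; last first.
  move=> D /bop_closedP cD D0 DS; apply: cD => e /small[n ne].
  by exists (y n); [elim: (n) => //= k IH; exact: DS|apply: le_lt_trans (zP n) ne].
have z1 : opnorm z <= 1 by have := zP 0%N; rewrite /y/= !subr0.
apply/eqP; rewrite -subr_eq0; apply/eqP/opnorm0_eq0.
apply: (@eq0_small _ _ 4); first exact: opnorm_ge0.
move=> e /small[n ne].
have -> : z + z - (h + z * z) = (z - y n.+1) + (z - y n.+1) - (z * z - y n * y n).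
  have hy : h + y n * y n = y n.+1 + y n.+1.
    by rewrite yS halfD.
  by rewrite (addrACA z) -(opprD (y n.+1)) -hy -[RHS]addrA opprB; congr (_ + _); rewrite !opprD -[RHS]addrA addKr.
have cn : c_ n <= c_ n.+1 by rewrite cS; have := c01 n; nra.
have /andP[c0 c1] := c01 n.
have e1 : opnorm (z - y n.+1) <= e by apply: le_trans (zP _) _; lra.
have e2 : opnorm (z - y n) <= e by apply: le_trans (zP _) _; lra.
have e0 : 0 <= e by apply: le_trans e1; exact: opnorm_ge0.
apply: le_trans (opnormD _ _) _; rewrite opnormN sqrB_split.
have := opnormD (z - y n.+1) (z - y n.+1).
have := opnormD (z * (z - y n)) ((z - y n) * y n).
have := opnormM z (z - y n); have := opnormM (z - y n) (y n).
have : opnorm z * opnorm (z - y n) <= 1 * e by rewrite ler_pM ?opnorm_ge0.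
have : opnorm (z - y n) * opnorm (y n) <= e * 1.
  by rewrite ler_pM ?opnorm_ge0//; apply: le_trans (yc n) _.
lra.
Qed.

Let commutant T := [set S : B | S * T = T * S].

Let closed_commutant T : closed (commutant T).
Proof.
apply/bop_closedP => S SD; apply/eqP; rewrite -subr_eq0; apply/eqP/opnorm0_eq0.
apply: (@eq0_small _ _ (2 * opnorm T)); first exact: opnorm_ge0.
move=> e /SD[S' S'T SS'].
have -> : S * T - T * S = (S - S') * T - T * (S - S').
  by rewrite mulrBl mulrBr S'T opprB addrA subrK.
apply: le_trans (opnormD _ _) _; rewrite opnormN.
have := opnormM (S - S') T; have := opnormM T (S - S').
have := opnorm_ge0 T; nra.
Qed.

Lemma closed_selfadj : closed [set S : B | adj S = S].
Proof.
apply/bop_closedP => S SD; apply/eqP; rewrite -subr_eq0; apply/eqP/opnorm0_eq0.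
apply: (@eq0_small _ _ 2); first exact: opnorm_ge0.
move=> e /SD[S' S'a SS'].
have -> : adj S - S = adj (S - S') - (S - S').
  by rewrite adjB S'a opprB addrA subrK.
by apply: le_trans (opnormD _ _) _; rewrite opnormN opnorm_adj; lra.
Qed.

Lemma closed_unit_ball : closed [set S : B | opnorm S <= 1].
Proof.
apply/bop_closedP => S SD; rewrite /= leNgt; apply/negP; rewrite -subr_gt0.
move=> /SD[S' S'1 SS']; have := opnormD (S - S') S'.
by rewrite subrK; move: S'1 => /=; lra.
Qed.

(** Each property of [y] is read off the iterates through one closed set: the algebra, the
    selfadjoint elements, the unit ball, a commutant. *)
Lemma sqrt_exists D h : cstar_subalgebra D -> D 1 -> D h -> adj h = h -> opnorm h <= 1 ->
  exists y, [/\ D y, adj y = y, opnorm y <= 1, (1 - y) * (1 - y) = 1 - h &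
    forall T, h * T = T * h -> y * T = T * y].
Proof.
move=> [[D0 DP DM _] cD] D1 Dh ha h1; have [y [yE yD]] := sqrt_fixpoint h1.
exists y; split.
- apply: yD => // S DS; rewrite -[_ *: _]addr0; apply: (DP) => //.
  by rewrite -[h]scale1r; apply: (DP) => //; exact: (DM).
- apply: (yD [set S | adj S = S]) => /=; [exact: closed_selfadj|exact: adj0|].
  by move=> S Sa; rewrite adjZr adjD adjM Sa ha.
- apply: (yD [set S | opnorm S <= 1]) => /=; first exact: closed_unit_ball.
    by rewrite opnorm0.
  move=> S S1; rewrite halfnorm ler_pdivrMr// mul1r.
  apply: le_trans (opnormD _ _) _; apply: lerD => //.
  by apply: le_trans (opnormM _ _) _; rewrite -[1]mulr1 ler_pM ?opnorm_ge0.
- have -> : (1 - y) * (1 - y) = 1 - (y + y) + y * y.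
    by rewrite mulrBl mul1r mulrBr mulr1 opprB opprD !addrA addrAC.
  by rewrite yE opprD addrA subrK.
- move=> T hT; apply: (yD (commutant T)); rewrite /commutant /=.
  + exact: closed_commutant.
  + by rewrite mul0r mulr0.
  + move=> S ST; rewrite bopZl bopZr mulrDl mulrDr hT -mulrA ST mulrA ST.
    by rewrite mulrA.
Qed.

(** Lets [sqrt_exists] be applied to [1 - T * T], which yields the absolute value of [T]. *)
Lemma opnorm_1Bsqr T : adj T = T -> opnorm T <= 1 -> opnorm (1 - T * T) <= 1.
Proof.
move=> Ta T1; apply: opnorm_le_bound => // x; rewrite mul1r.
rewrite -(@ler_pXn2r _ 2)// ?nnegrE ?ell2norm_ge0//.
rewrite -[(1 - T * T) x]/(x - T (T x)) ell2normD_sqr ell2normN dotpNr ReN.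
have -> : dotp x (T (T x)) = dotp (T x) (T x) by rewrite [RHS]adjP Ta.
rewrite dotpxx -[complex.Re _]/(ell2norm (T x) ^+ 2).
have : ell2norm (T (T x)) ^+ 2 <= ell2norm (T x) ^+ 2.
  rewrite ler_pXn2r ?nnegrE ?ell2norm_ge0//; apply: le_trans (opnorm_bound _ _) _.
  by rewrite ler_piMl ?ell2norm_ge0.
have := sqr_ge0 (ell2norm (T x)); lra.
Qed.

(* [n] is the negative part of [y] and [m * m] its absolute value. *)
Lemma negative_part D y : cstar_subalgebra D -> D 1 -> D y -> adj y = y ->
  opnorm y <= 1 -> exists m n, [/\ D m, D n, adj m = m, adj n = n &
    y = m * m - (n + n) /\ adj (m * n) * y * (m * n) = - ((n * n) * (n * n))].
Proof.
move=> sD D1 Dy ya y1; have [[D0 DP DM _] cD] := sD.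
have DB T S : D T -> D S -> D (T - S) by exact: (starB sD.1).
(* [1 - u] is the absolute value of [y]; below, [1 - v] is the square root of [1 - u]. *)
have [u [Du ua u1 uE uC]] : exists u, [/\ D u, adj u = u, opnorm u <= 1,
    (1 - u) * (1 - u) = y * y & u * y = y * u].
  have [|||u [Du ua u1 uE uC]] := @sqrt_exists D (1 - y * y) sD D1.
  - by apply: (DB) => //; exact: (DM).
  - by rewrite adjB adjM ya adj1.
  - exact: opnorm_1Bsqr.
  - exists u; split=> //; first by rewrite uE opprB addrC subrK.
    by apply: uC; rewrite mulrBl mulrBr mul1r mulr1 mulrA.
have [v [Dv va _ vE vC]] := sqrt_exists sD D1 Du ua u1.
pose r := 1 - u; pose m := 1 - v; pose n := half *: (r - y).
have rE : m * m = r by exact: vE.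
have ra : adj r = r by rewrite adjB adj1 ua.
have ma : adj m = m by rewrite adjB adj1 va.
have na : adj n = n by rewrite adjZr adjB ra ya.
have ry : r * y = y * r by rewrite mulrBl mulrBr mul1r mulr1 uC.
have my : m * y = y * m by rewrite mulrBl mulrBr mul1r mulr1 vC// uC.
have r2 : r * r = y * y by exact: uE.
have Dr : D r by apply: (DB).
have Dm : D m by apply: (DB).
clearbody r m.
have n2 : n + n = r - y.
  by rewrite halfD.
have yE : y = r - (n + n) by rewrite n2 opprB addrC subrK.
have pE : r - n = half *: (r + y).
  have rr : r = half *: (r + r).
    by rewrite scalerDr halfD.
  by rewrite /n {1}rr -scalerBr opprB addrA addrAC addrK.
(* [(r - n) * n] is a quarter of [(r + y) * (r - y)], which vanishes: positive and negative parts
   are orthogonal. Consequently [y * n = - (n * n)]. *)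
have rn : r * n = n * n.
  apply/eqP; rewrite -subr_eq0 -mulrBl pE /n bopZl bopZr.
  by rewrite mulrDl !mulrBr ry r2 addrA subrK subrr !scaler0.
have nr : n * r = r * n by rewrite /n bopZl bopZr mulrBl mulrBr ry.
have mr : m * r = r * m by rewrite -rE mulrA.
have mn : m * n = n * m by rewrite /n bopZl bopZr mulrBl mulrBr mr my.
exists m, n; split=> //; first by apply: (starZ sD.1); exact: DB.
split; first by rewrite rE.
rewrite adjM na ma -!mulrA [m * (y * _)]mulrA my -mulrA [m * (m * n)]mulrA rE rn.
rewrite {1}yE mulrBl mulrDl !mulrBr mulrDr.
have -> : r * (n * n) = n * (n * n) by rewrite mulrA rn mulrA.
by rewrite opprD addrA subrr sub0r !mulrA.
Qed.

End SquareRoot.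

(** * The numerical range and states on all bounded operators *)

Section NumericalSup.
Context (R : realType) (G : groupType).
Local Notation C := R[i].
Local Notation H := (ell2 R G).
Local Notation B := (bop R G).
Implicit Types (x y z : H) (c : C) (T S Y Z : B).

Definition form T x : R := complex.Re (dotp (T x) x).

Lemma formD T S x : form (T + S) x = form T x + form S x.
Proof. by rewrite /form bopD dotpDl ReD. Qed.

Lemma formZ (a : R) T x : form (a%:C *: T) x = a * form T x.
Proof. by rewrite /form bopZ dotpZl ReM. Qed.

Lemma formN T x : form (- T) x = - form T x.
Proof. by rewrite /form bopN dotpNl ReN. Qed.

Lemma form1 x : form 1 x = ell2norm x ^+ 2.
Proof. by rewrite /form bop1E dotpxx. Qed.

Lemma form_adj T x : form (adj T) x = form T x.
Proof. by rewrite /form adjP' Re_dotpC. Qed.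

Lemma form_conj Y T x : form (adj Y * T * Y) x = form T (Y x).
Proof. by rewrite /form !bopME adjP'. Qed.

Lemma form_sqr T x : form (adj T * T) x = ell2norm (T x) ^+ 2.
Proof. by rewrite -(mulr1 (adj T)) form_conj form1. Qed.

Lemma form_scale T (a : R) x : form T (a%:C *: x) = a ^+ 2 * form T x.
Proof.
by rewrite /form linearZ dotpZl dotpZr conjc_real !ReM mulrA expr2.
Qed.

Lemma form_le_opnorm T x : form T x <= opnorm T * ell2norm x ^+ 2.
Proof.
apply: le_trans (Re_dotp_le _ _) _; rewrite expr2 mulrA.
by rewrite ler_wpM2r ?ell2norm_ge0// opnorm_bound.
Qed.

Lemma ell2norm_delta (s : G) : ell2norm (delta s : H) = 1.
Proof.
apply/eqP; rewrite -(@eqrXn2 _ 2)// ?ell2norm_ge0// expr1n; apply/eqP/complexI.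
by rewrite -dotpxx dotp_deltal -[delta s s]/((s == s)%:R) eqxx conjc1.
Qed.

(** Sublinear and unchanged by conjugation with group unitaries, which the operator norm also is;
    unlike the norm it is one-sided, so its linear minorants are positive. *)
Definition nsup T := sup [set form T x | x in [set x | ell2norm x = 1]].

Let form_unit_le T x : ell2norm x = 1 -> form T x <= opnorm T.
Proof. by move=> x1; apply: le_trans (form_le_opnorm _ _) _; rewrite x1 expr1n mulr1. Qed.

Lemma nsup_unit T x : ell2norm x = 1 -> form T x <= nsup T.
Proof.
move=> x1; apply: ub_le_sup; last by exists x.
by exists (opnorm T) => _ [y y1 <-]; exact: form_unit_le.
Qed.

Lemma nsup_ub T x : form T x <= nsup T * ell2norm x ^+ 2.
Proof.
have [/ell2norm0_eq0->|x0] := eqVneq (ell2norm x) 0.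
  by rewrite /form linear0 dotp0l ell2norm0 expr0n mulr0.
have xp : 0 < ell2norm x by rewrite lt_neqAle eq_sym x0 ell2norm_ge0.
have := @nsup_unit T ((ell2norm x)^-1%:C *: x).
rewrite form_scale ell2normZ normc_real_ge0 ?invr_ge0 ?ell2norm_ge0// mulVf//.
by move=> /(_ erefl); rewrite exprVn ler_pdivrMl ?exprn_gt0// mulrC.
Qed.

Lemma nsup_le T (M : R) : (forall x, form T x <= M * ell2norm x ^+ 2) -> nsup T <= M.
Proof.
move=> TM; apply: ge_sup => [|_ [x /= x1 <-]].
  by exists (form T (delta 1%g)), (delta 1%g) => //; exact: ell2norm_delta.
by apply: le_trans (TM x) _; rewrite x1 expr1n mulr1.
Qed.

Lemma nsup_le_opnorm T : nsup T <= opnorm T.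
Proof. by apply: nsup_le => x; exact: form_le_opnorm. Qed.

Lemma nsup_sublinear : sublinear nsup.
Proof.
apply: (@sup_family_sublinear _ _ _ [set x | ell2norm x = 1] (fun x T => form T x)).
- by exists (delta 1%g); exact: ell2norm_delta.
- by move=> x _; split=> [T S|a T]; rewrite ?formD ?formZ.
- by move=> T; exists (opnorm T) => _ [x x1 <-]; exact: form_unit_le.
Qed.

(** The real part of a state on all bounded operators; [cstate] recovers the complex functional. *)
Definition rstate (f : B -> R) := real_linear f /\ forall T, f T <= nsup T.

Section RState.
Variables (f : B -> R) (sf : rstate f).
Let lf := sf.1.

Lemma rstate_mono T S : (forall x, form T x <= form S x) -> f T <= f S.
Proof.
move=> TS; rewrite -subr_le0 -real_linearB//; apply: le_trans (sf.2 _) _.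
by apply: nsup_le => x; rewrite mul0r formD formN subr_le0.
Qed.

Lemma rstate_form_eq T S : (forall x, form T x = form S x) -> f T = f S.
Proof. by move=> TS; apply/eqP; rewrite eq_le !rstate_mono// => x; rewrite TS. Qed.

Lemma rstate_adj T : f (adj T) = f T.
Proof. by apply: rstate_form_eq => x; rewrite form_adj. Qed.

Lemma rstate1 : f 1 = 1.
Proof.
apply/eqP; rewrite eq_le; apply/andP; split.
  by apply: le_trans (sf.2 _) _; apply: nsup_le => x; rewrite form1 mul1r.
rewrite -lerN2 -real_linearN//; apply: le_trans (sf.2 _) _.
by apply: nsup_le => x; rewrite formN form1 mulN1r.
Qed.

Lemma rstate_const (a : R) : f (a%:C *: (1 : B)) = a.
Proof. by rewrite lf.2 rstate1 mulr1. Qed.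

Lemma rstate_sqr_ge0 T : 0 <= f (adj T * T).
Proof.
rewrite -(real_linear0 lf); apply: rstate_mono => x.
by rewrite form_sqr /form dotp0l sqr_ge0.
Qed.

Lemma rstate_le_opnorm T : f T <= opnorm T.
Proof. exact: le_trans (sf.2 _) (nsup_le_opnorm _). Qed.

Lemma rstate_norm T : `|f T| <= opnorm T.
Proof.
by rewrite ler_norml rstate_le_opnorm andbT lerNl -real_linearN// -opnormN rstate_le_opnorm.
Qed.

Lemma rstate_conj_le Y T (M : R) : nsup T <= M ->
  f (adj Y * T * Y) <= M * f (adj Y * Y).
Proof.
move=> TM; rewrite -lf.2; apply: rstate_mono => x.
rewrite form_conj formZ form_sqr; apply: le_trans (nsup_ub _ _) _.
by rewrite ler_wpM2r ?sqr_ge0.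
Qed.

Lemma rstate_cauchy_schwarz Y Z :
  f (adj Y * Z) ^+ 2 <= f (adj Y * Y) * f (adj Z * Z).
Proof.
set a := f (adj Y * Y); set b := f (adj Y * Z); set d := f (adj Z * Z).
have sym : f (adj Z * Y) = b by rewrite -rstate_adj adjM adjK.
have H (s t : R) : 0 <= s ^+ 2 * a + 2 * (s * t * b) + t ^+ 2 * d.
  have := rstate_sqr_ge0 (s%:C *: Y + t%:C *: Z).
  rewrite adjD !adjZr mulrDl !mulrDr !bopZl !bopZr !scalerA -!rmorphM.
  by rewrite !lf.1 !lf.2 -/a -/b -/d sym => /le_trans; apply; rewrite le_eqVlt; apply/orP; left; apply/eqP; ring.
have a0 : 0 <= a by exact: rstate_sqr_ge0.
have d0 : 0 <= d by exact: rstate_sqr_ge0.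
have [d0'|d1] := eqVneq d 0.
  have [->|b0] := eqVneq b 0; first by rewrite expr0n mulr_ge0.
  (* For [d = 0] the form is affine in its second argument; this argument makes its value -1. *)
  have := H 1 (- (a + 1) / (2 * b)); rewrite d0' mulr0.
  have -> : 1 ^+ 2 * a + 2 * (1 * (- (a + 1) / (2 * b)) * b) + 0 = -1 by field.
  by rewrite lerNr oppr0 ler10.
have dp : 0 < d by rewrite lt_neqAle eq_sym d1.
have := H d (- b).
have -> : d ^+ 2 * a + 2 * (d * - b * b) + (- b) ^+ 2 * d = d * (a * d - b ^+ 2) by ring.
by rewrite pmulr_rge0// subr_ge0.
Qed.

Lemma rstate_null_l Y Z : f (adj Y * Y) = 0 -> f (adj Y * Z) = 0.
Proof.
move=> Y0; apply/eqP; rewrite -sqrf_eq0 eq_le sqr_ge0 andbT.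
by apply: le_trans (rstate_cauchy_schwarz _ _) _; rewrite Y0 mul0r.
Qed.

Lemma rstate_null_r Y Z : f (adj Y * Y) = 0 -> f (Z * Y) = 0.
Proof. by move=> Y0; rewrite -rstate_adj adjM rstate_null_l. Qed.

End RState.

Definition cstate (f : B -> R) T : C := (f T) +i* (- f ('i%C *: T)).

Lemma Re_cstate f T : complex.Re (cstate f T) = f T. Proof. by []. Qed.

Lemma cstate_norm_le f T : rstate f -> normc (cstate f T) <= 2 * opnorm T.
Proof.
move=> sf; apply: le_trans (normc_le_ReIm _) _.
have -> : 2 * opnorm T = opnorm T + opnorm ('i%C *: T).
  rewrite opnormZ -[normc 'i%C]/(Num.sqrt (0 ^+ 2 + 1 ^+ 2)) expr0n expr1n add0r sqrtr1 mul1r.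
  by rewrite mulr_natl mulr2n.
by rewrite lerD//= ?normrN rstate_norm.
Qed.

Lemma cstate_linear f : real_linear f ->
  forall c T S, cstate f (c *: T + S) = c * cstate f T + cstate f S.
Proof.
move=> [fD fZ] c T S; rewrite /cstate scalerDr !fD scalerA.
have cT (d : C) : f (d *: T) = complex.Re d * f T + complex.Im d * f ('i%C *: T).
  case: d => a b /=; have -> : a +i* b = a%:C + b%:C * 'i%C.
    by apply/eqP; rewrite eq_complex /=; apply/andP; split; apply/eqP; ring.
  by rewrite scalerDl -scalerA fD !fZ.
rewrite (cT c) (cT ('i%C * c)); case: c => a b; apply/eqP; rewrite eq_complex /=.
by apply/andP; split; apply/eqP; ring.
Qed.

Lemma cstate_is_state (A : set B) f : rstate f -> is_state A (cstate f).
Proof.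
move=> sf; have lf := sf.1; split=> [c T S _ _|T _|].
- exact: cstate_linear.
- rewrite lecE /= rstate_sqr_ge0// andbT oppr_eq0; apply/eqP.
  transitivity (f 0); last exact: real_linear0.
  apply: rstate_form_eq => // x.
  by rewrite /form bopZ dotpZl !bopME adjP' dotpxx dotp0l /= mulr0 mul0r subr0.
- rewrite /cstate rstate1//; have -> : f ('i%C *: (1 : B)) = 0.
    transitivity (f 0); last exact: real_linear0.
    apply: rstate_form_eq => // x.
    by rewrite /form bopZ bop1E dotpZl dotpxx dotp0l /= mulr0 mul0r subr0.
  by rewrite oppr0.
Qed.

End NumericalSup.

(** * Group unitaries, the group algebra and its norm closure *)

Section Conjugation.
Context (R : realType) (G : groupType).
Local Notation C := R[i].
Local Notation H := (ell2 R G).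
Local Notation B := (bop R G).
Local Notation lreg := (@lreg R G).
Implicit Types (x y : H) (c : C) (T S : B) (s t u : G).

Lemma lregE s x t : lreg s x t = x (s^-1 * t)%g. Proof. by []. Qed.

Lemma lreg1 : lreg 1%g = 1.
Proof. by apply: bop_ext => x; apply: ell2_ext => t; rewrite lregE invg1 mul1g. Qed.

Lemma lregM s t : lreg (s * t)%g = lreg s * lreg t.
Proof.
by apply: bop_ext => x; apply: ell2_ext => u; rewrite bopME !lregE invgM mulgA.
Qed.

Lemma lregV s : lreg s * lreg s^-1%g = 1.
Proof. by rewrite -lregM mulgV lreg1. Qed.

Lemma lregVr s : lreg s^-1%g * lreg s = 1.
Proof. by rewrite -lregM mulVg lreg1. Qed.

Lemma ell2norm_lreg s x : ell2norm (lreg s x) = ell2norm x.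
Proof. by rewrite /ell2norm sqnorm_lshift. Qed.

Definition cnj s T : B := lreg s^-1%g * T * lreg s.

Lemma cnjE s T : adj (lreg s) * T * lreg s = cnj s T.
Proof. by rewrite adj_lreg. Qed.

Lemma cnj_lreg s t : cnj s (lreg t) = lreg (s^-1 * t * s)%g.
Proof. by rewrite /cnj -!lregM. Qed.

Lemma cnj_cnj s t T : cnj t (cnj s T) = cnj (s * t)%g T.
Proof. by rewrite /cnj invgM !lregM !mulrA. Qed.

Lemma cnj1g T : cnj 1%g T = T.
Proof. by rewrite /cnj invg1 lreg1 mul1r mulr1. Qed.

Lemma cnjK s T : cnj s^-1%g (cnj s T) = T.
Proof. by rewrite cnj_cnj mulgV cnj1g. Qed.

Lemma cnjD s T S : cnj s (T + S) = cnj s T + cnj s S.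
Proof. by rewrite /cnj mulrDr mulrDl. Qed.

Lemma cnjZ s c T : cnj s (c *: T) = c *: cnj s T.
Proof. by rewrite /cnj bopZr bopZl. Qed.

Lemma cnj0 s : cnj s 0 = 0.
Proof. by rewrite /cnj mulr0 mul0r. Qed.

Lemma cnjN s T : cnj s (- T) = - cnj s T.
Proof. by rewrite /cnj mulrN mulNr. Qed.

Lemma cnj1 s : cnj s 1 = 1.
Proof. by rewrite /cnj mulr1 lregVr. Qed.

Lemma cnjM s T S : cnj s (T * S) = cnj s T * cnj s S.
Proof. by rewrite /cnj !mulrA; congr (_ * _ * _); rewrite -!mulrA lregV mulr1. Qed.

Lemma cnj_sum s (J : Type) (r : seq J) (F : J -> B) :
  cnj s (\sum_(j <- r) F j) = \sum_(j <- r) cnj s (F j).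
Proof.
elim: r => [|a r IH]; first by rewrite !big_nil cnj0.
by rewrite !big_cons cnjD IH.
Qed.

Lemma lreg_cnj s T : lreg s * cnj s T = T * lreg s.
Proof. by rewrite /cnj !mulrA lregV mul1r. Qed.

Lemma form_cnj s T x : form (cnj s T) x = form T (lreg s x).
Proof. by rewrite -cnjE form_conj. Qed.

Lemma nsup_cnj s T : nsup (cnj s T) = nsup T.
Proof.
have le t S : nsup (cnj t S) <= nsup S.
  apply: nsup_le => x; rewrite form_cnj; apply: le_trans (nsup_ub _ _) _.
  by rewrite ell2norm_lreg.
by apply/eqP; rewrite eq_le le/= -{1}(cnjK s T) le.
Qed.

Lemma opnorm_cnj s T : opnorm (cnj s T) <= opnorm T.
Proof.
apply: opnorm_le_bound => [|x]; first exact: opnorm_ge0.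
by rewrite /cnj !bopME ell2norm_lreg -(ell2norm_lreg s x) opnorm_bound.
Qed.

Definition subgroup (L : set G) :=
  [/\ L 1%g, forall s t, L s -> L t -> L (s * t)%g & forall s, L s -> L s^-1%g].

Lemma subgroupT : subgroup [set: G]. Proof. by []. Qed.

(** The image of the group algebra of [L]; lists stand for finitely supported functions and may
    repeat a group element. *)
Definition gspan (L : set G) : set B := [set T | exists l : seq (C * G),
  (forall a, a \in l -> L a.2) /\ T = \sum_(a <- l) a.1 *: lreg a.2].

Lemma gspan0 L : gspan L 0.
Proof. by exists [::]; rewrite big_nil. Qed.

Lemma gspan_lreg (L : set G) s : L s -> gspan L (lreg s).
Proof.
move=> Ls; exists [:: (1, s)]; rewrite big_seq1 scale1r; split=> // a.
by rewrite inE => /eqP->.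
Qed.

Lemma gspanP L c T S : gspan L T -> gspan L S -> gspan L (c *: T + S).
Proof.
move=> [l [lL ->]] [k [kL ->]]; exists ([seq (c * a.1, a.2) | a <- l] ++ k); split.
  by move=> a; rewrite mem_cat => /orP[/mapP[b bl ->]|/kL//]; exact: (lL b bl).
rewrite big_cat big_map /= scaler_sumr; congr (_ + _).
by apply: eq_bigr => a _; rewrite scalerA.
Qed.

Lemma gspanZ L c T : gspan L T -> gspan L (c *: T).
Proof. by move=> LT; rewrite -[_ *: _]addr0; apply: gspanP => //; exact: gspan0. Qed.

Lemma gspanD L T S : gspan L T -> gspan L S -> gspan L (T + S).
Proof. by move=> LT LS; rewrite -[T]scale1r; exact: gspanP. Qed.

Lemma gspan_sum (J : Type) (r : seq J) (F : J -> B) L :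
  (forall j, gspan L (F j)) -> gspan L (\sum_(j <- r) F j).
Proof.
move=> LF; elim: r => [|a r IH]; first by rewrite big_nil; exact: gspan0.
by rewrite big_cons; exact: gspanD.
Qed.

Lemma gspan_cnj (L L' : set G) s T : (forall t, L t -> L' (s^-1 * t * s)%g) ->
  gspan L T -> gspan L' (cnj s T).
Proof.
move=> LL' [l [lL ->]]; exists [seq (a.1, (s^-1 * a.2 * s)%g) | a <- l]; split.
  by move=> a /mapP[b /lL bL ->]; exact: LL'.
by rewrite cnj_sum big_map; apply: eq_bigr => a _; rewrite cnjZ cnj_lreg.
Qed.

Lemma gspan_star L : subgroup L -> star_subalgebra (gspan L).
Proof.
move=> [L1 LM LV]; split; [exact: gspan0|exact: gspanP| |].
  move=> T S [l [lL ->]] [k [kL ->]].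
  exists [seq (a.1 * b.1, (a.2 * b.2)%g) | a <- l, b <- k]; split.
    by move=> _ /allpairsP[[a b] /= [al bk ->]]; apply: LM; [exact: lL|exact: kL].
  rewrite big_allpairs_dep mulr_suml; apply: eq_bigr => a _.
  rewrite mulr_sumr; apply: eq_bigr => b _ /=.
  by rewrite bopZl bopZr scalerA lregM.
move=> T [l [lL ->]]; exists [seq (conjc a.1, a.2^-1%g) | a <- l]; split.
  by move=> a /mapP[b /lL bL ->]; exact: LV.
by rewrite adj_sum big_map; apply: eq_bigr => a _; rewrite adjZ adj_lreg.
Qed.

Lemma closure_cstar (D : set B) : star_subalgebra D -> cstar_subalgebra (closure D).
Proof.
move=> [D0 DP DM DA]; split; last exact: closed_closure.
split.
- exact: subset_closure.
- move=> c T S /bop_closureP DT /bop_closureP DS; apply/bop_closureP => e e0.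
  have n0 : 0 < normc c + 1 by rewrite ltr_wpDl// normc_ge0.
  have e2 : 0 < e / 2 by rewrite divr_gt0.
  have [T' DT' TT'] := DT _ (divr_gt0 e2 n0); have [S' DS' SS'] := DS _ e2.
  exists (c *: T' + S'); first exact: DP.
  rewrite opprD addrACA -scalerBr (splitr e); apply: le_lt_trans (opnormD _ _) _.
  apply: ltrD => //; rewrite opnormZ; move: TT'; rewrite ltr_pdivlMr//.
  by have := opnorm_ge0 (T - T'); nra.
- move=> T S /bop_closureP DT /bop_closureP DS; apply/bop_closureP => e e0.
  (* [d <= 1] keeps the norm of [T'] below [opnorm T + 1], and [d * K <= e / 2] bounds the total
     error. *)
  pose K := opnorm T + opnorm S + 1; pose d := Num.min 1 (e / 2 / K).
  have K0 : 0 < K by rewrite ltr_wpDl// addr_ge0 ?opnorm_ge0.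
  have d0 : 0 < d by rewrite lt_min ltr01 !divr_gt0.
  have d1 : d <= 1 by rewrite ge_min lexx.
  have dK : d * K <= e / 2 by rewrite -ler_pdivlMr// ge_min lexx orbT.
  have [T' DT' /ltW TT'] := DT _ d0; have [S' DS' /ltW SS'] := DS _ d0.
  exists (T' * S'); first exact: (DM).
  have -> : T * S - T' * S' = (T - T') * S + T' * (S - S').
    by rewrite mulrBl mulrBr addrA subrK.
  have T'le : opnorm T' <= opnorm T + 1.
    have := opnormD T (T' - T); rewrite addrC subrK opnormB => /le_trans; apply.
    by rewrite lerD2l (le_trans TT').
  have h1 : opnorm ((T - T') * S) <= d * opnorm S.
    by apply: le_trans (opnormM _ _) _; rewrite ler_wpM2r ?opnorm_ge0.
  have h2 : opnorm (T' * (S - S')) <= (opnorm T + 1) * d.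
    by apply: le_trans (opnormM _ _) _; rewrite ler_pM ?opnorm_ge0.
  apply: le_lt_trans (opnormD _ _) _; apply: le_lt_trans (lerD h1 h2) _.
  by move: dK; rewrite /K; lra.
- move=> T /bop_closureP DT; apply/bop_closureP => e /DT[S DS TS].
  by exists (adj S); [exact: DA|rewrite -adjB opnorm_adj].
Qed.

Section ReducedAlgebra.
Variables (L : set G) (LG : subgroup L).

(** The closure of the group algebra is a C*-algebra containing the generators, hence contains the
    smallest one. *)
Lemma reduced_cstar_dense T : reduced_cstar L T ->
  forall e : R, 0 < e -> exists2 S, gspan L S & opnorm (T - S) < e.
Proof.
move=> LT; apply/bop_closureP; apply: LT; split.
  exact: closure_cstar (gspan_star LG).
by move=> _ [t Lt <-]; apply: subset_closure; exact: gspan_lreg.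
Qed.

Lemma reduced_cstar_cstar : cstar_subalgebra (@reduced_cstar R G L).
Proof.
split; first split.
- by move=> D [[[D0 _ _ _] _] _].
- by move=> c T S LT LS D DL; have [[[_ DP _ _] _] _] := DL; apply: DP; [exact: LT|exact: LS].
- by move=> T S LT LS D DL; have [[[_ _ DM _] _] _] := DL; apply: DM; [exact: LT|exact: LS].
- by move=> T LT D DL; have [[[_ _ _ DA] _] _] := DL; apply: DA; exact: LT.
- by apply: closed_bigI => D [[_ cD] _].
Qed.

Lemma reduced_cstar_lreg t : L t -> @reduced_cstar R G L (lreg t).
Proof. by move=> Lt D [_]; apply; exists t. Qed.

Lemma reduced_cstar_gspan T : gspan L T -> reduced_cstar L T.
Proof.
move=> [l [lL ->]]; have [[A0 AP _ _] _] := reduced_cstar_cstar.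
elim: l lL => [|a l IH] lL; first by rewrite big_nil.
rewrite big_cons; apply: (AP); last by apply: IH => b bl; apply: lL; rewrite inE bl orbT.
by apply: reduced_cstar_lreg; apply: lL; rewrite inE eqxx.
Qed.

Lemma reduced_cstar1 : @reduced_cstar R G L 1.
Proof. by rewrite -lreg1; apply: reduced_cstar_lreg; case: LG. Qed.

Lemma reduced_cstar_cnj s T : L s -> reduced_cstar L T -> reduced_cstar L (cnj s T).
Proof.
move=> Ls LT; have [[_ _ AM _] _] := reduced_cstar_cstar.
have LV : L s^-1%g by case: LG => _ _; apply.
by apply: (AM); [apply: (AM) => //|]; exact: reduced_cstar_lreg.
Qed.

End ReducedAlgebra.

End Conjugation.

(** * Extension of states from an algebra to all bounded operators *)

Section StateExtension.
Context (R : realType) (G : groupType).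
Local Notation C := R[i].
Local Notation B := (bop R G).
Variables (A : set B) (cA : cstar_subalgebra A) (A1 : A 1).
Variables (phi : B -> C) (sphi : is_state A phi).
Implicit Types (T S : B) (c : C).

Let A0 : A 0. Proof. exact: (star0 cA.1). Qed.
Let AM T S : A T -> A S -> A (T * S). Proof. exact: (starM cA.1). Qed.
Let AA T : A T -> A (adj T). Proof. exact: (star_adj cA.1). Qed.
Let AZ c T : A T -> A (c *: T). Proof. exact: (starZ cA.1). Qed.
Let AD T S : A T -> A S -> A (T + S). Proof. exact: (starD cA.1). Qed.

Let phiP c T S : A T -> A S -> phi (c *: T + S) = c * phi T + phi S.
Proof. by case: sphi => H _ _; exact: H. Qed.

Lemma state0 : phi 0 = 0.
Proof.
have := phiP 1 A0 A0; rewrite scaler0 addr0 mul1r => /eqP.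
by rewrite eq_sym addrC -subr_eq0 addrK => /eqP.
Qed.

Lemma stateZ c T : A T -> phi (c *: T) = c * phi T.
Proof. by move=> AT; rewrite -[c *: T]addr0 phiP// state0 addr0. Qed.

Lemma stateD T S : A T -> A S -> phi (T + S) = phi T + phi S.
Proof. by move=> AT AS; rewrite -[T in LHS]scale1r phiP// mul1r. Qed.

Lemma stateN T : A T -> phi (- T) = - phi T.
Proof. by move=> AT; rewrite -scaleN1r stateZ// mulN1r. Qed.

Lemma state_sum (J : Type) (s : seq J) (F : J -> B) : (forall j, A (F j)) ->
  phi (\sum_(j <- s) F j) = \sum_(j <- s) phi (F j).
Proof.
move=> AF.
have AS (r : seq J) : A (\sum_(j <- r) F j) by exact: (star_sum cA.1).
elim: s => [|a r IH]; first by rewrite !big_nil state0.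
by rewrite !big_cons stateD// IH.
Qed.

Let phi_sqr T : A T -> 0 <= phi (adj T * T).
Proof. by case: sphi => _ H _; exact: H. Qed.

Let phi1 : phi 1 = 1. Proof. by case: sphi. Qed.

(** Positivity makes [phi] real on [T * T] and on the square of [T + 1]; their difference is
    [T + T + 1]. *)
Lemma state_selfadj_Im T : A T -> adj T = T -> complex.Im (phi T) = 0.
Proof.
move=> AT Ta.
have := ger0_Im (phi_sqr (AD AT A1)); rewrite adjD adj1 Ta.
have -> : (T + 1) * (T + 1) = T * T + (T + (T + 1)).
  by rewrite mulrDl mul1r mulrDr mulr1 -addrA.
rewrite (stateD (AM AT AT) (AD AT (AD AT A1))) (stateD AT (AD AT A1)) (stateD AT A1) phi1.
have := ger0_Im (phi_sqr AT); rewrite Ta.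
case: (phi (T * T)) => a b /= ->; case: (phi T) => p q /=; lra.
Qed.

(** Positivity of [phi] concerns products [adj x * x] within [A], that of [y] is spatial. Testing
    the form of [y] on the range of [m * n] kills the negative part, so [y] is such a product. *)
Lemma state_pos_small y : A y -> adj y = y -> opnorm y <= 1 ->
  (forall x, 0 <= form y x) -> 0 <= complex.Re (phi y).
Proof.
move=> Ay ya y1 y0.
have [m [n [Am An ma na [yE mny]]]] := negative_part cA A1 Ay ya y1.
have n2 : n * n = 0.
  apply: bop_ext => x; apply/ell2norm0_eq0/eqP; rewrite -sqrf_eq0 eq_le sqr_ge0 andbT.
  have := y0 ((m * n) x); rewrite -form_conj mny formN.
  by rewrite -{1 2}na -adjM form_sqr oppr_ge0.
have n0 : n = 0.
  apply: bop_ext => x; apply/ell2norm0_eq0/eqP; rewrite -sqrf_eq0.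
  by rewrite -form_sqr na n2 /form dotp0l.
rewrite yE n0 addr0 subr0 -{1}ma.
by have := phi_sqr Am; rewrite lecE => /andP[].
Qed.

Lemma state_pos y : A y -> adj y = y -> (forall x, 0 <= form y x) ->
  0 <= complex.Re (phi y).
Proof.
move=> Ay ya y0; have n0 : 0 < opnorm y + 1 by rewrite ltr_wpDl// opnorm_ge0.
have i0 : 0 < (opnorm y + 1)^-1 by rewrite invr_gt0.
have := @state_pos_small ((opnorm y + 1)^-1%:C *: y) (AZ _ Ay).
rewrite adjZr ya stateZ// ReM pmulr_rge0//; apply=> //.
  by rewrite opnormZ (normc_real_ge0 (ltW i0)) ler_pdivrMl// mulr1 lerDl.
by move=> x; rewrite formZ mulr_ge0// ltW.
Qed.

(** [nsup a] minus the real part [h] of [a] has a nonnegative form, and [state_pos] applies to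
    it. *)
Lemma state_le_nsup a : A a -> complex.Re (phi a) <= nsup a.
Proof.
move=> Aa; pose h : B := 2^-1%:C *: (a + adj a); pose k : B := 2^-1%:C *: (a - adj a).
have Ah : A h by apply/AZ/AD => //; exact: AA.
have Ak : A k by apply: (AZ); apply: (AD) => //; rewrite -scaleN1r; apply/AZ/AA.
have aE : a = h + k.
  rewrite /h /k -scalerDr addrACA subrr addr0 -[a in RHS]scale1r -scalerDl scalerA.
  by rewrite -[1 + 1]/((1 + 1)%R) -(rmorphD (real_complex R) 1 1) -rmorphM mulVf ?pnatr_eq0// scale1r.
have ha : adj h = h by rewrite adjZr adjD adjK addrC.
have ka : adj ('i%C *: k) = 'i%C *: k.
  rewrite adjZ adjZr adjB adjK !scalerA -opprB scalerN -scaleNr -mulNr.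
  by congr ((_ * _) *: _); apply/eqP; rewrite eq_complex /= oppr0 opprK !eqxx.
have Rk : complex.Re (phi k) = 0.
  have := state_selfadj_Im (AZ _ Ak) ka; rewrite stateZ//.
  by case: (phi k) => p q /=; rewrite mul0r add0r mul1r.
have formh x : form h x = form a x.
  by rewrite formZ formD form_adj; lra.
have := @state_pos ((nsup a)%:C *: (1 : B) + (-1)%:C *: h).
have -> : complex.Re (phi a) = complex.Re (phi h) by rewrite aE stateD// ReD Rk addr0.
rewrite (stateD (AZ _ A1) (AZ _ Ah)) (stateZ _ A1) (stateZ _ Ah) phi1 ReD !ReM.
rewrite mulr1 mulN1r subr_ge0; apply.
- by apply: (AD); exact: (AZ).
- by rewrite adjD (adjZr _ 1) (adjZr _ h) adj1 ha.
- by move=> x; rewrite formD (formZ _ 1) (formZ _ h) form1 mulN1r subr_ge0 formh nsup_ub.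
Qed.

Lemma state_norm_le a : A a -> normc (phi a) <= 2 * opnorm a.
Proof.
have Re_le T : A T -> `|complex.Re (phi T)| <= opnorm T.
  move=> AT; rewrite ler_norml (le_trans (state_le_nsup AT) (nsup_le_opnorm _)) andbT.
  have := le_trans (state_le_nsup (AZ (-1) AT)) (nsup_le_opnorm _).
  by rewrite stateZ// mulN1r ReN scaleN1r opnormN lerNl.
move=> Aa; apply: le_trans (normc_le_ReIm _) _; rewrite mulr_natl mulr2n lerD ?Re_le//.
rewrite -normrN -Re_iM -stateZ//; apply: le_trans (Re_le _ _) _; first exact: AZ.
by rewrite opnormZ [normc _]/= expr0n expr1n add0r sqrtr1 mul1r.
Qed.

(** The constraints form the graph of the real part of [phi] on [A]; as the graph is symmetric, the
    lower bounds become equalities. *)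
Lemma state_extension : exists f, rstate f /\ forall a, A a -> f a = complex.Re (phi a).
Proof.
pose Cn T (r : R) := A T /\ r = complex.Re (phi T).
have [|T r [AT ->]|f [lf fn fC]] := @cone_extension _ _ _ Cn (nsup_sublinear R G).
- split; first by split=> //; rewrite state0.
    move=> T S p r [AT ->] [AS ->]; split; first exact: (AD).
    by rewrite stateD// ReD.
  by move=> a T r a0 [AT ->]; split; [exact: (AZ)|rewrite stateZ// ReM].
- exact: state_le_nsup.
exists f; split=> // a Aa; apply/eqP; rewrite eq_le fC// andbT.
rewrite -lerN2 -(real_linearN a lf); apply: fC; split; last by rewrite stateN// ReN.
by rewrite -scaleN1r; exact: AZ.
Qed.

End StateExtension.

(** * Averages of conjugates and the separation argument *)

Section Averaging.
Context (R : realType) (G : groupType).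
Local Notation C := R[i].
Local Notation H := (ell2 R G).
Local Notation B := (bop R G).
Implicit Types (T S : B) (ts us : seq G).

Lemma four_polarization T (x y : H) :
  4 * complex.Re (dotp (T x) y) = form T (x + y) - form T (x - y)
    + (form ('i%C *: T) (x + 'i%C *: y) - form ('i%C *: T) (x - 'i%C *: y)).
Proof.
rewrite /form !bopZ !(linearD, linearN, linearZ) /=.
rewrite !(dotpDl, dotpDr, dotpNl, dotpNr, dotpZl, dotpZr).
case: (dotp (T x) y) => a b; case: (dotp (T y) x) => c d.
case: (dotp (T x) x) => e f; case: (dotp (T y) y) => g h /=; ring.
Qed.

(** Real functionals control [nsup] only; polarization recovers the norm from four directions at the
    cost of a factor 2. *)
Lemma opnorm_le_nsup T (e : R) : 0 <= e -> nsup T <= e -> nsup (- T) <= e ->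
  nsup ('i%C *: T) <= e -> nsup (- ('i%C *: T)) <= e -> opnorm T <= 2 * e.
Proof.
move=> e0 T1 T2 T3 T4.
have le S z : nsup S <= e -> form S z <= e * ell2norm z ^+ 2.
  by move=> Se; apply: le_trans (nsup_ub _ _) _; rewrite ler_wpM2r ?sqr_ge0.
have Re_le (x y : H) : complex.Re (dotp (T x) y) <= e * (ell2norm x ^+ 2 + ell2norm y ^+ 2).
  have h1 := le _ (x + y) T1; have h2 := le _ (x - y) T2.
  have h3 := le _ (x + 'i%C *: y) T3; have h4 := le _ (x - 'i%C *: y) T4.
  have iy : ell2norm ('i%C *: y) = ell2norm y.
    by rewrite ell2normZ [normc _]/= expr0n expr1n add0r sqrtr1 mul1r.
  have par (z : H) : ell2norm (x + z) ^+ 2 + ell2norm (x - z) ^+ 2 =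
      2 * (ell2norm x ^+ 2 + ell2norm z ^+ 2).
    by rewrite (ell2normD_sqr x z) (ell2normD_sqr x (- z)) dotpNr ReN ell2normN; ring.
  have p1 := par y; have p2 := par ('i%C *: y); rewrite iy in p2.
  rewrite (formN T) in h2; rewrite (formN ('i%C *: T)) in h4.
  have := four_polarization T x y; nra.
apply: opnorm_le => x x1.
have [->|n0] := eqVneq (ell2norm (T x)) 0; first by rewrite mulr_ge0.
have np : 0 < ell2norm (T x) by rewrite lt_neqAle eq_sym n0 ell2norm_ge0.
have := Re_le x ((ell2norm (T x))^-1%:C *: T x).
rewrite dotpZr conjc_real ReM dotpxx ell2normZ normc_real_ge0 ?invr_ge0 ?ell2norm_ge0//.
rewrite mulVf// expr1n -[complex.Re _]/(ell2norm (T x) ^+ 2) expr2 mulKf// => /le_trans; apply.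
rewrite mulrC ler_wpM2r//; have : ell2norm x ^+ 2 <= 1 by rewrite expr_le1 ?ell2norm_ge0.
lra.
Qed.

(** Repetitions in [ts] count, so every rational convex combination of conjugates is an average. *)
Definition avg ts T : B := (size ts)%:R^-1%:C *: \sum_(t <- ts) cnj t T.

Lemma nsup_sum_cnj ts T : nsup (\sum_(t <- ts) cnj t T) <= (size ts)%:R * nsup T.
Proof.
apply: le_trans (sublinear_sum _ _ (nsup_sublinear R G)) _.
under eq_bigr do rewrite nsup_cnj.
by rewrite big_const_seq count_predT iter_addr addr0 mulr_natl.
Qed.

Lemma nsup_avg ts T : ts != [::] -> nsup (avg ts T) <= nsup T.
Proof.
rewrite -size_eq0 -lt0n => ts0; rewrite (nsup_sublinear R G).2 ?invr_ge0//.
by rewrite ler_pdivrMl ?ltr0n// nsup_sum_cnj.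
Qed.

Lemma avgD ts T S : avg ts (T + S) = avg ts T + avg ts S.
Proof.
by rewrite /avg -scalerDr -big_split; congr (_ *: _); apply: eq_bigr => t _; rewrite cnjD.
Qed.

Lemma avgZ ts c T : avg ts (c *: T) = c *: avg ts T.
Proof.
rewrite /avg scalerA [c * _]mulrC -scalerA; congr (_ *: _); rewrite scaler_sumr.
by apply: eq_bigr => t _; rewrite cnjZ.
Qed.

Lemma avg_sum ts (J : Type) (r : seq J) (F : J -> B) :
  avg ts (\sum_(j <- r) F j) = \sum_(j <- r) avg ts (F j).
Proof.
elim: r => [|a r IH]; last by rewrite !big_cons avgD IH.
by rewrite !big_nil -(scale0r (0 : B)) avgZ !scale0r.
Qed.

Lemma avg1 ts : ts != [::] -> avg ts 1 = 1.
Proof.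
rewrite -size_eq0 => ts0; rewrite /avg; under eq_bigr do rewrite cnj1.
rewrite big_const_seq count_predT iter_addr addr0 -[X in _ *: X]scaler_nat scalerA.
by rewrite -(rmorph_nat (real_complex R)) -rmorphM mulVf ?pnatr_eq0// scale1r.
Qed.

Lemma opnorm_avg ts T : opnorm (avg ts T) <= opnorm T.
Proof.
rewrite /avg opnormZ normc_real_ge0 ?invr_ge0//.
have [->|ts0] := eqVneq (size ts) 0%N; first by rewrite invr0 mul0r opnorm_ge0.
rewrite ler_pdivrMl ?ltr0n ?lt0n//; apply: le_trans (opnorm_sum _ _) _.
apply: le_trans (ler_sum _ (fun t _ => opnorm_cnj t T)) _.
by rewrite big_const_seq count_predT iter_addr addr0 mulr_natl.
Qed.

Lemma avg_comp ts us T :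
  avg us (avg ts T) = avg [seq (t * u)%g | t <- ts, u <- us] T.
Proof.
rewrite avgZ /avg scalerA size_allpairs natrM invfM rmorphM; congr (_ *: _).
rewrite big_allpairs_dep exchange_big /=; apply: eq_bigr => u _.
by rewrite cnj_sum; apply: eq_bigr => t _; rewrite cnj_cnj.
Qed.

Section Relative.
Variables (L : set G) (LG : subgroup L).

(* Real weights are replaced by multiplicities: [N * a.1] is rounded down. *)
Lemma avg_of_weights (x : B) (e : R) (l : seq (R * G)) : 0 < e ->
  (forall a, a \in l -> 0 <= a.1 /\ L a.2) ->
  nsup (\sum_(a <- l) a.1%:C *: cnj a.2 x) < e * \sum_(a <- l) a.1 ->
  exists ts, [/\ ts != [::], forall t, t \in ts -> L t & nsup (avg ts x) < e].
Proof.
move=> e0 lL; set v := \sum_(a <- l) _; set s := \sum_(a <- l) _ => lt.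
have sub := nsup_sublinear R G.
(* [K] bounds the total rounding error: each entry costs at most [opnorm x] in the sum and [e] in
   the number of terms. *)
pose K : R := (size l)%:R * (opnorm x + e).
have [N KN] : exists N : nat, K / (e * s - nsup v) < N%:R.
  by exists (Num.truncn (K / (e * s - nsup v))).+1; rewrite truncnS_gt.
have {}KN : K < N%:R * (e * s - nsup v) by rewrite -ltr_pdivrMr// subr_gt0.
pose n (a : R * G) := Num.truncn (N%:R * a.1).
pose ts := flatten [seq nseq (n a) a.2 | a <- l].
have tsL t : t \in ts -> L t.
  by move=> /flattenP[_ /mapP[a al ->]]; rewrite mem_nseq => /andP[_ /eqP->]; case: (lL _ al).
have tsE : \sum_(t <- ts) cnj t x = \sum_(a <- l) (n a)%:R%:C *: cnj a.2 x.
  rewrite big_flatten big_map; apply: eq_bigr => a _.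
  by rewrite big_nseq iter_addr addr0 -scaler_nat rmorph_nat.
have tsS : (size ts)%:R = \sum_(a <- l) (n a)%:R :> R.
  rewrite size_flatten /shape sumnE !big_map natr_sum; apply: eq_bigr => a _.
  by rewrite size_nseq.
have round a : a \in l -> 0 <= N%:R * a.1 - (n a)%:R <= 1.
  move=> /lL[a0 _]; have N0 : 0 <= N%:R * a.1 by rewrite mulr_ge0.
  have /andP[h1 h2] := truncn_itv N0; rewrite subr_ge0 h1 lerBlDr -natr1 in h2 *.
  by rewrite addrC ltW.
have diff : nsup (\sum_(t <- ts) cnj t x) <= N%:R * nsup v + (size l)%:R * opnorm x.
  rewrite tsE -sub.2//.
  have -> : \sum_(a <- l) (n a)%:R%:C *: cnj a.2 x =
      N%:R%:C *: v + \sum_(a <- l) ((n a)%:R - N%:R * a.1)%:C *: cnj a.2 x.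
    rewrite scaler_sumr -big_split /=; apply: eq_bigr => a _.
    by rewrite scalerA -scalerDl -rmorphM -rmorphD addrC subrK.
  apply: le_trans (sub.1 _ _) _; rewrite lerD2l.
  apply: le_trans (nsup_le_opnorm _) _; apply: le_trans (opnorm_sum _ _) _.
  have -> : (size l)%:R * opnorm x = \sum_(a <- l) opnorm x.
    by rewrite big_const_seq count_predT iter_addr addr0 mulr_natl.
  rewrite big_seq [leRHS]big_seq; apply: ler_sum => a /round ar.
  rewrite opnormZ normcR distrC ger0_norm; last by case/andP: ar.
  apply: le_trans (ler_wpM2l _ (opnorm_cnj _ _)) _; first by case/andP: ar.
  by rewrite ler_piMl ?opnorm_ge0//; case/andP: ar.
have size_ge : N%:R * s - (size l)%:R <= (size ts)%:R.
  rewrite tsS mulr_sumr lerBlDr.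
  have -> : (size l)%:R = \sum_(a <- l) 1 :> R.
    by rewrite big_const_seq count_predT iter_addr addr0.
  rewrite -big_split big_seq [leRHS]big_seq; apply: ler_sum => a /round.
  by move=> /andP[_] /=; lra.
have lt' : nsup (\sum_(t <- ts) cnj t x) < e * (size ts)%:R.
  apply: le_lt_trans diff _.
  have : e * (N%:R * s - (size l)%:R) <= e * (size ts)%:R by rewrite ler_wpM2l// (ltW e0).
  by move: KN; rewrite /K; lra.
have ts0 : ts != [::].
  by apply/eqP => tsn; move: lt'; rewrite tsn big_nil mulr0 (sublinear0 sub) ltxx.
exists ts; split=> //; rewrite (sub.2 _ _ _) ?invr_ge0//.
by rewrite ltr_pdivrMl ?ltr0n ?lt0n ?size_eq0// mulrC.
Qed.

Lemma avg_onesided (x : B) :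
  (forall f (e : R), rstate f -> 0 < e -> ~ forall t, L t -> e <= f (cnj t x)) ->
  forall e : R, 0 < e ->
  exists ts, [/\ ts != [::], forall t, t \in ts -> L t & nsup (avg ts x) < e].
Proof.
move=> fx e e0; apply: contrapT => noavg.
(* The cone spanned by the constraints [e <= f (cnj t x)] for [t] in [L]. A violation of
   compatibility with [nsup] is a weighted average that is too small, which [avg_of_weights] turns
   into a forbidden one. *)
pose Cn v c := exists l : seq (R * G), [/\ forall a, a \in l -> 0 <= a.1 /\ L a.2,
  v = \sum_(a <- l) a.1%:C *: cnj a.2 x & c = e * \sum_(a <- l) a.1].
have [|v c [l [lL vE cE]]|f [lf fn fC]] := @cone_extension _ _ _ Cn (nsup_sublinear R G).
- split.
  + by exists [::]; rewrite !big_nil mulr0.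
  + move=> _ _ _ _ [l [lL -> ->]] [k [kL -> ->]]; exists (l ++ k); split.
    * by move=> a; rewrite mem_cat => /orP[/lL|/kL].
    * by rewrite big_cat.
    * by rewrite big_cat mulrDr.
  + move=> a _ _ a0 [l [lL -> ->]]; exists [seq (a * b.1, b.2) | b <- l]; split.
    * by move=> _ /mapP[b /lL[b0 Lb] ->]; rewrite mulr_ge0// (ltW a0).
    * by rewrite big_map scaler_sumr; apply: eq_bigr => b _; rewrite scalerA -rmorphM.
    * by rewrite big_map mulrCA mulr_sumr.
- rewrite leNgt; apply/negP => lt; apply: noavg.
  by apply: (@avg_of_weights x e l) => //; rewrite -vE -cE.
apply: (fx f e) => // t Lt; apply: fC; exists [:: (1, t)]; split.
- by move=> a; rewrite inE => /eqP->.
- by rewrite big_seq1 rmorph1 scale1r.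
- by rewrite big_seq1 mulr1.
Qed.

Definition nontrivial : set G := [set s | s <> 1%g].

Lemma gspan_avg ts T : gspan nontrivial T -> gspan nontrivial (avg ts T).
Proof.
move=> nT; apply/gspanZ/gspan_sum => t; apply: gspan_cnj nT => s s1 H1; apply: s1.
by move/(congr1 (fun u => t * u * t^-1)%g): H1; rewrite !mulgA mulgV mul1g mulgK mulg1 mulgV.
Qed.

Lemma powers_averaging_seq :
  (forall (ss : seq G) (e : R), 0 < e -> (forall s, s \in ss -> s <> 1%g) ->
    exists ts, [/\ ts != [::], forall t, t \in ts -> L t &
      forall s, s \in ss -> opnorm (avg ts (lreg R s)) < e]) ->
  powers_averaging R L.
Proof.
move=> H e n s e0 s1; have [|ts [ts0 tsL tsx]] := H [seq s j | j <- enum 'I_n] e e0.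
  by move=> _ /mapP[j _ ->].
have [m mE] : exists m, size ts = m.+1 by exists (size ts).-1; rewrite prednK// lt0n size_eq0.
exists m, (fun k => nth 1%g ts k); split=> [k|j].
  by apply/tsL/mem_nth; rewrite mE.
rewrite -[ `|_| ]/((opnorm _)%:C) ltcR.
have -> : m.+1%:R^-1 *: (\sum_(k < m.+1)
    lreg R ((nth 1 ts k)^-1 * s j * nth 1 ts k)%g) = avg ts (lreg R (s j)).
  rewrite /avg mE fmorphV rmorph_nat; congr (_ *: _).
  rewrite [RHS](big_nth 1%g) mE big_mkord; apply: eq_bigr => k _.
  by rewrite cnj_lreg.
by apply: tsx; rewrite map_f// mem_enum.
Qed.

Hypothesis no_positive_state : forall x f (e : R), gspan nontrivial x -> rstate f ->
  0 < e -> ~ forall t, L t -> e <= f (cnj t x).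

Lemma avg_simultaneous (xs : seq B) (e : R) : (forall x, x \in xs -> gspan nontrivial x) ->
  0 < e -> exists ts, [/\ ts != [::], forall t, t \in ts -> L t &
    forall x, x \in xs -> nsup (avg ts x) < e].
Proof.
have [L1 LM _] := LG.
move=> + e0; elim: xs => [|x xs IH] xsn; first by exists [:: 1%g]; split=> // t; rewrite inE => /eqP->.
have [|ts [ts0 tsL tsx]] := IH; first by move=> y yx; apply: xsn; rewrite inE yx orbT.
have nx : gspan nontrivial (avg ts x) by apply/gspan_avg/xsn; rewrite inE eqxx.
have [f d|us [us0 usL usx]] := @avg_onesided (avg ts x) _ e e0; first exact: no_positive_state.
exists [seq (t * u)%g | t <- ts, u <- us]; split.
- by rewrite -size_eq0 size_allpairs muln_eq0 !size_eq0 negb_or ts0.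
- by move=> _ /allpairsP[[t u] /= [tt uu ->]]; apply: (LM); [exact: tsL|exact: usL].
- move=> y; rewrite -avg_comp inE => /orP[/eqP->//|/tsx].
  by apply: le_lt_trans; exact: nsup_avg.
Qed.

Lemma powers_averaging_of_states : powers_averaging R L.
Proof.
apply: powers_averaging_seq => ss e e0 ss1; have e4 : 0 < e / 4 by rewrite divr_gt0.
(* The four directions needed by [opnorm_le_nsup]. *)
pose dirs : seq C := [:: 1; -1; 'i%C; - 'i%C].
have [|ts [ts0 tsL tsx]] := @avg_simultaneous
    [seq d *: lreg R s | d <- dirs, s <- ss] (e / 4) _ e4.
  by move=> _ /allpairsP[[d s] /= [_ sss ->]]; apply/gspanZ/gspan_lreg; exact: ss1.
exists ts; split=> // s sss.
have small d : d \in dirs -> nsup (d *: avg ts (lreg R s)) <= e / 4.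
  by move=> dd; rewrite -avgZ; apply/ltW/tsx; apply/allpairsP; exists (d, s).
apply: (@le_lt_trans _ _ (2 * (e / 4))); last by lra.
apply: opnorm_le_nsup; first exact: ltW.
- by rewrite -[avg _ _]scale1r; apply: small; rewrite inE eqxx.
- by rewrite -scaleN1r; apply: small; rewrite !inE eqxx orbT.
- by apply: small; rewrite !inE eqxx !orbT.
- by rewrite -scaleNr; apply: small; rewrite !inE eqxx !orbT.
Qed.

End Relative.

End Averaging.

(** * Closures in the topology of pointwise convergence *)

Section PointwiseTopology.
Context (R : realType).
Local Notation C := R[i].

(** The sets of functions close to [f] on a finite list generate a filter converging to [f] in each
    coordinate. [List.In] is used as [U] has no decidable equality. *)
Lemma ptws_closure (U : Type) (S : set {ptws U -> C}) (f : {ptws U -> C}) :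
  (forall (l : seq U) (e : R), 0 < e -> exists2 g, S g &
     forall u, List.In u l -> normc (g u - f u) < e) -> closure S f.
Proof.
move=> Sf.
pose D := [set d : seq U * R | 0 < d.2].
pose near (d : seq U * R) := [set g : U -> C | S g /\
  forall u, List.In u d.1 -> normc (g u - f u) < d.2].
pose F : set_system {ptws U -> C} := filter_from D near.
have FF : ProperFilter F.
  apply: filter_from_proper; last first.
    by move=> [l e] /= e0; have [g Sg gf] := Sf l e e0; exists g.
  apply: filter_from_filter; first by exists ([::], 1); exact: ltr01.
  move=> [l e] [k d] /= e0 d0; exists (l ++ k, Num.min e d); first by rewrite /D/= lt_min e0.
  by move=> g [Sg gf]; split; split=> // u ul; have := gf u (List.in_or_app _ _ _ _);
     rewrite lt_min => /(_ _)/andP[|//]; tauto.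
have Ff : F --> f.
  apply/cvg_sup => u V.
  have /= -> := @nbhsE (initial_topology (fun g : U -> C => g u)) f.
  case=> W [[X oX <-] Xf] /filterS; apply.
  have /nbhs_ballP[e /= e0 eX] : nbhs (f u) X by exact: open_nbhs_nbhs.
  have eE : e = (complex.Re e)%:C by rewrite RRe_real// gtr0_real.
  have {}e0 : 0 < complex.Re e by rewrite -ltcR -eE.
  exists ([:: u], complex.Re e) => // g [_ /(_ u) gf] /=; apply: eX.
  by rewrite -ball_normE /= eE distrC -[ `|_| ]/((normc _)%:C) ltcR; apply: gf; left.
move=> V /Ff [[l e] /= e0 nV].
by have [g Sg gf] := Sf l e e0; exists g; split=> //; apply: nV.
Qed.

Lemma ptws_closure_near (U : Type) (V : topologicalType) (S : set {ptws U -> V})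
  (f : {ptws U -> V}) u (N : set V) : closure S f -> nbhs (f u) N ->
  exists2 g, S g & N (g u).
Proof.
move=> Sf; rewrite nbhsE => -[X [oX Xf] XN].
have /cvg_sup/(_ u) fu : nbhs f --> f by exact: cvg_id.
have [|g [Sg gN]] := Sf ((fun g : {ptws U -> V} => g u) @^-1` X).
  apply: fu; have /= -> := @nbhsE (initial_topology (fun g : U -> V => g u)) f.
  by exists ((fun g : U -> V => g u) @^-1` X) => //; split=> //; exists X.
by exists g => //; exact: XN.
Qed.

End PointwiseTopology.

(** * Convex sets with complex scalars *)

Section Convexity.
Context (R : realType) (V : lmodType R[i]).
Local Notation C := R[i].

Lemma convex_combination (S : set V) (x y : V) (a : R) : @convex_set C V S ->
  0 <= a <= 1 -> S x -> S y -> S (a%:C *: x + (1 - a)%:C *: y).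
Proof.
move=> cS /andP[a0 a1] Sx Sy.
have a0' : 0 <= a%:C by rewrite ler0c.
have a1' : a%:C <= 1 by rewrite -(rmorph1 (real_complex R)) lecR.
have /set_mem := cS x y (Itv01 a0' a1') (mem_set Sx) (mem_set Sy).
by rewrite -[X in S X]/(a%:C *: x + (1 - a%:C) *: y) rmorphB rmorph1.
Qed.

(** The weights in [convex_set] are complex numbers between 0 and 1, which forces them to be
    real. *)
Lemma convex_setP (S : set V) :
  (forall x y (a : R), 0 <= a <= 1 -> S x -> S y -> S (a%:C *: x + (1 - a)%:C *: y)) ->
  @convex_set C V S.
Proof.
move=> H x y k /set_mem Sx /set_mem Sy; apply/mem_set.
rewrite -[X in S X]/(k%:num *: x + (1 - k%:num) *: y).
have k0 : 0 <= k%:num by []. have k1 : k%:num <= 1 by [].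
move: (k%:num) k0 k1 => z z0 z1.
have zE : z = (complex.Re z)%:C by rewrite RRe_real// ger0_real.
have -> : 1 - z = (1 - complex.Re z)%:C by rewrite {1}zE rmorphB rmorph1.
rewrite {1}zE; apply: H => //; move: z0 z1; rewrite zE ler0c => ->.
by rewrite -{1}(rmorph1 (real_complex R)) lecR.
Qed.

Lemma convex_average (S : set V) (J : eqType) (s : seq J) (F : J -> V) :
  @convex_set C V S -> s != [::] -> (forall j, j \in s -> S (F j)) ->
  S ((size s)%:R^-1%:C *: \sum_(j <- s) F j).
Proof.
move=> cS; elim: s => // a s IH _ SF.
have Sa : S (F a) by apply: SF; rewrite inE eqxx.
have [->|s0] := eqVneq s [::]; first by rewrite big_seq1 invr1 scale1r.
have {}IH := IH s0 (fun j js => SF j (mem_behead (s := a :: s) js)).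
rewrite big_cons scalerDr /=.
have n0 : (size s)%:R != 0 :> R by rewrite pnatr_eq0 size_eq0.
have n1 : (size s).+1%:R != 0 :> R by rewrite pnatr_eq0.
have -> : (size s).+1%:R^-1%:C *: (\sum_(j <- s) F j) =
   (1 - (size s).+1%:R^-1)%:C *: ((size s)%:R^-1%:C *: \sum_(j <- s) F j).
  rewrite scalerA -rmorphM; congr (_%:C *: _); move: n1; rewrite -natr1 => n1.
  by field; rewrite n0.
apply: convex_combination => //.
by rewrite invr_ge0 ler0n/= invf_le1 ?ltr0n// ler1n.
Qed.

Lemma convex_hull_sub (S T : set V) : @convex_set C V T -> S `<=` T ->
  convex_hull S `<=` T.
Proof. by move=> cT ST x; apply. Qed.

Lemma sub_convex_hull (S : set V) : S `<=` convex_hull S.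
Proof. by move=> x Sx T [_]; apply. Qed.

Lemma convex_hull_convex (S : set V) : @convex_set C V (convex_hull S).
Proof.
apply: convex_setP => x y a a01 hx hy T [cT ST].
by apply: convex_combination => //; [exact: hx|exact: hy].
Qed.

End Convexity.

(** * The canonical trace: trace property and faithfulness *)

Section Trace.
Context (R : realType) (G : groupType).
Local Notation C := R[i].
Local Notation B := (bop R G).
Local Notation lreg := (@lreg R G).
Local Notation tau := (@canonical_trace R G).
Implicit Types (T S : B).

Lemma traceE T : tau T = T (delta 1%g) 1%g.
Proof. by rewrite /canonical_trace dotpC dotp_deltal conjcK. Qed.

Lemma traceD T S : tau (T + S) = tau T + tau S.
Proof. by rewrite !traceE. Qed.

Lemma traceZ c T : tau (c *: T) = c * tau T.
Proof. by rewrite !traceE. Qed.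

Lemma traceN T : tau (- T) = - tau T.
Proof. by rewrite !traceE. Qed.

Lemma coord_le_opnorm T s t : normc (T (delta s) t) <= opnorm T.
Proof.
apply: le_trans (normc_le_ell2norm _ _) _; apply: le_trans (opnorm_bound _ _) _.
by rewrite ell2norm_delta mulr1.
Qed.

Lemma trace_le_opnorm T : normc (tau T) <= opnorm T.
Proof. by rewrite traceE coord_le_opnorm. Qed.

Lemma trace1 : tau 1 = 1.
Proof. by rewrite -lreg1 trace_lreg eqxx. Qed.

Lemma trace_sqr T : tau (adj T * T) = (ell2norm (T (delta 1%g)) ^+ 2)%:C.
Proof. by rewrite /canonical_trace bopME dotp_adjM. Qed.

Lemma trace_sum (J : Type) (s : seq J) (F : J -> B) :
  tau (\sum_(j <- s) F j) = \sum_(j <- s) tau (F j).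
Proof.
elim: s => [|a s IH]; last by rewrite !big_cons traceD IH.
by rewrite !big_nil -(scale0r (0 : B)) traceZ mul0r.
Qed.

Lemma trace_nontrivial T : gspan (@nontrivial G) T -> tau T = 0.
Proof.
move=> [l [l1 ->]]; rewrite trace_sum big_seq big1// => a /l1 a1.
by rewrite traceZ trace_lreg (negPf (introN eqP a1)) mulr0.
Qed.

Variables (L : set G) (LG : subgroup L).

(** The passage from identities between group elements to the whole algebra, by linearity and
    density. *)
Lemma reduced_cstar_vanish (phi : B -> C) (K : R) :
  (forall c T S, phi (c *: T + S) = c * phi T + phi S) ->
  (forall T, normc (phi T) <= K * opnorm T) ->
  (forall t, L t -> phi (lreg t) = 0) -> forall T, reduced_cstar L T -> phi T = 0.
Proof.
move=> lphi bphi phi0 T LT.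
have phi00 : phi 0 = 0.
  have := lphi 1 0 0; rewrite scaler0 addr0 mul1r => /eqP.
  by rewrite eq_sym addrC -subr_eq0 addrK => /eqP.
have phis S : gspan L S -> phi S = 0.
  move=> [l [lL ->]]; elim: l lL => [|a l IH] lL; first by rewrite big_nil.
  rewrite big_cons lphi phi0 ?mulr0 ?add0r; last by apply: lL; rewrite inE eqxx.
  by apply: IH => b bl; apply: lL; rewrite inE bl orbT.
apply/eq0_normc/(@eq0_small _ _ `|K|); first exact: normc_ge0.
move=> e e0; have [S /phis S0 TS] := reduced_cstar_dense LG LT e0.
have -> : phi T = phi (T - S).
  by rewrite -[T - S]addrC -scaleN1r lphi S0 mulr0 add0r.
apply: le_trans (bphi _) _; apply: (@le_trans _ _ (`|K| * opnorm (T - S))).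
  by rewrite ler_wpM2r ?opnorm_ge0 ?ler_norm.
by rewrite ler_wpM2l// ltW.
Qed.

Lemma trace_comm T S : reduced_cstar L T -> reduced_cstar L S -> tau (T * S) = tau (S * T).
Proof.
move=> LT LS; apply/eqP; rewrite -subr_eq0; apply/eqP.
have bnd U V : normc (tau (U * V) - tau (V * U)) <= (2 * opnorm U) * opnorm V.
  apply: le_trans (le_normcD _ _) _; rewrite normcN.
  have := trace_le_opnorm (U * V); have := trace_le_opnorm (V * U).
  have := opnormM U V; have := opnormM V U; lra.
apply: (@reduced_cstar_vanish (fun U => tau (U * S) - tau (S * U)) (2 * opnorm S)) => //.
- by move=> c U V; rewrite mulrDl mulrDr bopZl bopZr !traceD !traceZ; ring.
- by move=> U; rewrite normcB; exact: bnd.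
move=> t Lt; apply: (@reduced_cstar_vanish (fun U => tau (lreg t * U) - tau (U * lreg t))
    (2 * opnorm (lreg t))) => //.
- by move=> c U V; rewrite mulrDl mulrDr bopZl bopZr !traceD !traceZ; ring.
- by move=> s Ls; rewrite -!lregM !trace_lreg mulg_eq1 -(inj_eq invg_inj) invgK eq_sym -mulg_eq1 subrr.
Qed.

Lemma bop_delta_eq0 T : (forall s, T (delta s) = 0) -> T = 0.
Proof.
move=> T0; apply: bop_ext => x; apply: ell2norm0_eq0.
apply: (@eq0_small _ _ (opnorm T)); first exact: ell2norm_ge0.
move=> e /(finvec_dense x)[D xD].
have -> : T x = T (x - finvec D x) + T (finvec D x) by rewrite -linearD subrK.
have -> : T (finvec D x) = 0.
  by rewrite linear_sum big1// => i _; rewrite linearZ /= T0 scaler0.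
rewrite addr0; apply: le_trans (opnorm_bound _ _) _.
by rewrite ler_wpM2l ?opnorm_ge0// ltW.
Qed.

(** Elements of the algebra commute with right translations, so the value at [delta 1] determines
    all others; the norm of that value is what the trace of [adj T * T] measures. *)
Lemma trace_faithful T : reduced_cstar L T -> tau (adj T * T) = 0 -> T = 0.
Proof.
move=> LT; rewrite trace_sqr => /complexI/eqP; rewrite expf_eq0/= => /eqP/ell2norm0_eq0 T1.
apply: bop_delta_eq0 => s; apply: ell2_ext => t.
have : T (delta s) t - T (delta 1%g) (t * s^-1)%g = 0.
  apply: (@reduced_cstar_vanish (fun U => U (delta s) t - U (delta 1%g) (t * s^-1)%g) 2) => //.
  - have coord c (x y : ell2 R G) u : (c *: x + y) u = c * x u + y u by [].
    by move=> c U V; rewrite !bopD !bopZ !coord; ring.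
  - move=> U; apply: le_trans (le_normcD _ _) _; rewrite normcN.
    by have := coord_le_opnorm U s t; have := coord_le_opnorm U 1%g (t * s^-1)%g; lra.
  - move=> r _; rewrite !lreg_delta mulg1 /= /delta_fun.
    have -> : (t == r * s)%g = (t * s^-1 == r)%g.
      by apply/eqP/eqP => [->|<-]; rewrite ?mulgK ?mulgVK.
    by rewrite subrr.
by rewrite T1 subr0.
Qed.

End Trace.

(** * Averaging of states, Powers averaging, Dixmier property and irreducibility *)

Section Equivalences.
Context (R : realType) (G : groupType).
Local Notation C := R[i].
Local Notation B := (bop R G).
Local Notation lreg := (@lreg R G).
Local Notation tau := (@canonical_trace R G).
Variables (L : set G) (LG : subgroup L).
Local Notation A := (@reduced_cstar R G [set: G]).
Implicit Types (T S : B).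

Let TG := @subgroupT G.
Let cA : cstar_subalgebra A. Proof. exact: reduced_cstar_cstar. Qed.
Let A1 : A 1. Proof. exact: reduced_cstar1. Qed.

Lemma weakstar_closure_approx (S : set (B -> C)) (phi : B -> C) :
  (forall (l : seq B) (e : R), (forall T, T \in l -> A T) -> 0 < e ->
    exists2 psi, S psi & forall T, T \in l -> normc (psi T - phi T) < e) ->
  in_weakstar_closure A S phi.
Proof.
move=> H; apply: ptws_closure => l e e0.
have [|psi Spsi Hpsi] := H [seq set_val u | u <- l] e _ e0.
  by move=> T /mapP[u _ ->]; exact: set_valP.
exists (sigL A psi); first by exists psi.
move=> u ul; apply: Hpsi; apply/mapP; exists u => //.
by elim: l ul {H} => //= v l IH [->|/IH]; rewrite inE ?eqxx// => ->; rewrite orbT.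
Qed.

Lemma approx_of_weakstar_closure (S : set (B -> C)) (phi : B -> C) T (e : R) :
  in_weakstar_closure A S phi -> A T -> 0 < e ->
  exists2 psi, S psi & normc (psi T - phi T) < e.
Proof.
move=> H AT e0; have AT' : T \in A by exact: mem_set.
have eC : 0 < e%:C :> C by rewrite ltcR.
have [_ [psi Spsi <-]] := ptws_closure_near (u := SigSub AT' : A) H
  (nbhsx_ballx (sigL A phi (SigSub AT')) e%:C eC).
rewrite -ball_normE /= -[ `|_| ]/((normc _)%:C) ltcR => near.
by exists psi => //; rewrite normcB.
Qed.

(** Removing its trace from the approximation error makes the scalar term exactly [tau T]; this at
    most doubles the error, hence [e / 2]. *)
Lemma trace_decomposition T (e : R) : A T -> 0 < e ->
  exists (l : seq (C * G)) (S : B), [/\ forall a, a \in l -> a.2 <> 1%g, A S, opnorm S < e &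
    T = S + (tau T *: (1 : B) + \sum_(a <- l) a.1 *: lreg a.2)].
Proof.
move=> AT e0; have e2 : 0 < e / 2 by rewrite divr_gt0.
have [U [l [lT UE]] TU] := reduced_cstar_dense TG AT e2.
have AU : A U by apply: reduced_cstar_gspan => //; exists l.
exists [seq a <- l | a.2 != 1%g], (T - U - tau (T - U) *: (1 : B)); split.
- by move=> a; rewrite mem_filter => /andP[/eqP].
- exact: (starB cA.1 (starB cA.1 AT AU) (starZ cA.1 _ A1)).
- apply: le_lt_trans (opnormD _ _) _; rewrite opnormN opnormZ.
  have := trace_le_opnorm (T - U).
  have := ler_wpM2l (normc_ge0 (tau (T - U))) (opnorm1_le R G).
  by move: TU; lra.
have -> : \sum_(a <- [seq a <- l | a.2 != 1%g]) a.1 *: lreg a.2 = U - tau U *: (1 : B).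
  rewrite {1}UE UE trace_sum scaler_suml -sumrB big_filter big_mkcond /=.
  apply: eq_bigr => a _; rewrite traceZ trace_lreg; case: eqP => [->|_] /=.
    by rewrite lreg1 mulr1 subrr.
  by rewrite mulr0 scale0r subr0.
have -> : tau (T - U) = tau T - tau U by rewrite traceD traceN.
rewrite scalerBl opprB addrA -(addrA (T - U)) subrK -addrA [_ + (U - _)]addrC.
by rewrite !subrK.
Qed.

(* [x] stands for an average or for a state, [err x T] for its distance to the
   trace at [T], and [v x s] for its size at the group element [s]. *)
Lemma trace_approx (J : Type) (Q : J -> Prop) (err : J -> B -> R) (v : J -> G -> R) :
  (forall x T S (l : seq (C * G)), Q x -> A S ->
    T = S + (tau T *: (1 : B) + \sum_(a <- l) a.1 *: lreg a.2) ->
    err x T <= 2 * opnorm S + \sum_(a <- l) normc a.1 * v x a.2) ->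
  forall (Ts : seq B) (e : R), (forall T, T \in Ts -> A T) -> 0 < e ->
  exists (ss : seq G) (d : R), [/\ forall s, s \in ss -> s <> 1%g, 0 < d &
    forall x, Q x -> (forall s, s \in ss -> v x s < d) -> forall T, T \in Ts -> err x T < e].
Proof.
move=> errP Ts e + e0; have e4 : 0 < e / 4 by rewrite divr_gt0.
elim: Ts => [|T Ts IH] ATs; first by exists [::], 1; split; rewrite ?ltr01.
have [|ss [d [ss1 d0 ssP]]] := IH; first by move=> S Sl; apply: ATs; rewrite inE Sl orbT.
have [l [S [l1 AS Se TE]]] := trace_decomposition (ATs T (mem_head _ _)) e4.
pose K : R := \sum_(a <- l) normc a.1.
have K1 : 0 < K + 1 by rewrite ltr_wpDl// sumr_ge0// => a _; exact: normc_ge0.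
pose d' := e / 4 / (K + 1); have d'0 : 0 < d' by rewrite divr_gt0.
exists ([seq a.2 | a <- l] ++ ss), (Num.min d' d); split=> [s||x Qx xP U].
- by rewrite mem_cat => /orP[/mapP[a al ->]|/ss1//]; exact: l1.
- by rewrite lt_min d'0.
rewrite inE => /orP[/eqP->|]; last first.
  by apply: ssP => // s sss; have := xP s; rewrite mem_cat sss orbT lt_min => /(_ isT)/andP[].
apply: le_lt_trans (errP _ _ _ _ Qx AS TE) _.
have : \sum_(a <- l) normc a.1 * v x a.2 <= \sum_(a <- l) normc a.1 * d'.
  rewrite big_seq [leRHS]big_seq; apply: ler_sum => a al; rewrite ler_wpM2l ?normc_ge0//.
  have := xP a.2; rewrite mem_cat map_f//= lt_min => /(_ isT)/andP[h _]; exact: ltW.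
rewrite -mulr_suml -/K => h; have : K * d' <= e / 4.
  by rewrite /d' mulrCA ler_piMr ?(ltW e4)// ler_pdivrMr// mul1r lerDl.
by move: Se h; lra.
Qed.

Definition weakstar_orbit (phi : B -> C) := [set shift_functional s phi | s in L].

Definition averaging_states := forall phi, is_state A phi ->
  in_weakstar_closure A (convex_hull (weakstar_orbit phi)) tau.

Lemma averaging_of_states : averaging_states -> powers_averaging R L.
Proof.
move=> H; apply: powers_averaging_of_states => // x f e nx sf e0 fx.
have Ax : A x.
  by apply: reduced_cstar_gspan => //; case: nx => l [_ ->]; exists l.
have [psi hpsi] := approx_of_weakstar_closure (H _ (cstate_is_state A sf)) Ax e0.
rewrite (trace_nontrivial nx) subr0.
have : e <= complex.Re (psi x).
  (* The half-space of functionals with real part at least [e] at [x] contains the orbit and hence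
     its convex hull, but a functional near the trace is small at [x]. *)
  apply: (@convex_hull_sub _ _ (weakstar_orbit (cstate f)) [set p | e <= complex.Re (p x)]) hpsi.
    apply: convex_setP => p q a /andP[a0 a1] /= pe qe.
    rewrite -[leRHS]/(complex.Re (a%:C * p x + (1 - a)%:C * q x)) ReD !ReM.
    have : 0 <= a * (complex.Re (p x) - e) by rewrite mulr_ge0// subr_ge0.
    have : 0 <= (1 - a) * (complex.Re (q x) - e) by rewrite mulr_ge0// subr_ge0.
    lra.
  by move=> _ [t Lt <-] /=; rewrite /shift_functional cnjE; exact: fx.
by move=> h1 h2; have := lt_le_trans h2 (le_trans h1 (Re_le_normc _)); rewrite ltxx.
Qed.

Section Powers.
Hypothesis powers : powers_averaging R L.

Lemma powers_list (ss : seq G) (e : R) : (forall s, s \in ss -> s <> 1%g) -> 0 < e ->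
  exists ts, [/\ ts != [::], forall t, t \in ts -> L t &
    forall s, s \in ss -> opnorm (avg ts (lreg s)) < e].
Proof.
move=> ss1 e0; have [|m [t [Lt tP]]] := powers (s := fun j : 'I_(size ss) => nth 1%g ss j) e0.
  by move=> j; apply/ss1/mem_nth.
exists [seq t k | k <- enum 'I_m.+1]; split.
- by rewrite -size_eq0 size_map size_enum_ord.
- by move=> _ /mapP[k _ ->].
move=> s sss; have ilt : (index s ss < size ss)%N by rewrite index_mem.
have := tP (Ordinal ilt); rewrite /= nth_index//.
rewrite -[ `|_| ]/((opnorm _)%:C) ltcR; congr (opnorm _ < _).
rewrite /avg size_map size_enum_ord fmorphV rmorph_nat; congr (_ *: _).
by rewrite big_map big_enum /=; apply: eq_bigr => k _; rewrite cnj_lreg.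
Qed.

Lemma averaging_to_trace (l : seq B) (e : R) : (forall T, T \in l -> A T) -> 0 < e ->
  exists ts, [/\ ts != [::], forall t, t \in ts -> L t &
    forall T, T \in l -> opnorm (avg ts T - tau T *: (1 : B)) < e].
Proof.
move=> lA e0.
have [|ss [d [ss1 d0 sP]]] := @trace_approx (seq G) (fun ts => ts != [::])
    (fun ts T => opnorm (avg ts T - tau T *: (1 : B))) (fun ts s => opnorm (avg ts (lreg s))) _ l e lA e0.
  move=> ts T S r ts0 _ TE.
  have -> : avg ts T - tau T *: (1 : B) = avg ts S + \sum_(a <- r) a.1 *: avg ts (lreg a.2).
    rewrite {1}TE !avgD avgZ avg1// avg_sum addrA addrAC addrK; congr (_ + _).
    by apply: eq_bigr => a _; rewrite avgZ.
  apply: le_trans (opnormD _ _) _; apply: lerD.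
    by apply: le_trans (opnorm_avg _ _) _; rewrite ler_peMl ?opnorm_ge0// ler1n.
  by apply: le_trans (opnorm_sum _ _) _; apply: ler_sum => a _; rewrite opnormZ.
have [ts [ts0 tsL tsP]] := powers_list ss1 d0.
by exists ts; split=> //; exact: sP.
Qed.

(** Averaging the translates of [phi] over [ts] evaluates [phi] at [avg ts T], which is close in
    norm to a scalar; any state sends that scalar to the trace of [T]. *)
Lemma states_of_averaging : averaging_states.
Proof.
move=> phi sphi; apply: weakstar_closure_approx => l e lA e0.
have e2 : 0 < e / 2 by rewrite divr_gt0.
have [ts [ts0 tsL tsP]] := averaging_to_trace lA e2.
pose psi : B -> C := (size ts)%:R^-1%:C *: \sum_(t <- ts) shift_functional t phi.
exists psi.
  apply: convex_average => //; first exact: convex_hull_convex.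
  by move=> t tts; apply: sub_convex_hull; exists t => //; exact: tsL.
move=> T Tl; have AT := lA _ Tl.
have sumE (r : seq G) : (\sum_(t <- r) shift_functional t phi) T = \sum_(t <- r) phi (cnj t T).
  elim: r => [|t r IH]; first by rewrite !big_nil.
  by rewrite !big_cons -IH /shift_functional -cnjE.
have Acnj t : A (cnj t T) by exact: reduced_cstar_cnj.
have Aavg : A (avg ts T) by apply: (starZ cA.1); exact: (star_sum cA.1).
have psiE : psi T = phi (avg ts T).
  rewrite -[psi T]/(_ * (\sum_(t <- ts) shift_functional t phi) T) sumE.
  by rewrite (stateZ cA sphi) ?(state_sum cA sphi)//; exact: (star_sum cA.1).
have -> : psi T - tau T = phi (- tau T *: (1 : B) + avg ts T).
  have [phiP _ phi1] := sphi.
  by rewrite phiP// phi1 mulr1 psiE addrC.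
have AT' : A (- tau T *: (1 : B) + avg ts T) by exact: (starD cA.1 (starZ cA.1 _ A1)).
apply: le_lt_trans (state_norm_le cA A1 sphi AT') _.
by rewrite scaleNr addrC; have := tsP _ Tl; lra.
Qed.

Lemma dixmier_of_averaging : relative_dixmier (@reduced_cstar R G L) A.
Proof.
move=> a Aa; exists (tau a); apply/bop_closureP => e e0.
have [|ts [ts0 tsL tsP]] := @averaging_to_trace [:: a] e _ e0.
  by move=> T; rewrite inE => /eqP->.
exists (avg ts a); last by rewrite opnormB; apply: tsP; rewrite inE eqxx.
apply: convex_average => //; first exact: convex_hull_convex.
move=> t tts; apply: sub_convex_hull; exists (lreg t); last by rewrite /= cnjE.
split; first by apply: reduced_cstar_lreg; exact: tsL.
by rewrite /unitary_op adj_lreg lregVr lregV.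
Qed.

End Powers.

Lemma irreducible_of_dixmier : relative_dixmier (@reduced_cstar R G L) A ->
  cstar_irreducible (@reduced_cstar R G L) A.
Proof.
move=> dix D [[D0 DP DM DA] cD] BD DsubA.
have B1 : reduced_cstar L (1 : B) by exact: reduced_cstar1.
have D1 : D 1 by exact: BD.
split.
  move=> D00; move: D1; rewrite D00 => /= /(congr1 tau).
  by rewrite trace1 traceE => /eqP; rewrite oner_eq0.
move=> J [JD J0 JP JM cJ].
have [[a [Ja a0]]|noa] := pselect (exists a, J a /\ a <> 0); last first.
  left; apply/seteqP; split=> [a Ja|_ ->//]; apply: contrapT => a0.
  by apply: noa; exists a.
right; apply/seteqP; split=> // d Dd.
have Jaa : J (adj a * a) by have [] := JM (adj a) a (DA _ (JD _ Ja)) Ja.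
have Aaa : A (adj a * a) by apply: (DsubA); exact: JD.
have [c cP] := dix _ Aaa.
(* [K] is closed, convex and contains the unitary conjugates of [adj a * a], so it contains the
   Dixmier scalar: this scalar lies in [J] and equals a nonzero trace. *)
pose K := [set T : B | J T /\ tau T = tau (adj a * a)].
have KJ : K (c *: (1 : B)).
  have cK : closed K.
    apply/bop_closedP => T TK; split.
      by move/bop_closedP: cJ; apply=> e /TK[S [JS _] TS]; exists S.
    apply/eqP; rewrite -subr_eq0; apply/eqP/eq0_normc/(@eq0_small _ _ 1).
      exact: normc_ge0.
    move=> e /TK[S [_ <-] /ltW TS]; rewrite mul1r; apply: le_trans TS.
    have -> : tau T - tau S = tau (T - S) by rewrite traceD traceN.
    exact: trace_le_opnorm.
  apply: cK; apply: closure_subset cP; apply: convex_hull_sub.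
    apply: convex_setP => x y s _ [Jx tx] [Jy ty]; split.
      apply: (JP) => //; rewrite -[_ *: _]addr0; exact: (JP).
    by rewrite traceD !traceZ tx ty -mulrDl -rmorphD addrC subrK rmorph1 mul1r.
  move=> _ [u [Bu [uu1 uu2]] <-]; have Du := BD _ Bu.
  have Jau : J (adj u * (adj a * a)) by have [] := JM (adj u) _ (DA _ Du) Jaa.
  split; first by have [] := JM u _ Du Jau.
  rewrite (trace_comm TG); first by rewrite mulrA uu2 mul1r.
    by apply: (DsubA); exact: JD.
  exact: DsubA.
case: KJ => J1 c1.
have c0 : c != 0.
  apply/eqP => cz; apply: a0; apply: (trace_faithful TG).
    by apply: (DsubA); exact: JD.
  by rewrite -c1 cz traceZ mul0r.
have {}J1 : J 1.
  by have := JP c^-1 _ _ J1 J0; rewrite addr0 scalerA mulVf// scale1r.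
by have [] := JM d 1 Dd J1; rewrite mulr1.
Qed.

End Equivalences.

(** * From a finitely additive content to a Radon probability measure *)

Section InnerContent.
Context (R : realType) (X : ptopologicalType).
Hypotheses (cX : compact [set: X]) (hX : hausdorff_space X).
Variable n : set X -> R.
Hypotheses (n_ge0 : forall A, 0 <= n A) (nT : n setT = 1).
Hypothesis nU : forall A B, A `&` B = set0 -> n (A `|` B) = n A + n B.
Implicit Types (A B K O U V : set X).

Let n_mono A B : A `<=` B -> n A <= n B.
Proof.
move=> AB; rewrite -(setDUK AB) nU ?lerDl//.
by rewrite setDIK.
Qed.

Let n0 : n set0 = 0.
Proof.
have := @nU set0 set0; rewrite setU0 set0I => /(_ erefl) /eqP.
by rewrite eq_sym -subr_eq0 addrK => /eqP.
Qed.

Let n_le1 A : n A <= 1. Proof. by rewrite -nT n_mono. Qed.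

Let n_subadd A B : n (A `|` B) <= n A + n B.
Proof.
rewrite -(setDUK (@subsetUl _ A B)) nU ?setDIK// lerD2l; apply: n_mono.
by move=> x [[]].
Qed.

(** [n] is only finitely additive; its regularization from inside by closed sets is the one used on
    open sets. *)
Definition inner O : R := sup [set n K | K in [set K | closed K /\ K `<=` O]].

Let inner_has_sup O : has_sup [set n K | K in [set K | closed K /\ K `<=` O]].
Proof.
split; first by exists (n set0), set0 => //; split=> //; exact: closed0.
by exists 1 => _ [K _ <-].
Qed.

Lemma inner_ub O K : closed K -> K `<=` O -> n K <= inner O.
Proof. by move=> cK KO; apply: ub_le_sup; [case: (inner_has_sup O)|exists K]. Qed.

Lemma inner_le O (M : R) : (forall K, closed K -> K `<=` O -> n K <= M) -> inner O <= M.
Proof.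
move=> H; apply: ge_sup => [|_ [K [cK KO] <-]]; last exact: H.
by case: (inner_has_sup O).
Qed.

Lemma inner_adherent O (e : R) : 0 < e -> exists K, [/\ closed K, K `<=` O & inner O - e < n K].
Proof.
by move=> e0; have [_ [K [cK KO] <-] lt] := sup_adherent e0 (inner_has_sup O); exists K.
Qed.

Let inner_ge0 O : 0 <= inner O.
Proof. by rewrite -n0; apply: inner_ub; [exact: closed0|]. Qed.

Let inner_le1 O : inner O <= 1. Proof. by apply: inner_le. Qed.

Let inner_mono U V : U `<=` V -> inner U <= inner V.
Proof. by move=> UV; apply: inner_le => K cK KU; apply: inner_ub => //; exact: subset_trans UV. Qed.

Let closed_split K U V : closed K -> open U -> open V -> K `<=` U `|` V ->
  exists K1 K2, [/\ closed K1 /\ K1 `<=` U, closed K2 /\ K2 `<=` V & K `<=` K1 `|` K2].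
Proof.
move=> cK oU oV KUV.
have cA : closed (K `\` V) by apply: closedI => //; exact: open_closedC.
have AU : set_nbhs (K `\` V) U.
  by apply/set_nbhsP; exists U; split=> // x [Kx nVx]; have [] := KUV _ Kx.
have [W /set_nbhsP[W' [oW' AW' W'W]] WU] := compact_normal hX cX cA AU.
exists (K `&` closure W), (K `\` W'); split.
- by split; [apply: closedI => //; exact: closed_closure|move=> x [_ /WU]].
- split; first by apply: closedI => //; exact: open_closedC.
  by move=> x [Kx nW'x]; apply: contrapT => nVx; apply/nW'x/AW'.
move=> x Kx; have [W'x|nW'x] := pselect (W' x); last by right.
by left; split=> //; apply/subset_closure/W'W.
Qed.

Let innerU U V : open U -> open V -> inner (U `|` V) <= inner U + inner V.
Proof.
move=> oU oV; apply: inner_le => K cK KUV.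
have [K1 [K2 [[c1 K1U] [c2 K2V] KK]]] := closed_split cK oU oV KUV.
apply: le_trans (n_mono KK) _; apply: le_trans (n_subadd _ _) _.
by apply: lerD; exact: inner_ub.
Qed.

Let inner_finite (U : nat -> set X) m : (forall i, open (U i)) ->
  inner (\big[setU/set0]_(i < m) U i) <= \sum_(i < m) inner (U i).
Proof.
move=> oU; elim: m => [|m IH].
  rewrite !big_ord0; apply: inner_le => K _; rewrite subset0 => ->.
  by rewrite n0.
rewrite !big_ord_recr /=; apply: le_trans (innerU _ _) _ => //.
  by rewrite -(bigcup_mkord m U); apply: bigcup_open.
by rewrite lerD2r.
Qed.

(** A closed set nearly exhausting the union is compact, so finitely many of the open sets cover
    it. *)
Let inner_countable (U : nat -> set X) : (forall i, open (U i)) ->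
  ((inner (\bigcup_i U i))%:E <= \sum_(i <oo) (inner (U i))%:E)%E.
Proof.
move=> oU; apply/lee_addgt0Pr => e e0.
have [K [cK KU lt]] := inner_adherent (\bigcup_i U i) e0.
have kK : compact K by apply: subclosed_compact cK cX _.
move: kK; rewrite compact_cover => /(_ _ setT U)[//|x Kx|D _ KD].
  by have [i _ Ux] := KU _ Kx; exists i.
pose m := (\max_(i <- D) i).+1.
have Km : K `<=` \big[setU/set0]_(i < m) U i.
  move=> x /KD[i /= iD Ux]; rewrite -bigcup_mkord; exists i => //=.
  by rewrite /m ltnS; apply: (@leq_bigmax_seq _ _ xpredT id).
apply: (@le_trans _ _ ((\sum_(i < m) inner (U i))%:E + e%:E)%E).
  rewrite -EFinD lee_fin -lerBlDr; apply: le_trans (ltW lt) _.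
  by apply: le_trans (inner_finite _ oU); apply: inner_ub.
rewrite leeD2r// -sumEFin -(big_mkord xpredT (fun i => (inner (U i))%:E)).
by apply: nneseries_lim_ge => i _ _; rewrite lee_fin.
Qed.

Definition outer A : \bar R := ereal_inf [set (inner O)%:E | O in [set O | open O /\ A `<=` O]].

Lemma outer_le A O : open O -> A `<=` O -> (outer A <= (inner O)%:E)%E.
Proof. by move=> oO AO; apply: ereal_inf_lbound; exists O. Qed.

Lemma le_outer A (M : \bar R) :
  (forall O, open O -> A `<=` O -> (M <= (inner O)%:E)%E) -> (M <= outer A)%E.
Proof. by move=> H; apply: le_ereal_inf_tmp => _ [U [oU AU] <-]; exact: H. Qed.

Lemma outer_open O : open O -> outer O = (inner O)%:E.
Proof.
move=> oO; apply/eqP; rewrite eq_le outer_le//=.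
by apply: le_outer => V oV OV; rewrite lee_fin inner_mono.
Qed.

Let outer_ge0 A : (0 <= outer A)%E.
Proof. by apply: le_outer => O _ _; rewrite lee_fin. Qed.

Let outer_le1 A : (outer A <= 1)%E.
Proof. by apply: le_trans (@outer_le A setT openT _) _ => //; rewrite lee_fin. Qed.

Let outer_fin A : outer A \is a fin_num.
Proof. by rewrite ge0_fin_numE// (le_lt_trans (outer_le1 A))// ltry. Qed.

Let outer0 : outer set0 = 0%E.
Proof.
rewrite (outer_open open0); congr (_%:E); apply/eqP; rewrite eq_le inner_ge0 andbT.
by apply: inner_le => K _; rewrite subset0 => ->; rewrite n0.
Qed.

Let le_outer_mono : {homo outer : A B / A `<=` B >-> (A <= B)%E}.
Proof.
move=> A B AB; apply: le_outer => O oO BO; apply: outer_le => //.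
exact: subset_trans BO.
Qed.

Let outer_adherent A (e : R) : 0 < e ->
  exists O, [/\ open O, A `<=` O & ((inner O)%:E <= outer A + e%:E)%E].
Proof.
move=> e0; have [_ [U [oU AU] <-] /ltW lt] := lb_ereal_inf_adherent e0 (outer_fin A).
by exists U.
Qed.

Let outer_sigma_subadditive : sigma_subadditive outer.
Proof.
move=> F; apply/lee_addgt0Pr => e e0.
have e_ i : 0 < e / (2 ^ i.+1)%:R by rewrite divr_gt0// ltr0n expn_gt0.
have /choice[ O OP] : forall i, exists O, [/\ open O, F i `<=` O &
    ((inner O)%:E <= outer (F i) + (e / (2 ^ i.+1)%:R)%:E)%E].
  by move=> i; exact: outer_adherent.
apply: (@le_trans _ _ (\sum_(i <oo) (inner (O i))%:E)%E).
  apply: le_trans (inner_countable _); last by move=> i; have [] := OP i.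
  apply: outer_le; first by apply: bigcup_open => i _; have [] := OP i.
  by move=> x [i _ Fx]; exists i => //; have [_ FO _] := OP i; exact: FO.
apply: le_trans (epsilon_trick xpredT _ (ltW e0)); last by [].
apply: lee_nneseries; first by move=> i _ _; rewrite lee_fin.
by move=> i _; have [] := OP i.
Qed.

HB.instance Definition _ := isOuterMeasure.Build R X outer
  outer0 outer_ge0 le_outer_mono outer_sigma_subadditive.

(** [K] nearly exhausts [W] inside [O] and [K'] nearly exhausts the rest of [W]; being disjoint and
    closed, they add up inside [W]. *)
Lemma outer_open_measurable O : open O -> outer.-caratheodory O.
Proof.
move=> oO; apply: le_caratheodory_measurable => A.
apply: le_outer => W oW AW; apply/lee_addgt0Pr => e e0.
have e2 : 0 < e / 2 by rewrite divr_gt0.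
have [K [cK KWO ltK]] := inner_adherent (W `&` O) e2.
have [K' [cK' K'W ltK']] := inner_adherent (W `\` K) e2.
have h1 : (outer (A `&` O) <= (inner (W `&` O))%:E)%E.
  by apply: outer_le; [exact: openI|exact: setSI].
have h2 : (outer (A `&` ~` O) <= (inner (W `\` K))%:E)%E.
  apply: outer_le; first by apply: openI => //; exact: closed_openC.
  by move=> x [Ax nOx]; split; [exact: AW|move=> /KWO[]].
apply: le_trans (leeD h1 h2) _; rewrite -!EFinD lee_fin.
have KK : n (K `|` K') = n K + n K'.
  apply: nU; apply/seteqP; split=> // x [Kx /K'W[_]]; exact.
have : n (K `|` K') <= inner W.
  apply: inner_ub; first exact: closedU.
  by move=> x [/KWO[]|/K'W[]].
rewrite KK; lra.
Qed.

Let borel_measurable (A : set (borel X)) : measurable A -> outer.-caratheodory (A : set X).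
Proof.
apply: smallest_sub; last by move=> O; exact: outer_open_measurable.
split.
- exact: caratheodory_measurable_set0.
- by move=> B mB; rewrite setTD; exact: caratheodory_measurable_setC.
- by move=> F mF; exact: caratheodory_measurable_bigcup.
Qed.

(** The same set function, typed on the Borel structure, so that a measure for this sigma-algebra
    can be declared on it. *)
Let outer_borel : set (borel X) -> \bar R := outer.

Let outer_borel_sigma_additive : semi_sigma_additive outer_borel.
Proof.
move=> F mF tF mUF; apply: (@caratheodory_measure_sigma_additive _ _ outer) => //.
  by move=> i; exact: borel_measurable.
exact: borel_measurable.
Qed.

HB.instance Definition _ := isMeasure.Build _ (borel X) R outer_borel
  outer0 outer_ge0 outer_borel_sigma_additive.

Let outer_borelT : outer_borel setT = 1%E.
Proof.
rewrite /outer_borel (outer_open openT); congr (_%:E); apply/eqP; rewrite eq_le inner_le1/=.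
by rewrite -[leLHS]nT; apply: inner_ub => //; exact: closedT.
Qed.

HB.instance Definition _ := Measure_isProbability.Build _ (borel X) R outer_borel outer_borelT.

(** Inner regularity at [A] is outer regularity at its complement, since closed sets are compact.
    The values on open sets allow a return from [mu] to [n]. *)
Theorem radon_of_content : exists mu : probability (borel X) R,
  radon mu /\ forall O : set X, open O -> mu O = (inner O)%:E.
Proof.
exists (outer_borel : probability _ _); split; last exact: outer_open.
move=> A mA; apply/eqP; rewrite eq_le; apply/andP; split; last first.
  apply: ge_ereal_sup => _ [K [_ KA] <-]; exact: le_outer_mono.
apply/lee_addgt0Pr => e e0.
have [ O [oO AO Oe]] := outer_adherent (~` A) e0.
have KA : ~` O `<=` A by rewrite -[A]setCK; exact: subsetC.
have mO : measurable (O : set (borel X)) by exact: sub_sigma_algebra.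
have PC := probability_setC (outer_borel : probability _ _).
apply: (@le_trans _ _ (outer_borel (~` O) + e%:E)%E); last first.
  rewrite leeD2r//; apply: ereal_sup_ubound; exists (~` O) => //; split=> //.
  by apply: subclosed_compact cX _ => //; exact: open_closedC.
move: Oe; rewrite -(outer_open oO) -[outer O]/(outer_borel O) -[outer (~` A)]/(outer_borel (~` A)).
have := PC A mA; have := PC O mO => /= -> ->.
rewrite -(fineK (outer_fin A : outer_borel A \is a fin_num)).
rewrite -(fineK (outer_fin O : outer_borel O \is a fin_num)).
rewrite -!EFinN -!EFinD !lee_fin; lra.
Qed.

End InnerContent.

(** * Multiplication operators and the values of states at them *)

Section MultiplicationOperators.
Context (R : realType) (G : groupType).
Local Notation B := (bop R G).
Implicit Types (F : G -> R) (x : ell2 R G).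

Lemma bounded_real01 F : (forall k, 0 <= F k <= 1) -> bounded_real F.
Proof. by move=> F01; exists 1 => k; rewrite ger0_norm; have /andP[] := F01 k. Qed.

Lemma form_mulop F x : bounded_real F ->
  has_sum (fun k => (F k * normc (x k) ^+ 2)%:C) (form (mulop F) x)%:C.
Proof.
move=> bF.
have H : has_sum (fun k => (F k * normc (x k) ^+ 2)%:C) (dotp (mulop F x) x).
  by apply: eq_has_sum (dotpP _ _) => k; rewrite mulopE// -mulrA mulcJ -rmorphM.
suff -> : (form (mulop F) x)%:C = dotp (mulop F x) x by [].
apply/RRe_real/CrealP; rewrite -[LHS]/(conjc (dotp (mulop F x) x)) -dotpC.
apply: dotp_has_sum; apply: eq_has_sum (dotpP (mulop F x) x) => k.
by rewrite mulopE// conjcMr mulrCA mulrA.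
Qed.

Lemma has_sum_ge0 (a : G -> R) (s : R) : (forall k, 0 <= a k) ->
  has_sum (fun k => (a k)%:C) s%:C -> 0 <= s.
Proof.
move=> a0 H; rewrite leNgt; apply/negP => s0.
have ms : 0 < - s by rewrite oppr_gt0.
have [A /(_ A (fsubset_refl _))] := H _ ms; rewrite -rmorph_sum -rmorphB normcR.
have : 0 <= \sum_(i <- A) a i by apply: sumr_ge0.
by move=> h0; rewrite ger0_norm ?subr_ge0 ?(le_trans (ltW s0))//; lra.
Qed.

Lemma mulop_adj F : bounded_real F -> adj (mulop F) = mulop F.
Proof.
move=> bF; apply: adj_unique => x y; apply: dotp_has_sum.
apply: eq_has_sum (dotpP x (mulop F y)) => k.
by rewrite !mulopE// conjcMr mulrCA mulrA.
Qed.

Lemma mulopM F F' : bounded_real F -> bounded_real F' ->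
  mulop F * mulop F' = mulop (fun k => F k * F' k) :> B.
Proof.
move=> bF bF'; apply: bop_ext => x; apply: ell2_ext => k.
rewrite bopME !mulopE// ?rmorphM ?mulrA//.
have [M FM] := bF; have [M' FM'] := bF'; exists (M * M') => j.
by rewrite normrM ler_pM.
Qed.

Lemma mulopP (a : R) F F' : bounded_real F -> bounded_real F' ->
  mulop (fun k => a * F k + F' k) = a%:C *: mulop F + mulop F' :> B.
Proof.
move=> bF bF'; apply: bop_ext => x; apply: ell2_ext => k.
rewrite -[RHS]/(a%:C * mulop F x k + mulop F' x k) !mulopE//.
  by rewrite rmorphD rmorphM mulrDl mulrA.
have [M FM] := bF; have [M' FM'] := bF'; exists (`|a| * M + M') => j.
by apply: le_trans (ler_normD _ _) _; rewrite normrM lerD// ler_wpM2l.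
Qed.

Lemma bounded_real_cst (a : R) : bounded_real (fun _ : G => a).
Proof. by exists `|a|. Qed.

Lemma mulop_cst (a : R) : mulop (fun _ => a) = a%:C *: (1 : B).
Proof.
apply: bop_ext => x; apply: ell2_ext => k; rewrite mulopE//.
exact: bounded_real_cst.
Qed.

Lemma bounded_indic (E : set G) : bounded_real (\1_E : G -> R).
Proof. by apply: bounded_real01 => k; rewrite indicE; case: (_ \in _); rewrite ?lexx ?ler01. Qed.

Lemma mulop_indic_proj (E : set G) : mulop \1_E * mulop \1_E = mulop \1_E :> B.
Proof.
rewrite mulopM; [|exact: bounded_indic..]; congr mulop; apply/funext => k.
by rewrite indicE; case: (_ \in _); rewrite ?mulr1 ?mulr0.
Qed.

Lemma cnj_mulop F s : bounded_real F ->
  cnj s (mulop F) = mulop (fun k => F (s * k)%g) :> B.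
Proof.
move=> bF; apply: bop_ext => x; apply: ell2_ext => k.
rewrite /cnj !bopME lregE mulopE// lregE invgK mulKg mulopE//.
by have [M FM] := bF; exists M.
Qed.

Lemma rstate_mulop_ge0 f F : rstate f -> bounded_real F -> (forall k, 0 <= F k) ->
  0 <= f (mulop F).
Proof.
move=> sf bF F0; rewrite -(real_linear0 sf.1); apply: rstate_mono => // x.
rewrite [leLHS]/form dotp0l; apply: has_sum_ge0 (form_mulop x bF) => k.
by rewrite mulr_ge0 ?sqr_ge0.
Qed.

Lemma rstate_mulop_le f F F' : rstate f -> bounded_real F -> bounded_real F' ->
  (forall k, F k <= F' k) -> f (mulop F) <= f (mulop F').
Proof.
move=> sf bF bF' FF'.
have := mulopP (-1) bF bF'; rewrite rmorphN1 scaleN1r addrC => E.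
rewrite -subr_ge0 -(real_linearB _ _ sf.1) -E; apply: rstate_mulop_ge0 => // [|k].
  have [M FM] := bF; have [M' FM'] := bF'; exists (M + M') => j.
  by rewrite mulN1r; apply: le_trans (ler_normD _ _) _; rewrite normrN lerD.
by rewrite mulN1r addrC subr_ge0.
Qed.

Lemma rstate_mulopP f (a : R) F F' : rstate f -> bounded_real F -> bounded_real F' ->
  f (mulop (fun k => a * F k + F' k)) = a * f (mulop F) + f (mulop F').
Proof. by move=> sf bF bF'; rewrite mulopP// sf.1.1 sf.1.2. Qed.

Lemma rstate_mulop_cst (f : B -> R) (a : R) : rstate f -> f (mulop (fun _ => a)) = a.
Proof. by move=> sf; rewrite mulop_cst rstate_const. Qed.

(* If [f] almost lives on the range of the projection [F], then so does its
   value at [u], which is small when [u] moves this range off itself. *)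
Lemma rstate_disjoint f (F u : B) (d : R) : rstate f -> adj F = F -> F * F = F ->
  opnorm u <= 1 -> F * u * F = 0 -> f (1 - F) <= d -> f u ^+ 2 <= 4 * d.
Proof.
move=> sf Fa FF u1 FuF fd; have lf := sf.1.
have F'a : adj (1 - F) = 1 - F by rewrite adjB adj1 Fa.
have F'F' : (1 - F) * (1 - F) = 1 - F.
  by rewrite mulrBl mul1r mulrBr mulr1 FF subrr subr0.
have d0 : 0 <= d by apply: le_trans fd; rewrite -F'F' -{1}F'a rstate_sqr_ge0.
have sq T : opnorm T <= 1 -> f (adj T * T) <= 1.
  move=> T1; apply: le_trans (rstate_le_opnorm sf _) _.
  by apply: le_trans (opnormM _ _) _; rewrite opnorm_adj -[leRHS]mulr1 ler_pM ?opnorm_ge0.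
have F1 : opnorm F <= 1.
  apply: opnorm_le_bound => // x; rewrite mul1r.
  have : ell2norm (F x) ^+ 2 <= ell2norm (F x) * ell2norm x.
    have -> : ell2norm (F x) ^+ 2 = complex.Re (dotp (F x) x).
      by rewrite -[LHS]/(complex.Re ((_)%:C)) -dotp_adjM Fa -bopME FF.
    exact: Re_dotp_le.
  have [->|n0] := eqVneq (ell2norm (F x)) 0; first by rewrite ell2norm_ge0.
  by rewrite expr2 ler_pM2l// lt_neqAle eq_sym n0 ell2norm_ge0.
have uF1 : opnorm (u * F) <= 1.
  by apply: le_trans (opnormM _ _) _; rewrite -[leRHS]mulr1 ler_pM ?opnorm_ge0.
(* The corner [F * u * F] is zero; each remaining term has square at most [d], and the square of a
   sum of two is at most twice the sum of squares, hence the 4. *)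
have split : f u = f (u * (1 - F)) + f ((1 - F) * (u * F)).
  rewrite -lf.1; congr f; rewrite mulrBr mulr1 mulrBl mul1r mulrA FuF subr0.
  by rewrite subrK.
have h1 : f (u * (1 - F)) ^+ 2 <= d.
  rewrite -[u]adjK; apply: le_trans (rstate_cauchy_schwarz sf _ _) _.
  rewrite F'a F'F'; have := sq (adj u); rewrite opnorm_adj => /(_ u1).
  have := rstate_sqr_ge0 sf (adj u).
  have : 0 <= f (1 - F) by rewrite -F'F' -{1}F'a rstate_sqr_ge0.
  nra.
have h2 : f ((1 - F) * (u * F)) ^+ 2 <= d.
  rewrite -F'a; apply: le_trans (rstate_cauchy_schwarz sf _ _) _.
  rewrite F'a F'F'; have := sq _ uF1; have := rstate_sqr_ge0 sf (u * F).
  have : 0 <= f (1 - F) by rewrite -F'F' -{1}F'a rstate_sqr_ge0.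
  nra.
rewrite split; move: h1 h2; set p := f _; set q := f _ => h1 h2.
by have := sqr_ge0 (p - q); rewrite sqrrB sqrrD; lra.
Qed.

End MultiplicationOperators.

(** * From free contraction on a boundary to convergence of states *)

Section BoundaryToStates.
Context (R : realType) (G : groupType).
Local Notation C := R[i].
Local Notation B := (bop R G).
Local Notation lreg := (@lreg R G).
Local Notation tau := (@canonical_trace R G).
Variables (L : set G) (LG : subgroup L).
Local Notation A := (@reduced_cstar R G [set: G]).
Implicit Types (T S : B).

Let TG := @subgroupT G.
Let cA : cstar_subalgebra A. Proof. exact: reduced_cstar_cstar. Qed.
Let A1 : A 1. Proof. exact: reduced_cstar1. Qed.
Let A_lreg t : A (lreg t). Proof. exact: reduced_cstar_lreg. Qed.

Lemma is_state_shift (phi : B -> C) s : is_state A phi -> is_state A (shift_functional s phi).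
Proof.
move=> [phiP phi0 phi1]; have [[_ _ AM _] _] := cA.
split=> [c T S AT AS|T AT|]; rewrite /shift_functional ?cnjE.
- by rewrite cnjD cnjZ; apply: phiP; apply: reduced_cstar_cnj.
- rewrite cnjM (_ : cnj s (adj T) = adj (cnj s T)); last first.
    by rewrite /cnj !adjM !adj_lreg invgK mulrA.
  by apply: phi0; apply: reduced_cstar_cnj.
- by rewrite cnj1.
Qed.

Lemma weakstar_closure_trace (S : set (B -> C)) :
  (forall psi, S psi -> is_state A psi) ->
  (forall (ss : seq G) (d : R), (forall s, s \in ss -> s <> 1%g) -> 0 < d ->
    exists2 psi, S psi & forall s, s \in ss -> normc (psi (lreg s)) < d) ->
  in_weakstar_closure A S tau.
Proof.
move=> Sst H; apply: weakstar_closure_approx => l e lA e0.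
have [|ss [d [ss1 d0 sP]]] := @trace_approx R G (B -> C) (is_state A)
    (fun psi T => normc (psi T - tau T)) (fun psi s => normc (psi (lreg s))) _ l e lA e0.
  move=> psi T U r spsi AU TE; have [phiP _ psi1] := spsi.
  have Ar (a : C * G) : A (a.1 *: lreg a.2) by exact: (starZ cA.1).
  have Asum : A (\sum_(a <- r) a.1 *: lreg a.2) by exact: (star_sum cA.1).
  have -> : psi T - tau T = psi U + \sum_(a <- r) a.1 * psi (lreg a.2).
    rewrite {1}TE (stateD spsi AU); last exact: (starD cA.1 (starZ cA.1 _ A1) Asum).
    rewrite phiP// psi1 mulr1 addrA addrAC addrK (state_sum cA spsi _ Ar); congr (_ + _).
    by apply: eq_bigr => a _; rewrite (stateZ cA spsi).
  apply: le_trans (le_normcD _ _) _; apply: lerD; first exact: (state_norm_le cA A1 spsi).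
  elim: (r) => [|a q IH]; first by rewrite !big_nil normc0.
  by rewrite !big_cons; apply: le_trans (le_normcD _ _) _; rewrite normcM lerD2l.
have [psi Spsi psiP] := H _ _ ss1 d0.
by exists psi => //; apply: sP psiP; exact: Sst.
Qed.

Section Boundary.
Variables (X : ptopologicalType) (act : G -> X -> X).
Hypothesis bX : boundary_action R act.

Let cX : compact [set: X]. Proof. by case: bX. Qed.
Let hX : hausdorff_space X. Proof. by case: bX. Qed.
Let actM s t x : act (s * t)%g x = act s (act t x). Proof. by case: bX => _ _ []. Qed.
Let act_cont s : continuous (act s). Proof. by case: bX => _ _ []. Qed.

Lemma free_neighbourhood x (ss : seq G) : acts_freely_on act x ->
  (forall s, s \in ss -> s <> 1%g) ->
  exists U : set X, [/\ open U, U x & forall s y, s \in ss -> U y -> ~ U (act s y)].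
Proof.
move=> fx; elim: ss => [|s ss IH] ss1; first by exists setT; split=> //; exact: openT.
have [|U [oU Ux Uss]] := IH; first by move=> t tss; apply: ss1; rewrite inE tss orbT.
have sx : act s x != x by apply/eqP/fx/ss1; rewrite inE eqxx.
move: hX; rewrite open_hausdorff => /(_ _ _ sx)[[V W]]/= [/set_mem Vsx /set_mem Wx] [oV oW /eqP VW].
exists (U `&` (W `&` act s @^-1` V)); split.
- apply: openI => //; apply: openI => //; apply: open_comp => // z _; exact: act_cont.
- by [].
move=> t y; rewrite inE => /orP[/eqP->|tss] [Uy [Wy Vy]] [Uty [Wty _]].
  by have : (V `&` W) (act s y) by []; rewrite VW.
exact: Uss Uty.
Qed.

(* Integrating a Urysohn function supported in [U] turns weak* convergence of
   translates of [mu] to a point mass into a lower bound for their mass of [U]. *)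
Lemma translate_mass (mu : probability (borel X) R) (x : borel X) (U : set X) (d : R) :
  weakstar_closure_measures (measure_orbit act L mu) \d_x ->
  open U -> U x -> 0 < d ->
  exists2 s, L s & ((1 - d)%:E < mu (act s @^-1` U))%E.
Proof.
move=> mux oU Ux d0.
have sep : uniform_separator (~` U) [set (x : X)].
  have := compact_normal hX cX; move=> /(@normal_separatorP R X); apply.
  - exact: open_closedC.
  - exact/accessible_closed_set1/hausdorff_accessible.
  - by apply/seteqP; split=> // y [] nUy /= yx; apply: nUy; rewrite yx.
pose g : X -> R := Urysohn (~` U) [set (x : X)].
have cg : continuous g by exact: Urysohn_continuous.
have g01 y : 0 <= g y <= 1.
  by have := @Urysohn_range X R (~` U) [set (x : X)] (g y); rewrite /= in_itv /=; apply; exists y.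
have g0 y : ~ U y -> g y = 0 by move=> nUy; apply: (@Urysohn_sub0 X R _ _ sep); exists y.
have gx : g x = 1 by apply: (@Urysohn_sub1 X R _ _ sep); exists x.
have mg : measurable_fun [set: borel X] (g : borel X -> R).
  apply: (measurability _ (measurable_realfun.RGenOpens.measurableE R)).
  move=> _ [_ [a [b ->] <-]]; rewrite setTI; apply: sub_sigma_algebra.
  by apply: open_comp; [move=> z _; exact: cg|exact: interval_open].
have mEg : measurable_fun [set: borel X] (fun y : borel X => (g y)%:E) by exact/measurable_EFinP.
have dx : (\int[\d_x]_(y in [set: borel X]) (g y)%:E = 1)%E.
  by rewrite (integral_dirac _ measurableT mEg) diracT mul1e gx.
have near1 : nbhs (integral_functional (\d_x : probability (borel X) R) (mkcts cg)) [set r | 1 - d < r].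
  have -> : integral_functional (\d_x : probability (borel X) R) (mkcts cg) = 1.
    by rewrite /integral_functional /Rintegral /= dx.
  by apply: open_nbhs_nbhs; split; [exact: open_gt|rewrite /= ltrBlDr ltrDl].
have [_ [nu [s Ls nuE] <-] big] := ptws_closure_near mux near1.
exists s => //.
have mU : measurable (U : set (borel X)) by exact: sub_sigma_algebra.
rewrite -(nuE _ mU).
have le : (\int[nu]_(y in [set: borel X]) (g y)%:E <= nu U)%E.
  have <- : (\int[nu]_(y in [set: borel X]) (\1_U y)%:E = nu U)%E.
    by rewrite integral_indic// setIT.
  apply: ge0_le_integral => //.
  - by move=> y _; rewrite lee_fin; case/andP: (g01 y).
  - by apply/measurable_EFinP; exact: measurable_indic.
  - move=> y _; rewrite lee_fin indicE; have [yU|nyU] := boolP (y \in U).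
      by case/andP: (g01 y).
    by rewrite g0//; move: nyU; rewrite notin_setE.
apply: (lt_le_trans _ le).
have : 1 - d < fine (\int[nu]_(y in [set: borel X]) (g y)%:E)%E by exact: big.
have i0 : (0 <= \int[nu]_(y in [set: borel X]) (g y)%:E)%E.
  by apply: integral_ge0 => y _; rewrite lee_fin; case/andP: (g01 y).
have ifin : (\int[nu]_(y in [set: borel X]) (g y)%:E)%E \is a fin_num.
  rewrite ge0_fin_numE//; apply: le_lt_trans le _.
  by apply: (@le_lt_trans _ _ 1%E); [exact: probability_le1|rewrite ltry].
by rewrite -lte_fin fineK.
Qed.

Hypothesis contract : forall mu : probability (borel X) R, radon mu ->
  exists2 x : borel X, acts_freely_on act x &
    weakstar_closure_measures (measure_orbit act L mu) \d_x.

Lemma free_contraction_small phi (ss : seq G) (d : R) : is_state A phi ->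
  (forall s, s \in ss -> s <> 1%g) -> 0 < d ->
  exists2 s, L s & forall t, t \in ss -> normc (shift_functional s phi (lreg t)) < d.
Proof.
move=> sphi ss1 d0.
have [f [sf fphi]] := state_extension cA A1 sphi.
(* The orbit map of [point] pulls subsets of X back to the group, where [f] can be evaluated at
   their indicators. *)
pose ind (E : set X) (k : G) : R := \1_E (act k point).
have ind01 E k : 0 <= ind E k <= 1 by rewrite /ind indicE; case: (_ \in _); rewrite ?lexx ?ler01.
have bind E : bounded_real (ind E) by exact: bounded_real01.
pose n E := f (mulop (ind E)).
have n_ge0 E : 0 <= n E by apply: rstate_mulop_ge0 => // k; case/andP: (ind01 E k).
have nT : n setT = 1.
  rewrite -(rstate_mulop_cst 1 sf) /n; congr (f (mulop _)); apply/funext => k.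
  by rewrite /ind indicT.
have nU E E' : E `&` E' = set0 -> n (E `|` E') = n E + n E'.
  move=> EE'; rewrite -[n E]mul1r -rstate_mulopP//; congr (f (mulop _)); apply/funext => k.
  rewrite mul1r /ind !indicE in_setU.
  have [kE|kE] := boolP (_ \in E); have [kE'|kE'] := boolP (_ \in E');
    rewrite ?addr0 ?add0r//=.
  have : (E `&` E') (act k point) by split; exact: set_mem.
  by rewrite EE'.
have [mu [rmu muO]] := radon_of_content cX hX n_ge0 nT nU.
have [x fx mux] := contract rmu.
have [U [oU Ux Uss]] := free_neighbourhood fx ss1.
(* Then [4 * e] is the square of [d / 4]; the real and the imaginary part are each at most
   [d / 4]. *)
pose e := (d / 8) ^+ 2.
have e0 : 0 < e / 2 by rewrite divr_gt0// exprn_gt0// divr_gt0.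
have [s Ls] := translate_mass mux oU Ux e0.
have oV : open (act s @^-1` U) by apply: open_comp => // z _; exact: act_cont.
rewrite muO// lte_fin => big.
(* The state sees the content [n] and not [mu]; a closed set of large content inside the open set
   leads back to the state. *)
have [K [cK KV Kbig]] := inner_adherent n_ge0 nT nU (act s @^-1` U) e0.
exists s => // t tss.
pose F : B := mulop (ind K).
have Fa : adj F = F by exact: mulop_adj.
have FF : F * F = F.
  rewrite mulopM//; congr mulop; apply/funext => k.
  by rewrite /ind indicE; case: (_ \in _); rewrite ?mulr1 ?mulr0.
have fF : f (1 - F) <= e by rewrite (real_linearB _ _ sf.1) rstate1// -/(n K); move: big Kbig; lra.
(* As [t] moves [U] off itself, its conjugate by [s] moves the preimage of [U] under [s], which
   contains [K], off itself. *)
have FuF (c : C) : F * (c *: lreg (s^-1 * t * s)%g) * F = 0.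
  rewrite bopZr bopZl; apply/eqP; rewrite scaler_eq0; apply/orP; right; apply/eqP.
  apply: bop_ext => y; apply: ell2_ext => k; rewrite !bopME mulopE// lregE mulopE// mulrA -rmorphM.
  rewrite /ind !indicE; have [kK|] := boolP (_ \in K); last by rewrite mul0r mul0r.
  have [kK'|] := boolP (_ \in K); last by rewrite mulr0 mul0r.
  have h1 := KV _ (set_mem kK); have h2 := KV _ (set_mem kK').
  exfalso; apply: (Uss t _ tss h2); rewrite -!actM; move: h1; rewrite /= -actM.
  congr (U (act _ _)); rewrite mulgA; congr (_ * _)%g.
  by rewrite !invgM invgK !mulgA mulgK mulgV mul1g.
(* Used with [c] equal to 1 and to the imaginary unit. *)
have small (c : C) : normc c = 1 -> `|complex.Re (c * shift_functional s phi (lreg t))| <= d / 4.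
  move=> c1; rewrite /shift_functional cnjE cnj_lreg.
  rewrite -(stateZ cA sphi)// -fphi; last first.
    by apply: reduced_cstar_gspan => //; apply/gspanZ/gspan_lreg.
  have u1 : opnorm (c *: lreg (s^-1 * t * s)%g) <= 1.
    rewrite opnormZ c1 mul1r; apply: opnorm_le_bound => // y.
    by rewrite ell2norm_lreg mul1r.
  have := rstate_disjoint sf Fa FF u1 (FuF c) fF.
  have -> : 4 * e = (d / 4) ^+ 2 by rewrite /e; field.
  by rewrite -real_normK ?num_real// ler_pXn2r ?nnegrE// divr_ge0// ltW.
apply: le_lt_trans (normc_le_ReIm _) _.
have h1 := small 1 (@normc1 R); rewrite mul1r in h1.
have h2 := small 'i%C; rewrite Re_iM normrN [normc _]/= expr0n expr1n add0r sqrtr1 in h2.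
by have {}h2 := h2 erefl; lra.
Qed.

End Boundary.

Lemma states_of_boundary (X : ptopologicalType) (act : G -> X -> X) :
  boundary_action R act ->
  (forall mu : probability (borel X) R, radon mu ->
    exists2 x : borel X, acts_freely_on act x &
      weakstar_closure_measures (measure_orbit act L mu) \d_x) ->
  forall phi, is_state A phi -> in_weakstar_closure A (weakstar_orbit L phi) tau.
Proof.
move=> bX contract phi sphi; apply: weakstar_closure_trace.
  by move=> _ [s _ <-]; exact: is_state_shift.
move=> ss d ss1 d0.
have [s Ls sP] := free_contraction_small bX contract sphi ss1 d0.
by exists (shift_functional s phi) => //; exists s.
Qed.

End BoundaryToStates.

(** * Kesten's criterion and the trivial character of an amenable subgroup *)

Section TrivialState.
Context (R : realType) (G : groupType).
Local Notation C := R[i].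
Local Notation H := (ell2 R G).
Local Notation B := (bop R G).
Local Notation lreg := (@lreg R G).
Implicit Types (f F : G -> R) (h k s : G).

(** The numerical radius equals the norm for selfadjoint operators. The factor 2 of [opnorm_le_nsup]
    would be fatal here, as norms are compared with 1. *)
Lemma opnorm_selfadj_le (N : B) (M : R) : adj N = N -> 0 <= M ->
  (forall y, form N y <= M * ell2norm y ^+ 2) ->
  (forall y, - form N y <= M * ell2norm y ^+ 2) -> opnorm N <= M.
Proof.
move=> Na M0 NM nNM; apply: opnorm_le_bound => // y.
have sym (z : H) : 4 * complex.Re (dotp (N y) z) = form N (y + z) - form N (y - z).
  rewrite /form !(linearD, linearN) /= !(dotpDl, dotpDr, dotpNl, dotpNr) !(ReD, ReN).
  have -> : complex.Re (dotp (N z) y) = complex.Re (dotp (N y) z).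
    by rewrite -{1}Na adjP' Re_dotpC.
  by ring.
have para (z : H) : ell2norm (y + z) ^+ 2 + ell2norm (y - z) ^+ 2 =
    2 * (ell2norm y ^+ 2 + ell2norm z ^+ 2).
  rewrite (ell2normD_sqr y z) (ell2normD_sqr y (- z)) ell2normN dotpNr ReN.
  by move: (ell2norm y ^+ 2) (ell2norm z ^+ 2) (complex.Re _) => p q r; ring.
have le (z : H) : 2 * complex.Re (dotp (N y) z) <= M * (ell2norm y ^+ 2 + ell2norm z ^+ 2).
  have h1 := NM (y + z); have h2 := nNM (y - z).
  have : 4 * complex.Re (dotp (N y) z) <= M * (ell2norm (y + z) ^+ 2 + ell2norm (y - z) ^+ 2).
    by rewrite sym mulrDr lerD.
  rewrite para (mulrCA M).
  by move: (complex.Re _) (M * _) => p q; lra.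
have [/ell2norm0_eq0->|y0] := eqVneq (ell2norm y) 0.
  by rewrite linear0 ell2norm0 mulr0.
have yp : 0 < ell2norm y by rewrite lt_neqAle eq_sym y0 ell2norm_ge0.
have [->|n0] := eqVneq (ell2norm (N y)) 0; first by rewrite mulr_ge0// ltW.
have np : 0 < ell2norm (N y) by rewrite lt_neqAle eq_sym n0 ell2norm_ge0.
have := le ((ell2norm y / ell2norm (N y))%:C *: N y).
rewrite dotpZr conjc_real ReM dotpxx /= ell2normZ normc_real_ge0 ?divr_ge0 ?ell2norm_ge0//.
have -> : 2 * (ell2norm y / ell2norm (N y) * ell2norm (N y) ^+ 2) =
  2 * ell2norm y * ell2norm (N y) by field.
have -> : M * (ell2norm y ^+ 2 + (ell2norm y / ell2norm (N y) * ell2norm (N y)) ^+ 2) =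
  2 * ell2norm y * (M * ell2norm y) by field.
by rewrite ler_pM2l// mulr_gt0.
Qed.

Lemma bounded_realP (a : R) F F' : bounded_real F -> bounded_real F' ->
  bounded_real (fun k => a * F k + F' k).
Proof.
move=> [M FM] [M' FM']; exists (`|a| * M + M') => k.
by apply: le_trans (ler_normD _ _) _; rewrite normrM lerD// ler_wpM2l.
Qed.

(** The Markov operator of the symmetrized step distribution, acting on arbitrary functions;
    [symmetrized] is the same operator on l2. *)
Definition walk (l : seq (R * G)) F k : R :=
  \sum_(a <- l) a.1 / 2 * (F (a.2^-1 * k)%g + F (a.2 * k)%g).

Lemma ler_walk l F F' : (forall a, a \in l -> 0 < a.1) -> (forall k, F k <= F' k) ->
  forall k, walk l F k <= walk l F' k.
Proof.
move=> l0 FF' k; rewrite /walk big_seq [leRHS]big_seq; apply: ler_sum => a /l0 a0.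
by rewrite ler_wpM2l ?lerD// divr_ge0// ltW.
Qed.

Variables (L : set G) (LG : subgroup L).
Let L1 : L 1%g. Proof. by case: LG. Qed.
Let LM s t : L s -> L t -> L (s * t)%g. Proof. by case: LG => _ + _; apply. Qed.
Let LV s : L s -> L s^-1%g. Proof. by case: LG => _ _; apply. Qed.

Let indL_bounded : bounded_real (\1_L : G -> R). Proof. exact: bounded_indic. Qed.

Definition symmetrized (l : seq (R * G)) : B :=
  \sum_(a <- l) (a.1 / 2)%:C *: (lreg a.2 + lreg a.2^-1%g).

Definition compressed_walk (l : seq (R * G)) : B :=
  mulop \1_L * symmetrized l * mulop \1_L.

Section Superharmonic.
Variables (l : seq (R * G)) (lam : R).
Hypothesis lP : forall a, a \in l -> 0 < a.1 /\ L a.2.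
Hypothesis lam01 : 0 < lam < 1.
Hypothesis norm_walk : opnorm (compressed_walk l) <= lam.

(** Above [lam], so that the Green series converges; below 1, so that its sum is strictly
    superharmonic. *)
Let mu := (1 + lam) / 2.
Let mu0 : 0 < mu. Proof. by rewrite /mu; case/andP: lam01; lra. Qed.

Let lam_mu : lam < mu. Proof. by rewrite /mu; case/andP: lam01; lra. Qed.

(** Partial sums of the Green function at parameter [mu]. [green_vec] is its l2 version, where the
    norm bound yields a geometric series with sum [mu / (mu - lam)]. *)
Let green n : G -> R := iter n (fun F k => (k == 1%g)%:R + mu^-1 * walk l F k) (fun=> 0).
Let green_vec n : H :=
  iter n (fun y => delta 1%g + mu^-1%:C *: compressed_walk l y) 0.

Let greenS n k : green n.+1 k = (k == 1%g)%:R + mu^-1 * walk l (green n) k. Proof. by []. Qed.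

Let walk_out F k : (forall h, ~ L h -> F h = 0) -> ~ L k -> walk l F k = 0.
Proof.
move=> F0 nLk; rewrite /walk big_seq big1// => a /lP[_ La].
have nL h : L h -> ~ L (h * k)%g.
  by move=> Lh Lhk; apply: nLk; rewrite -(mulKg h k); apply: LM => //; exact: LV.
by rewrite !F0 ?addr0 ?mulr0//; apply: nL => //; exact: LV.
Qed.

Let green_out n k : ~ L k -> green n k = 0.
Proof.
elim: n k => // n IH k nLk; rewrite greenS walk_out// mulr0 addr0.
by case: eqP => // k1; case: nLk; rewrite k1.
Qed.

Let green_vecE n k : green_vec n k = (green n k)%:C.
Proof.
elim: n k => [|n IH] k; first by rewrite rmorph0.
rewrite greenS /green_vec iterS -/(green_vec n) -[LHS]/((k == 1%g)%:R + mu^-1%:C * compressed_walk l (green_vec n) k).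
rewrite rmorphD rmorph_nat rmorphM; congr (_ + _ * _).
rewrite /compressed_walk !bopME mulopE//.
have -> : mulop \1_L (green_vec n) = green_vec n.
  apply: ell2_ext => h; rewrite mulopE// indicE IH; have [_|] := boolP (_ \in _).
    by rewrite mul1r.
  by rewrite notin_setE => nLh; rewrite green_out// rmorph0 mulr0.
have -> : symmetrized l (green_vec n) k = (walk l (green n) k)%:C.
  rewrite /symmetrized bop_sumE ell2_sumE /walk rmorph_sum; apply: eq_bigr => a _.
  rewrite -[LHS]/((a.1 / 2)%:C * (lreg a.2 (green_vec n) k + lreg a.2^-1%g (green_vec n) k)).
  by rewrite !lregE invgK !IH -rmorphD -rmorphM.
rewrite indicE; have [_|] := boolP (_ \in _); first by rewrite mul1r.
by rewrite notin_setE => nLk; rewrite walk_out// => [|h]; [rewrite rmorph0 mulr0|exact: green_out].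
Qed.

Let green_ge0 n k : 0 <= green n k.
Proof.
elim: n k => // n IH k; rewrite greenS addr_ge0 ?ler0n// mulr_ge0 ?invr_ge0 ?(ltW mu0)//.
rewrite /walk big_seq sumr_ge0// => a /lP[a0 _].
by rewrite mulr_ge0 ?addr_ge0// divr_ge0// ltW.
Qed.

Let green_mono n k : green n k <= green n.+1 k.
Proof.
elim: n k => [|n IH] k; first exact: green_ge0.
rewrite greenS [leRHS]greenS lerD2l ler_wpM2l ?invr_ge0 ?(ltW mu0)//.
by apply: ler_walk => // a /lP[].
Qed.

Let green_bound n k : green n k <= mu / (mu - lam).
Proof.
apply: le_trans (ler_norm _) _; rewrite -normcR -green_vecE.
apply: le_trans (normc_le_ell2norm _ _) _.
have ml : 0 < mu - lam by rewrite subr_gt0.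
elim: n => [|n IH]; first by rewrite ell2norm0 divr_ge0 ?(ltW mu0)// ltW.
rewrite /green_vec iterS -/(green_vec n); apply: le_trans (ell2normD _ _) _.
rewrite ell2norm_delta ell2normZ normc_real_ge0 ?invr_ge0 ?(ltW mu0)//.
have h : ell2norm (compressed_walk l (green_vec n)) <= lam * (mu / (mu - lam)).
  apply: le_trans (opnorm_bound _ _) _.
  by rewrite ler_pM ?opnorm_ge0 ?ell2norm_ge0.
have -> : mu / (mu - lam) = 1 + mu^-1 * (lam * (mu / (mu - lam))).
  by field; rewrite !gt_eqF.
by rewrite lerD2l ler_wpM2l// invr_ge0 ltW.
Qed.

(** The pointwise limit of the Green sums: their recursion passes to the limit, and dropping the
    point mass at 1 leaves the inequality. *)
Lemma superharmonic_exists : exists f, [/\ forall k, 0 <= f k, 0 < f 1%g &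
  forall k, walk l f k <= mu * f k].
Proof.
have nd k : nondecreasing_seq (fun n => green n k).
  by apply/nondecreasing_seqP => n; exact: green_mono.
have cv k : cvgn (fun n => green n k).
  apply: nondecreasing_is_cvgn => //; exists (mu / (mu - lam)) => _ [n _ <-].
  exact: green_bound.
pose f k := limn (fun n => green n k).
have fg n k : green n k <= f k by exact: nondecreasing_cvgn_le.
exists f; split=> [k||k].
- by apply: le_trans (fg 0%N k).
- by apply: lt_le_trans (fg 1%N 1%g); rewrite greenS eqxx ltr_pwDl// mulr_ge0 ?invr_ge0 ?(ltW mu0)// /walk big1// => a _; rewrite addr0 mulr0.
have cw : walk l (green n) k @[n --> \oo] --> walk l f k.
  rewrite /walk; apply: cvg_big => [|a _]; [exact: add_continuous|apply: cvgM]; first exact: cvg_cst.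
  by apply: cvgD; exact: cv.
rewrite -(cvg_lim _ cw)//; apply: limr_le; first exact/cvgP/cw.
apply: nearW => n; rewrite -ler_pdivrMl//.
by apply: le_trans (fg n.+1 k); rewrite greenS lerDr ler0n.
Qed.

End Superharmonic.

Section Amenable.
Variables (x : B -> R) (sx : rstate x).
Hypothesis xL : forall s T, L s -> x (cnj s T) = x T.

Let mean_shift F s : L s -> bounded_real F ->
  x (mulop (fun k => F (s * k)%g)) = x (mulop F).
Proof. by move=> Ls bF; rewrite -cnj_mulop// xL. Qed.

(* Kesten's criterion.  A norm below 1 yields a positive function [f] with
   [walk l f <= mu * f] and [mu < 1]; by concavity the logarithmic increments
   [ln f(h k) - ln f(k)] have a walk average at most [mu - 1 < 0], whereas
   their invariant means cancel for [h] and [h^-1]. *)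
Lemma compressed_walk_norm (l : seq (R * G)) (lam : R) :
  (forall a, a \in l -> 0 < a.1 /\ L a.2) -> \sum_(a <- l) a.1 = 1 ->
  0 < lam < 1 -> ~ opnorm (compressed_walk l) <= lam.
Proof.
move=> lP l1 lam01 /(superharmonic_exists lP lam01)[f [f0 f1 fw]].
set mu := (1 + lam) / 2 in fw.
have mu0 : 0 < mu by rewrite /mu; case/andP: lam01; lra.
have mu1 : mu < 1 by rewrite /mu; case/andP: lam01; lra.
have harnack a k : a \in l -> a.1 / 2 * f (a.2^-1 * k)%g <= mu * f k /\
    a.1 / 2 * f (a.2 * k)%g <= mu * f k.
  move=> al; have a2 b : b \in l -> 0 <= b.1 / 2 by move=> /lP[b0 _]; rewrite divr_ge0// ltW.
  have h : a.1 / 2 * (f (a.2^-1 * k)%g + f (a.2 * k)%g) <= mu * f k.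
    apply: le_trans (fw k); rewrite /walk (big_rem a)//= lerDl big_seq sumr_ge0// => b /mem_rem bl.
    by rewrite mulr_ge0 ?addr_ge0// a2.
  have p := mulr_ge0 (a2 _ al) (f0 (a.2^-1 * k)%g); have q := mulr_ge0 (a2 _ al) (f0 (a.2 * k)%g).
  by rewrite mulrDr in h; split; apply: le_trans h; rewrite ?lerDl ?lerDr.
(* [f] may vanish somewhere, so logarithms are taken only on the subgroup preserving its positivity
   set; it contains all steps by the Harnack inequality. *)
pose K : set G := [set s | forall k, 0 < f k <-> 0 < f (s * k)%g].
have K1 : K 1%g by move=> k; rewrite mul1g.
have KM s t : K s -> K t -> K (s * t)%g.
  by move=> Ks Kt k; rewrite -mulgA -Ks.
have KV s : K s -> K s^-1%g by move=> Ks k; rewrite (Ks (s^-1 * k)%g) mulVKg.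
have lK a : a \in l -> K a.2.
  move=> al k; have [a0 _] := lP _ al.
  have pos p q : a.1 / 2 * p <= mu * q -> 0 < p -> 0 < q.
    move=> pq p0; rewrite -(pmulr_rgt0 _ mu0); apply: lt_le_trans pq.
    by rewrite mulr_gt0// divr_gt0.
  split=> h; last by exact: pos (harnack a k al).2 h.
  by apply: pos (harnack a (a.2 * k)%g al).1 _; rewrite mulKg.
have Kf s : K s -> 0 < f s by move=> Ks; have := (Ks 1%g).1 f1; rewrite mulg1.
(* A representative of the coset of [k] modulo [K]; one exists, as [k] itself qualifies. Shifting by
   it makes the logarithm of [f] available on the whole group. *)
pose rep k := xget 1%g [set t | K (k * t^-1)%g].
have Krep k : K (k * (rep k)^-1)%g.
  by rewrite /rep; case: xgetP => [t _ //|/(_ k)]; rewrite /= mulgV => /(_ K1).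
have repM s k : K s -> rep (s * k)%g = rep k.
  move=> Ks; rewrite /rep; congr (xget _ _); apply/seteqP; split=> t /= h.
    by have := KM _ _ (KV _ Ks) h; rewrite -!mulgA mulKg.
  by rewrite -mulgA; exact: KM.
pose g k := ln (f (k * (rep k)^-1)%g).
pose D h k := g (h * k)%g - g k.
have gM h k : K h -> g (h * k)%g = ln (f (h * (k * (rep k)^-1))%g).
  by move=> Kh; rewrite /g repM// mulgA.
have posK h k : K h -> 0 < f (h * (k * (rep k)^-1))%g.
  by move=> Kh; apply/Kf/KM.
have pos1 k : 0 < f (k * (rep k)^-1)%g by exact/Kf.
have D_le h k : K h ->
    D h k <= f (h * (k * (rep k)^-1))%g / f (k * (rep k)^-1)%g - 1.
  move=> Kh; rewrite /D gM// {1}/g -ln_div ?posrE ?posK//.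
  set r := _ / _; have -> : r = 1 + (r - 1) by rewrite addrC subrK.
  rewrite [1 + _ - 1]addrC addKr; apply: le_ln1Dx.
  by rewrite ltrBrDl subrr divr_gt0// posK.
have bD h k (c : R) : K h -> 0 < c -> c * f (h * (k * (rep k)^-1))%g <= f (k * (rep k)^-1)%g ->
    D h k <= - ln c.
  move=> Kh c0 le; rewrite /D gM// {1}/g lerBlDr -lerBlDl opprK -lnM ?posrE ?posK//.
  by rewrite ler_ln ?posrE ?mulr_gt0 ?posK// mulrC.
(* The Harnack inequality bounds increments from above only; the lower bound is the upper bound for
   the inverse step at the shifted point. *)
have bounded_D a : a \in l -> bounded_real (D a.2) /\ bounded_real (D a.2^-1%g).
  move=> al; have Ka := lK _ al; have Ka' := KV _ Ka; have [a0 _] := lP _ al.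
  pose c := a.1 / 2 / mu; have c0 : 0 < c by rewrite divr_gt0// divr_gt0.
  have cP p q : a.1 / 2 * p <= mu * q -> c * p <= q.
    by move=> pq; rewrite /c mulrAC ler_pdivrMr// [leRHS]mulrC.
  have DN h k : D h^-1%g k = - D h (h^-1 * k)%g by rewrite /D mulVKg opprB.
  have le1 k : D a.2 k <= - ln c by apply: (bD) => //; apply/cP; exact: (harnack _ _ al).2.
  have le2 k : D a.2^-1%g k <= - ln c by apply: (bD) => //; apply/cP; exact: (harnack _ _ al).1.
  split; exists (- ln c) => k; rewrite ler_norml ?le1 ?le2 andbT lerNl.
    by have := le2 (a.2 * k)%g; rewrite DN mulKg.
  by rewrite DN opprK.
pose W k := \sum_(a <- l) a.1 / 2 * (D a.2 k + D a.2^-1%g k).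
have W_le k : W k <= mu - 1.
  set t := (k * (rep k)^-1)%g.
  apply: (@le_trans _ _ (walk l f t / f t - 1)); last first.
    by rewrite lerD2r ler_pdivrMr ?pos1// fw.
  rewrite -l1 /walk mulr_suml -sumrB /W big_seq [leRHS]big_seq; apply: ler_sum => a al.
  have Ka := lK _ al; have Ka' := KV _ Ka; have [a0 _] := lP _ al.
  have := lerD (D_le _ k Ka) (D_le _ k Ka'); rewrite -/t.
  move: (D a.2 k) (D a.2^-1%g k) (f t) (f (a.2^-1 * t)%g) (f (a.2 * t)%g) => d d' u v w.
  have -> : a.1 / 2 * (v + w) / u - a.1 = a.1 / 2 * (w / u - 1 + (v / u - 1)).
    by move: (u^-1) => r; field.
  by move=> h; rewrite ler_wpM2l// divr_ge0// ltW.
suff : x (mulop W) = 0 /\ bounded_real W.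
  move=> [x0 bW].
  have := rstate_mulop_le sx bW (bounded_real_cst G (mu - 1)) W_le.
  by rewrite x0 rstate_mulop_cst// subr_ge0 leNgt mu1.
(* Prepares an induction on the list of summands alone, while the facts about members of [l] stay
   available. *)
have : {subset l <= l} by [].
rewrite /W; elim: {1 3 4}l => [|a r IH] rl.
  under eq_fun do rewrite big_nil.
  by split; [rewrite rstate_mulop_cst|exact: bounded_real_cst].
have [r0 bW] := IH (fun b br => rl b (mem_behead (s := a :: r) br)).
have al : a \in l by apply: rl; rewrite mem_head.
have [bD1 bD2] := bounded_D _ al; have [_ La] := lP _ al.
have bD12 : bounded_real (fun k => 1 * D a.2 k + D a.2^-1%g k) by exact: bounded_realP.
under eq_fun do rewrite big_cons -[D a.2 _]mul1r.
split; last exact: bounded_realP.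
(* Shifting the increment of the inverse step by [a.2] gives minus the increment of [a.2], so the
   two means cancel. *)
rewrite rstate_mulopP// r0 addr0 rstate_mulopP// -(mean_shift La bD2) mul1r.
have -> : (fun k => D a.2^-1%g (a.2 * k)%g) = (fun k => (-1) * D a.2 k + 0).
  by apply/funext => k; rewrite /D mulKg mulN1r opprB addr0.
by rewrite rstate_mulopP// ?rstate_mulop_cst ?mulN1r ?addr0 ?subrr ?mulr0//; exact: bounded_real_cst.
Qed.

Let ind_form (y : H) : form (mulop \1_L) y = ell2norm (mulop \1_L y) ^+ 2.
Proof. by rewrite -form_sqr mulop_adj// mulop_indic_proj. Qed.

Let ind_contract (y : H) : ell2norm (mulop \1_L y) <= ell2norm y.
Proof.
have [->|n0] := eqVneq (ell2norm (mulop \1_L y)) 0; first exact: ell2norm_ge0.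
have np : 0 < ell2norm (mulop \1_L y) by rewrite lt_neqAle eq_sym n0 ell2norm_ge0.
by have := Re_dotp_le (mulop \1_L y) y; rewrite -/(form _ y) ind_form expr2 ler_pM2l.
Qed.

(** The compatibility of the constraints imposed on the trivial state. If it failed, a lazy walk
    with these weights would have norm below 1 on l2 of [L]. *)
Let nsup_walk_ge0 (l : seq (R * G)) (b : R) :
  (forall a, a \in l -> 0 < a.1 /\ L a.2) -> 0 <= b ->
  0 <= nsup (\sum_(a <- l) a.1%:C *: (lreg a.2 - 1) + b%:C *: (mulop \1_L - 1) : B).
Proof.
move=> lP b0; rewrite leNgt; apply/negP; set v := _ + _ => v0.
pose s := \sum_(a <- l) a.1.
pose m : B := mulop \1_L.
have m_adj : adj m = m by exact: mulop_adj.
have vE y : form v (m y) = \sum_(a <- l) a.1 * form (lreg a.2) (m y) - s * ell2norm (m y) ^+ 2.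
  rewrite /v formD formZ formD formN form1.
  have -> : form m (m y) = ell2norm (m y) ^+ 2.
    by rewrite ind_form -bopME mulop_indic_proj.
  rewrite subrr mulr0 addr0 /s mulr_suml -sumrB.
  elim: (l) => [|a r IH]; first by rewrite !big_nil /form dotp0l.
  by rewrite !big_cons formD formZ formD formN form1 mulrBr IH.
have v_le y : form v (m y) <= nsup v * ell2norm (m y) ^+ 2 by exact: nsup_ub.
have u_le h z : form (lreg h) z <= ell2norm z ^+ 2 /\ - form (lreg h) z <= ell2norm z ^+ 2.
  split; last rewrite -formN; apply: le_trans (nsup_ub _ _) _; rewrite ler_piMl ?sqr_ge0//;
    apply: le_trans (nsup_le_opnorm _) _; rewrite ?opnormN; apply: opnorm_le_bound => // y;
    by rewrite ell2norm_lreg mul1r.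
have m1 : m (delta 1%g) = delta 1%g.
  apply: ell2_ext => k; rewrite mulopE// indicE -[delta 1%g k]/((k == 1%g)%:R).
  by case: eqP => [->|_]; rewrite ?mulr0// mem_set// mul1r.
have s_gt0 : 0 < s.
  rewrite lt_neqAle; apply/andP; split; last first.
    by rewrite /s big_seq sumr_ge0// => a /lP[/ltW].
  apply/eqP => s0; have := v_le (delta 1%g); rewrite vE m1 -s0 mul0r subr0 ell2norm_delta expr1n mulr1.
  suff -> : l = [::] by rewrite big_nil leNgt v0.
  rewrite /s in s0; case: (l) (lP) s0 => // a r aP /esym/eqP; rewrite big_cons paddr_eq0.
  - by have [a0 _] := aP a (mem_head _ _); rewrite gt_eqF.
  - by have [a0 _] := aP a (mem_head _ _); rewrite ltW.
  - rewrite big_seq sumr_ge0// => c cr; have [c0 _] := aP c (mem_behead (s := a :: r) cr).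
    exact: ltW.
(* Half of the mass stays at the identity, which makes the form of the walk nonnegative, so that
   only its upper bound matters. *)
pose l' := (2^-1, 1%g) :: [seq (a.1 / (2 * s), a.2) | a <- l].
pose d := - nsup v / (2 * s).
have d0 : 0 < d by rewrite divr_gt0 ?oppr_gt0// mulr_gt0.
(* The form is bounded by [1 - d], a number that may be negative; the maximum keeps [lam]
   positive. *)
pose lam := Num.max (1 - d) 2^-1.
have l'P a : a \in l' -> 0 < a.1 /\ L a.2.
  rewrite inE => /orP[/eqP->|/mapP[c /lP[c0 Lc] ->]]; split=> //=.
  by rewrite divr_gt0// mulr_gt0.
have l'1 : \sum_(a <- l') a.1 = 1.
  by rewrite big_cons big_map /= -mulr_suml -/s; field; rewrite gt_eqF.
apply: (compressed_walk_norm l'P l'1 (lam := lam)).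
  by rewrite lt_max invr_gt0 ltr0n orbT gt_max gtrBl d0 invf_lt1// ltr1n.
have sym_form z : form (symmetrized l') z =
    2^-1 * ell2norm z ^+ 2 + (2 * s)^-1 * \sum_(a <- l) a.1 * form (lreg a.2) z.
  rewrite /symmetrized /l' big_cons big_map formD formZ formD /= invg1 lreg1 form1.
  congr (_ + _); first by move: (_ ^+ 2) => p; field.
  elim: (l) => [|a r IH]; first by rewrite !big_nil mulr0 /form dotp0l.
  rewrite !big_cons formD formZ formD IH [RHS]mulrDr; congr (_ + _).
  have -> : form (lreg a.2^-1%g) z = form (lreg a.2) z by rewrite -adj_lreg form_adj.
  by move: (form _ _) => p; field; rewrite gt_eqF.
have form_N y : form (compressed_walk l') y = form (symmetrized l') (m y).
  by rewrite -(form_conj m) m_adj.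
have norm_m y : ell2norm (m y) ^+ 2 <= ell2norm y ^+ 2.
  by rewrite ler_pXn2r ?nnegrE ?ell2norm_ge0//; exact: ind_contract.
have lam0 : 0 <= lam by rewrite le_max invr_ge0 ler0n orbT.
have s2 : 0 < (2 * s)^-1 by rewrite invr_gt0 mulr_gt0.
apply: opnorm_selfadj_le => // [|y|y].
- rewrite /compressed_walk !adjM mulop_adj// mulrA; congr (_ * _ * _).
  rewrite /symmetrized adj_sum; apply: eq_bigr => a _.
  by rewrite adjZr adjD !adj_lreg invgK addrC.
- rewrite form_N sym_form.
  have -> : \sum_(a <- l) a.1 * form (lreg a.2) (m y) = form v (m y) + s * ell2norm (m y) ^+ 2.
    by rewrite vE subrK.
  apply: (@le_trans _ _ ((1 - d) * ell2norm (m y) ^+ 2)).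
    have := v_le y; rewrite -(ler_pM2l s2) /d.
    move: (form v _) (_ ^+ 2) (nsup v) => p q r h.
    have -> : 2^-1 * q + (2 * s)^-1 * (p + s * q) = q + (2 * s)^-1 * p.
      by field; rewrite gt_eqF.
    have -> : (1 - - r / (2 * s)) * q = q + (2 * s)^-1 * (r * q).
      by field; rewrite gt_eqF.
    by rewrite lerD2l.
  apply: (@le_trans _ _ (lam * ell2norm (m y) ^+ 2)).
    by rewrite ler_wpM2r ?sqr_ge0// le_max lexx.
  by rewrite ler_wpM2l.
- apply: (@le_trans _ _ 0); last by rewrite mulr_ge0 ?sqr_ge0.
  rewrite form_N sym_form.
  have : - \sum_(a <- l) a.1 * form (lreg a.2) (m y) <= s * ell2norm (m y) ^+ 2.
    rewrite -sumrN /s mulr_suml big_seq [leRHS]big_seq; apply: ler_sum => a /lP[a0 _].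
    by rewrite -mulrN ler_pM2l//; case: (u_le a.2 (m y)).
  rewrite -(ler_pM2l s2); move: (bigop _ _ _) (_ ^+ 2) => p q.
  have -> : (2 * s)^-1 * (s * q) = 2^-1 * q by field; rewrite gt_eqF.
  by rewrite mulrN; move: (_ * p) (_ * q) => u w; lra.
Qed.

(** The lower bounds are constraints and the upper bounds are norms of contractions. The last
    property says that [chi] lives on [L] inside the group. *)
Lemma trivial_state : exists chi : B -> R,
  [/\ rstate chi, forall s, L s -> chi (lreg s) = 1 & chi (mulop \1_L) = 1].
Proof.
pose Cn (v : B) (c : R) := c = 0 /\ exists (l : seq (R * G)) (b : R),
  [/\ forall a, a \in l -> 0 < a.1 /\ L a.2, 0 <= b &
    v = \sum_(a <- l) a.1%:C *: (lreg a.2 - 1) + b%:C *: (mulop \1_L - 1)].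
have [|v c [-> [l [b [lP b0 ->]]]]|chi [lchi chin chiC]] :=
    @cone_extension _ _ _ Cn (nsup_sublinear R G).
- split.
  + split=> //; exists [::], 0; split=> //.
    by rewrite big_nil rmorph0 scale0r addr0.
  + move=> v w c d [-> [l [b [lP b0 ->]]]] [-> [l' [b' [lP' b0' ->]]]].
    split; first by rewrite addr0.
    exists (l ++ l'), (b + b'); split; last by rewrite big_cat rmorphD scalerDl addrACA.
      by move=> a; rewrite mem_cat => /orP[/lP|/lP'].
    exact: addr_ge0.
  + move=> a v c a0 [-> [l [b [lP b0 ->]]]]; split; first by rewrite mulr0.
    exists [seq (a * e.1, e.2) | e <- l], (a * b); split; last 1 first.
    * rewrite scalerDr scalerA -rmorphM big_map scaler_sumr; congr (_ + _).
      by apply: eq_bigr => e _; rewrite scalerA -rmorphM.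
    * by move=> _ /mapP[e /lP[e0 Le] ->]; split=> //=; rewrite mulr_gt0.
    * by rewrite mulr_ge0// ltW.
- exact: nsup_walk_ge0.
have schi : rstate chi by [].
have ge1 (T : B) : 0 <= chi (T - 1) -> nsup T <= 1 -> chi T = 1.
  rewrite (real_linearB _ _ lchi) rstate1// subr_ge0 => T1 T2.
  by apply/eqP; rewrite eq_le T1 andbT (le_trans (chin T)).
exists chi; split=> // [s Ls|].
  apply: ge1.
    apply: chiC; split=> //; exists [:: (1, s)], 0; split=> //.
      by move=> a; rewrite inE => /eqP->; rewrite ltr01.
    by rewrite big_seq1 rmorph1 scale1r rmorph0 scale0r addr0.
  apply: le_trans (nsup_le_opnorm _) _; apply: opnorm_le_bound => // y.
  by rewrite ell2norm_lreg mul1r.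
apply: ge1.
  apply: chiC; split=> //; exists [::], 1; split=> //.
  by rewrite big_nil rmorph1 scale1r add0r.
apply: le_trans (nsup_le_opnorm _) _; apply: opnorm_le_bound => // y.
by rewrite mul1r ind_contract.
Qed.

End Amenable.

End TrivialState.

(** * Simplicity and the trace as a limit of vector states *)

Section TraceExtension.
Context (R : realType) (G : groupType).
Local Notation C := R[i].
Local Notation H := (ell2 R G).
Local Notation B := (bop R G).
Local Notation lreg := (@lreg R G).
Local Notation tau := (@canonical_trace R G).
Local Notation A := (@reduced_cstar R G [set: G]).
Implicit Types (T Y Z b : B) (k s g : G).

Let TG := @subgroupT G.
Let cA : cstar_subalgebra A. Proof. exact: reduced_cstar_cstar. Qed.
Let A1 : A 1. Proof. exact: reduced_cstar1. Qed.

(** The elements with this property form a closed ideal of [D] that misses 1. Letting [Y] range over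
    all operators makes the left ideal property immediate. *)
Lemma simple_null (D : set B) (f : B -> R) : cstar_subalgebra D -> D 1 ->
  simple_cstar D -> rstate f ->
  forall a, D a -> (forall Y b, D b -> f (Y * a * b) = 0) -> a = 0.
Proof.
move=> cD D1 [_ Dideal] sf; have [[D0 DP DM DA] clD] := cD; have lf := sf.1.
pose J : set B := [set a | D a /\ forall Y b, D b -> f (Y * a * b) = 0].
move=> x Dx xJ; suff /Dideal[J0|JD] : closed_ideal D J.
- by have : J x by []; rewrite J0.
- have [_ /(_ 1 1 D1)] : J 1 by rewrite JD.
  by rewrite !mulr1 rstate1// => /eqP; rewrite oner_eq0.
split.
- by move=> a [].
- by split=> // Y b _; rewrite mulr0 mul0r real_linear0.
- move=> c a a' [Da a0] [Da' a0']; split=> [|Y b Db]; first exact: DP.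
  by rewrite mulrDr mulrDl lf.1 a0'// bopZr -bopZl a0// addr0.
- move=> c a Dc [Da a0]; split; split=> [|Y b Db]; try exact: DM.
    by rewrite mulrA a0.
  by rewrite mulrA -[_ * c * b]mulrA a0//; exact: DM.
apply/bop_closedP => a aJ; split.
  by move/bop_closedP: clD; apply => e /aJ[a' [Da' _] aa']; exists a'.
move=> Y b Db; apply/eqP; rewrite -normr_eq0; apply/eqP.
apply: (@eq0_small _ _ (opnorm Y * opnorm b)) => // e /aJ[a' [_ a'0] /ltW aa'].
have -> : f (Y * a * b) = f (Y * (a - a') * b).
  by rewrite mulrBr mulrBl (real_linearB _ _ lf) a'0// subr0.
apply: le_trans (rstate_norm sf _) _; apply: le_trans (opnormM _ _) _.
rewrite mulrAC ler_wpM2r ?opnorm_ge0//; apply: le_trans (opnormM _ _) _.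
by rewrite ler_wpM2l ?opnorm_ge0.
Qed.

Variables (L : set G) (LG : subgroup L).

(** The [k] whose coset [k L] is fixed by [s]. *)
Definition returns s : set G := [set k | L (k^-1 * s * k)%g].

Definition return_proj s : B := mulop \1_(returns s).

Lemma cnj_return_proj g s : cnj g (return_proj s) = return_proj (g^-1 * s * g)%g.
Proof.
rewrite cnj_mulop; last exact: bounded_indic.
congr mulop; apply/funext => k; rewrite !indicE; congr (_%:R); congr nat_of_bool.
by apply/idP/idP => /set_mem h; apply/mem_set; move: h; rewrite /returns /= invgM !mulgA.
Qed.

Lemma return_proj_comm s : return_proj s * lreg s = lreg s * return_proj s.
Proof. by rewrite -lreg_cnj cnj_return_proj mulVg mul1g. Qed.

Variable chi : B -> R.
Hypotheses (schi : rstate chi) (chi_u : forall s, L s -> chi (lreg s) = 1).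
Hypothesis chi_ind : chi (mulop \1_L) = 1.
Hypothesis simpleA : simple_cstar A.

Let lchi := schi.1.

Let chi_fix Z s : L s -> chi (Z * (lreg s - 1)) = 0.
Proof.
move=> Ls; apply: rstate_null_r => //.
rewrite adjB adj_lreg adj1 mulrBr !mulrBl lregVr !mul1r mulr1.
have E : chi (lreg s^-1%g) = 1 by rewrite -adj_lreg rstate_adj// chi_u.
by rewrite !(real_linearB _ _ lchi) E chi_u// rstate1// subrr.
Qed.

(** For [s] outside [L], no element of [L] returns, and [chi] lives on [L]. *)
Let chi_out Z s : ~ L s -> chi (Z * return_proj s) = 0.
Proof.
move=> nLs; apply: rstate_null_r => //.
rewrite mulop_adj ?mulop_indic_proj; last exact: bounded_indic.
apply/eqP; rewrite eq_le; apply/andP; split; last first.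
  apply: (rstate_mulop_ge0 schi (bounded_indic _ _)) => k.
  by rewrite indicE; case: (_ \in _); rewrite ?lexx ?ler01.
apply: (@le_trans _ _ (chi (mulop (fun k => (-1) * \1_L k + 1)))).
  apply: rstate_mulop_le => //; first exact: bounded_indic.
    by apply: bounded_realP; [exact: bounded_indic|exact: bounded_real_cst].
  move=> k; rewrite !indicE mulN1r; have [kL|] := boolP (k \in L); last first.
    by rewrite oppr0 add0r lern1 leq_b1.
  rewrite addrC subrr; have [/set_mem kE|//] := boolP (_ \in _).
  have Lk := set_mem kL; case: nLs; have [_ LM LV] := LG.
  have := LM _ _ (LM _ _ Lk kE) (LV _ Lk).
  by rewrite !mulgA mulgV mul1g mulgK.
rewrite rstate_mulopP//; [|exact: bounded_indic|exact: bounded_real_cst].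
by rewrite chi_ind rstate_mulop_cst// mulN1r addrC subrr.
Qed.

(** Moving a group unitary from the right to the left conjugates [s]: if the conjugate lies in [L]
    the factor [lreg s - 1] is killed, otherwise the projection is. Density extends this to all [b]
    in [A]. *)
Let chi_return Y s c b : A b -> chi (Y * (c *: (return_proj s * (lreg s - 1))) * b) = 0.
Proof.
move=> Ab; pose T : B := c *: (return_proj s * (lreg s - 1)).
have lregT Z g : chi (Z * T * lreg g) = 0.
  rewrite -mulrA -lreg_cnj cnjZ cnjM cnj_return_proj cnjD cnjN cnj1 cnj_lreg bopZr bopZr -bopZl.
  rewrite !mulrA; have [Ls|nLs] := pselect (L (g^-1 * s * g)%g); first exact: chi_fix.
  have comm s' : return_proj s' * (lreg s' - 1) = (lreg s' - 1) * return_proj s'.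
    by rewrite mulrBr mulrBl mulr1 mul1r return_proj_comm.
  by rewrite -mulrA comm mulrA chi_out.
rewrite -/T -Re_cstate.
suff -> : cstate chi (Y * T * b) = 0 by [].
apply: (@reduced_cstar_vanish R G [set: G] TG (fun b => cstate chi (Y * T * b))
  (2 * opnorm (Y * T)) _ _ _ b Ab).
- by move=> d S U; rewrite mulrDr bopZr cstate_linear.
- move=> S /=; apply: le_trans (cstate_norm_le _ schi) _.
  by rewrite -[leRHS]mulrA ler_wpM2l// opnormM.
- move=> g _; rewrite /cstate lregT -!bopZl.
  by rewrite lregT oppr0.
Qed.

(** The unit vectors coming from [A] in the GNS space of [chi]; [q] is the supremum of their vector
    states. *)
Let qs : set B := [set b | A b /\ chi (adj b * b) = 1].

Let q T : R := sup [set chi (adj b * T * b) | b in qs].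

Let q_dom : qs !=set0.
Proof. by exists 1; split=> //; rewrite mulr1 adj1 rstate1. Qed.

Let q_linear b : qs b -> real_linear (fun T => chi (adj b * T * b)).
Proof.
move=> _; split=> [T S|c T]; first by rewrite mulrDr mulrDl lchi.1.
by rewrite bopZr bopZl lchi.2.
Qed.

Let q_nsup T b : qs b -> chi (adj b * T * b) <= nsup T.
Proof. by move=> [_ b1]; have := rstate_conj_le schi b (lexx (nsup T)); rewrite b1 mulr1. Qed.

Let q_bounded T : has_ubound [set chi (adj b * T * b) | b in qs].
Proof. by exists (nsup T) => _ [b qb <-]; exact: q_nsup. Qed.

Let q_le T (M : R) : (forall b, qs b -> chi (adj b * T * b) <= M) -> q T <= M.
Proof. exact: (@sup_family_le _ _ _ qs (fun b T => chi (adj b * T * b)) q_dom). Qed.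

Let q_ub T b : qs b -> chi (adj b * T * b) <= q T.
Proof. exact: (@sup_family_ub _ _ _ qs (fun b T => chi (adj b * T * b)) q_bounded). Qed.

Let AZ (c : C) T : A T -> A (c *: T). Proof. exact: (starZ cA.1). Qed.

Let q_scaled T b : A b -> chi (adj b * T * b) <= q T * chi (adj b * b).
Proof.
move=> Ab; have [b0|b0] := eqVneq (chi (adj b * b)) 0.
  by rewrite b0 mulr0 (rstate_null_r schi).
have bp : 0 < chi (adj b * b) by rewrite lt_neqAle eq_sym b0 rstate_sqr_ge0.
set t := chi (adj b * b) in b0 bp *.
pose a := (Num.sqrt t)^-1.
have aa : a * a * t = 1 by rewrite /a -invfM -expr2 sqr_sqrtr ?(ltW bp)// mulVf.
have E S : chi (adj (a%:C *: b) * S * (a%:C *: b)) = a * a * chi (adj b * S * b).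
  by rewrite adjZr bopZl bopZr bopZl scalerA -rmorphM lchi.2.
have : chi (adj (a%:C *: b) * T * (a%:C *: b)) <= q T.
  by apply: q_ub; split; [exact: AZ|rewrite -[adj _]mulr1 E mulr1 -/t aa].
by rewrite E -(ler_pM2r bp) mulrAC aa mul1r.
Qed.

Let q_sublinear : sublinear q.
Proof. exact: (sup_family_sublinear q_dom q_linear q_bounded). Qed.

(* The negative part of [q z - Re z] generates an ideal on which [chi] vanishes. *)
Let trace_le_q z : A z -> complex.Re (tau z) <= q z.
Proof.
move=> Az; have [[A0 AP AM AA] _] := cA.
pose y0 : B := (q z)%:C *: (1 : B) - 2^-1%:C *: (z + adj z).
have Ay0 : A y0 by exact: (starB cA.1 (AZ _ A1) (AZ _ (starD cA.1 Az (AA _ Az)))).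
have y0a : adj y0 = y0 by rewrite adjB !adjZr adj1 adjD adjK [adj z + z]addrC.
pose r := (opnorm y0 + 1)^-1.
have n0 : 0 < opnorm y0 + 1 by rewrite ltr_wpDl// opnorm_ge0.
have r0 : 0 < r by rewrite invr_gt0.
have y1 : opnorm (r%:C *: y0) <= 1.
  by rewrite opnormZ normc_real_ge0 ?(ltW r0)// ler_pdivrMl// mulr1 lerDl.
have ya : adj (r%:C *: y0) = r%:C *: y0 by rewrite adjZr y0a.
have [m [n [Am An ma na [yE mny]]]] := negative_part cA A1 (AZ r%:C Ay0) ya y1.
have chi_y b : A b -> 0 <= chi (adj b * (r%:C *: y0) * b).
  move=> Ab; rewrite bopZr bopZl lchi.2 mulr_ge0 ?(ltW r0)//.
  rewrite /y0 mulrBr mulrBl (real_linearB _ _ lchi) !bopZr !bopZl !lchi.2 mulr1.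
  rewrite mulrDr mulrDl lchi.1.
  have -> : chi (adj b * adj z * b) = chi (adj b * z * b).
    by rewrite -rstate_adj// !adjM !adjK mulrA.
  have := q_scaled z Ab; move: (chi _) (q z * _) => u v; lra.
have n2 : n * n = 0.
  apply: (simple_null cA A1 simpleA schi) => [|Y b Ab]; first exact: AM.
  rewrite -mulrA; apply: rstate_null_r => //.
  have := chi_y (m * n * b) (AM _ _ (AM _ _ Am An) Ab).
  have -> : adj (m * n * b) * (r%:C *: y0) * (m * n * b) =
      adj b * (adj (m * n) * (r%:C *: y0) * (m * n)) * b by rewrite (adjM (m * n)) !mulrA.
  rewrite mny mulrN mulNr real_linearN// oppr_ge0 => le0.
  apply/eqP; rewrite eq_le rstate_sqr_ge0// andbT.
  by move: le0; rewrite !adjM na !mulrA.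
have n00 : n = 0.
  apply: bop_ext => v; apply: ell2norm0_eq0; apply/eqP; rewrite -sqrf_eq0 -form_sqr na n2.
  by rewrite /form dotp0l.
(* Without a negative part [y0] is a positive multiple of a square, so its form at [delta 1], which
   is the real part of the trace, is nonnegative. *)
have := form_sqr m (delta 1%g); rewrite ma.
have -> : m * m = r%:C *: y0 by rewrite yE n00 addr0 subr0.
rewrite formZ /y0 formD formN !formZ formD form_adj form1 ell2norm_delta => h.
have : 0 <= r * (q z * 1 ^+ 2 - 2^-1 * (form z (delta 1%g) + form z (delta 1%g))).
  by rewrite h sqr_ge0.
rewrite pmulr_rge0//; rewrite -[complex.Re (tau z)]/(form z (delta 1%g)).
by move: (form _ _) => u; lra.
Qed.

Lemma trace_extension : exists om : B -> R, [/\ rstate om,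
  forall T, A T -> om T = complex.Re (tau T) &
  forall s c, om (c *: (return_proj s * (lreg s - 1))) = 0].
Proof.
have [[A0 AP AM AA] _] := cA.
pose Cn (T : B) (r : R) := A T /\ r = complex.Re (tau T).
have [|T r [AT ->]|om [lom omq omC]] := @cone_extension _ _ _ Cn q_sublinear.
- split; first by split=> //; rewrite -(scale0r (0 : B)) traceZ mul0r.
    move=> T S c d [AT ->] [AS ->]; split; last by rewrite traceD ReD.
    exact: (starD cA.1 AT AS).
  by move=> a T c a0 [AT ->]; split; [exact: AZ|rewrite traceZ ReM].
- exact: trace_le_q.
exists om; split.
- split=> // T; apply: le_trans (omq T) _; apply: q_le => b; exact: q_nsup.
- move=> T AT; have AN : A (- T) by rewrite -scaleN1r; exact: AZ.
  apply/eqP; rewrite eq_le; apply/andP; split; last exact: omC.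
  rewrite -lerN2 -(real_linearN _ lom); apply: omC; split=> //.
  by rewrite traceN ReN.
(* All the vector states vanish at this element and [om] lies below their supremum; [c] and [- c]
   together give equality. *)
have le0 s c : om (c *: (return_proj s * (lreg s - 1))) <= 0.
  by apply: le_trans (omq _) _; apply: q_le => b [Ab _]; rewrite chi_return.
move=> s c; apply/eqP; rewrite eq_le le0/= -lerN2 oppr0 -(real_linearN _ lom).
by rewrite -scaleNr le0.
Qed.

End TraceExtension.

(** * Powers averaging from simplicity *)

Section SimplePowers.
Context (R : realType) (G : groupType).
Local Notation C := R[i].
Local Notation B := (bop R G).
Local Notation lreg := (@lreg R G).
Local Notation tau := (@canonical_trace R G).
Implicit Types (T S Y Z : B) (k s g t : G).

Definition invariant (p : B -> R) := forall s T, p (cnj s T) = p T.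

(** The support function of a minimal closed convex invariant set of states. *)
Lemma minimal_invariant : exists p : B -> R, [/\ sublinear p, invariant p,
  forall T, p T <= nsup T &
  forall r, sublinear r -> invariant r -> (forall T, r T <= p T) -> r = p].
Proof.
apply: (@minimal_sublinear _ _ invariant); [|exact: nsup_sublinear|exact: nsup_cnj].
move=> D _ DP _ s T; rewrite /inf_chain; congr inf; apply/seteqP.
by split=> _ [f Df <-]; have [_ fs _] := DP _ Df; exists f; rewrite // fs.
Qed.

Variables (p x : B -> R).
Hypotheses (sp : sublinear p) (p_inv : invariant p) (p_nsup : forall T, p T <= nsup T).
Hypothesis p_min : forall r, sublinear r -> invariant r -> (forall T, r T <= p T) -> r = p.
Hypotheses (lx : real_linear x) (xp : forall T, x T <= p T) (x_ext : extreme p x).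

Let sx : rstate x. Proof. by split=> // T; apply: le_trans (xp T) _. Qed.

Definition stabilizer : set G := [set s | forall T, x (cnj s T) = x T].

Lemma stabilizer_subgroup : subgroup stabilizer.
Proof.
split=> [T|s t hs ht T|s hs T].
- by rewrite cnj1g.
- by rewrite -cnj_cnj ht hs.
- by rewrite -[in RHS](cnjK s^-1%g T) invgK hs.
Qed.

Definition symbol T k : R := x (cnj k T).

Let bounded_symbol T : bounded_real (symbol T).
Proof.
exists (opnorm T) => k; apply: le_trans (rstate_norm sx _) _.
exact: opnorm_cnj.
Qed.

Definition poisson T : B := mulop (symbol T).

Let poissonP (a : R) T S : poisson (a%:C *: T + S) = a%:C *: poisson T + poisson S.
Proof.
rewrite -mulopP//; congr mulop; apply/funext => k.
by rewrite /symbol cnjD cnjZ lx.1 lx.2.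
Qed.

Let poissonD T S : poisson (T + S) = poisson T + poisson S.
Proof. by have := poissonP 1 T S; rewrite !scale1r. Qed.

Let poisson0 : poisson 0 = 0.
Proof.
rewrite /poisson (_ : symbol 0 = fun=> 0); first by rewrite mulop_cst rmorph0 scale0r.
by apply/funext => k; rewrite /symbol cnj0 real_linear0.
Qed.

Let poissonZ (a : R) T : poisson (a%:C *: T) = a%:C *: poisson T.
Proof. by rewrite -[_ *: T]addr0 poissonP poisson0 addr0. Qed.

Let poisson_adj T : adj (poisson T) = poisson T.
Proof. exact: mulop_adj. Qed.

Let cnj_poisson s T : cnj s (poisson T) = poisson (cnj s T).
Proof.
by rewrite cnj_mulop//; congr mulop; apply/funext => k; rewrite /symbol cnj_cnj.
Qed.

Section Boundary.
Variables (phi : B -> R) (sphi : rstate phi).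

Let orbit_sup T : R := sup [set phi (cnj g T) | g in [set: G]].

Let orbit_dom : [set: G] !=set0. Proof. by exists 1%g. Qed.

Let orbit_bounded T : has_ubound [set phi (cnj g T) | g in [set: G]].
Proof. by exists (nsup T) => _ [g _ <-]; rewrite -(nsup_cnj g T); exact: sphi.2. Qed.

Let orbit_ub g T : phi (cnj g T) <= orbit_sup T.
Proof. exact: (@sup_family_ub _ _ _ [set: G] (fun g T => phi (cnj g T)) orbit_bounded). Qed.

Let orbit_le T (M : R) : (forall g, phi (cnj g T) <= M) -> orbit_sup T <= M.
Proof. by move=> TM; apply: (@sup_family_le _ _ _ _ (fun g T => phi (cnj g T)) orbit_dom) => g _. Qed.

Let orbit_sublinear : sublinear orbit_sup.
Proof.
apply: (@sup_family_sublinear _ _ _ _ (fun g T => phi (cnj g T)) orbit_dom _ orbit_bounded) => g _.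
by split=> [T S|a T]; rewrite ?cnjD ?cnjZ ?sphi.1.1 ?sphi.1.2.
Qed.

(** This functional is sublinear, invariant and below [p], as each symbol is; minimality of [p]
    leaves no other possibility. *)
Let orbit_poisson : (fun T => orbit_sup (poisson T)) = p.
Proof.
apply: p_min.
- split=> [T S|a T a0]; first by rewrite poissonD orbit_sublinear.1.
  by rewrite poissonZ orbit_sublinear.2.
- move=> s T; rewrite -cnj_poisson; apply/eqP; rewrite eq_le; apply/andP; split.
    by apply: orbit_le => g; rewrite cnj_cnj orbit_ub.
  apply: orbit_le => g; have := orbit_ub (s^-1 * g)%g (cnj s (poisson T)).
  by rewrite cnj_cnj mulVKg.
- move=> T; apply: orbit_le => g; rewrite cnj_poisson -(rstate_mulop_cst (p T) sphi).
  apply: rstate_mulop_le => // [|k]; first exact: bounded_real_cst.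
  by apply: le_trans (xp _) _; rewrite !p_inv.
Qed.

(** By [orbit_poisson] the constraint that [psi] restores [x] is compatible with the orbit of [phi].
    The second clause puts [psi] in the closed convex hull of this orbit. *)
Lemma boundary_state : exists psi : B -> R, [/\ rstate psi,
  forall T c, (forall g, phi (cnj g T) <= c) -> psi T <= c &
  forall T, psi (poisson T) = x T].
Proof.
pose Cn v c := exists T, v = poisson T /\ c = x T.
have [|v c [T [-> ->]]|psi [lpsi psip psiC]] := @cone_extension _ _ _ Cn orbit_sublinear.
- split.
  + exists 0; by rewrite real_linear0// poisson0.
  + by move=> _ _ _ _ [T [-> ->]] [S [-> ->]]; exists (T + S); rewrite poissonD lx.1.
  + by move=> a _ _ _ [T [-> ->]]; exists (a%:C *: T); rewrite poissonZ lx.2.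
- by rewrite -[orbit_sup _]/((fun T => orbit_sup (poisson T)) T) orbit_poisson.
exists psi; split.
- split=> // T; apply: le_trans (psip T) _; apply: orbit_le => g.
  by rewrite -(nsup_cnj g T); exact: sphi.2.
- by move=> T c Tc; apply: le_trans (psip T) _; exact: orbit_le.
- have ge T : x T <= psi (poisson T) by apply: psiC; exists T.
  move=> T; apply/eqP; rewrite eq_le ge andbT.
  have := ge (- T); rewrite real_linearN//.
  have -> : poisson (- T) = - poisson T.
    by rewrite -scaleN1r -(rmorphN1 (real_complex R)) poissonZ rmorphN1 scaleN1r.
  by rewrite real_linearN// lerN2.
Qed.

End Boundary.

Section Vanishing.
Variables (psi : B -> R) (spsi : rstate psi) (psi_poisson : forall T, psi (poisson T) = x T).

Let lpsi := spsi.1.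

Let weighted_le F T : (forall k, 0 <= F k <= 1) ->
  psi (mulop F * poisson T) <= psi (mulop F) * p T.
Proof.
move=> F01; have bF := bounded_real01 F01.
rewrite mulopM// mulrC -[leRHS]addr0 -[X in _ + X](rstate_mulop_cst 0 spsi).
rewrite -rstate_mulopP//; last exact: bounded_real_cst.
apply: rstate_mulop_le => // [||k].
- have [M1 FM] := bF; have [M2 TM] := bounded_symbol T.
  by exists (M1 * M2) => k; rewrite normrM ler_pM.
- by apply: bounded_realP => //; exact: bounded_real_cst.
- have /andP[F0 _] := F01 k; rewrite addr0 mulrC ler_wpM2r//.
  by apply: le_trans (xp _) _; rewrite p_inv.
Qed.

(* Since [x] is extreme, weighting [psi] by [F] only rescales [psi \o poisson]. *)
Let weighted01 F T : (forall k, 0 <= F k <= 1) ->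
  psi (mulop F * poisson T) = psi (mulop F) * x T.
Proof.
move=> F01; have bF := bounded_real01 F01.
pose F' k := (-1) * F k + 1.
have F01' k : 0 <= F' k <= 1 by rewrite /F'; have := F01 k; lra.
have F'E : mulop F' = 1 - mulop F :> B.
  rewrite mulopP//; last exact: bounded_real_cst.
  by rewrite mulop_cst scale1r rmorphN1 scaleN1r addrC.
have lin Y : real_linear (fun T => psi (Y * poisson T)).
  split=> [T1 T2|a T1]; first by rewrite poissonD mulrDr lpsi.1.
  by rewrite poissonZ bopZr lpsi.2.
apply: (x_ext (g := fun T => psi (mulop F' * poisson T)) _ (lin _) (lin _)) => // [|S|S|S].
- rewrite rstate_mulop_ge0//=; last by move=> k; case/andP: (F01 k).
  rewrite -(rstate_mulop_cst 1 spsi); apply: rstate_mulop_le => // [|k].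
    exact: bounded_real_cst.
  by case/andP: (F01 k).
- exact: weighted_le.
- by apply: le_trans (weighted_le _ F01') _; rewrite F'E real_linearB// rstate1.
- by rewrite F'E mulrBl mul1r real_linearB// psi_poisson addrC subrK.
Qed.

Let weighted F T : bounded_real F -> psi (mulop F * poisson T) = psi (mulop F) * x T.
Proof.
move=> [M FM]; pose K := `|M| + 1.
have K0 : 0 < K by rewrite ltr_wpDl.
have FK k : - K <= F k <= K.
  by rewrite -ler_norml (le_trans (FM k))// (le_trans (ler_norm M))// /K lerDl.
pose F' k := (F k + K) / (2 * K).
have F01 k : 0 <= F' k <= 1.
  have /andP[h1 h2] := FK k; rewrite /F' divr_ge0 ?mulr_ge0 ?(ltW K0)//=; last by lra.
  by rewrite ler_pdivrMr ?mulr_gt0// mul1r; lra.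
have FE : F = fun k => (2 * K) * F' k + - K.
  by apply/funext => k; rewrite /F'; field; rewrite gt_eqF.
have bF' := bounded_real01 F01.
rewrite FE mulopP ?bounded_real_cst//; last exact: bounded_real_cst.
rewrite mulop_cst mulrDl !bopZl mul1r !lpsi.1 !lpsi.2 weighted01// psi_poisson rstate1//.
by rewrite mulr1 [RHS]mulrDl -[X in _ = X + _]mulrA.
Qed.

(** The variance of [poisson T] under [psi] is zero, so Poisson operators can be pulled out of [psi]
    on either side. *)
Let poisson_null T :
  psi (adj (poisson T - (x T)%:C *: (1 : B)) * (poisson T - (x T)%:C *: (1 : B))) = 0.
Proof.
rewrite adjB poisson_adj adjZr adj1 mulrBl !mulrBr !bopZl !bopZr mulr1 mul1r mulr1.
rewrite !(real_linearB _ _ lpsi) !lpsi.2 weighted// psi_poisson rstate1//.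
by rewrite mulr1 !subrr.
Qed.

Let poisson_mull T Y : psi (poisson T * Y) = x T * psi Y.
Proof.
have := rstate_null_l spsi Y (poisson_null T).
rewrite adjB poisson_adj adjZr adj1 mulrBl bopZl mul1r (real_linearB _ _ lpsi) lpsi.2.
by move/eqP; rewrite subr_eq0 => /eqP.
Qed.

Let poisson_mulr T Y : psi (Y * poisson T) = x T * psi Y.
Proof.
have := rstate_null_r spsi Y (poisson_null T).
rewrite mulrBr bopZr mulr1 (real_linearB _ _ lpsi) lpsi.2.
by move/eqP; rewrite subr_eq0 => /eqP.
Qed.

Let off_stabilizer s (a : R) : ~ stabilizer s ->
  (forall T, x T * a = x (cnj s T) * a) -> a = 0.
Proof.
move=> ns H; apply: contrapT => /eqP a0; apply: ns => T.
by apply: (mulIf a0); rewrite -H.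
Qed.

(** Moving [poisson T] across [lreg s] replaces [T] by [cnj s T]; off the stabilizer [x] separates
    the two for some [T]. *)
Lemma vanish_lreg s c : ~ stabilizer s -> psi (c *: lreg s) = 0.
Proof.
move=> ns; apply: off_stabilizer ns _ => T.
rewrite -poisson_mull -poisson_mulr -cnj_poisson; congr psi.
by rewrite bopZl bopZr lreg_cnj.
Qed.

(** On the returning elements the symbols of [T] and of [cnj s T] coincide, so the projection cannot
    tell the two apart, whereas [x] can. *)
Lemma vanish_return s : ~ stabilizer s -> psi (return_proj R stabilizer s) = 0.
Proof.
move=> ns; apply: off_stabilizer (ns) _ => T.
rewrite -!poisson_mulr; congr psi; rewrite !mulopM//; try exact: bounded_indic.
congr mulop; apply/funext => k; rewrite indicE; have [/set_mem kE|_] := boolP (_ \in _); last by rewrite !mul0r.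
by rewrite !mul1r /symbol -[in LHS](kE (cnj k T)) !cnj_cnj !mulgA mulgV mul1g.
Qed.

End Vanishing.

Hypothesis simpleA : simple_cstar (@reduced_cstar R G [set: G]).

Let SG := stabilizer_subgroup.

(* If [s] is conjugate to [f] in the stabilizer and the other elements are
   already moved off it, then [psi] lives on the range of [return_proj f], where
   [lreg f] acts as 1 for the extension [om] of the trace; but [tau (lreg f) = 0]. *)
Lemma avoid_stabilizer (ss : seq G) : (forall s, s \in ss -> s <> 1%g) ->
  exists g, forall s, s \in ss -> ~ stabilizer (g^-1 * s * g)%g.
Proof.
elim: ss => [|s ss IH] ss1; first by exists 1%g.
have [|g gss] := IH; first by move=> t tss; apply: ss1; rewrite inE tss orbT.
have [Sf|nSf] := pselect (stabilizer (g^-1 * s * g)%g); last first.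
  by exists g => t; rewrite inE => /orP[/eqP->|/gss].
apply: contrapT => nog.
(* If no [g] works, every point of the orbit of [x] is fixed by one of the given elements. *)
have cover k : exists2 t, t \in s :: ss & stabilizer ((g * k)^-1 * t * (g * k))%g.
  apply: contrapT => h; apply: nog; exists (g * k)%g => t tss St.
  by apply: h; exists t.
have [chi [schi chi_u chi_ind]] := trivial_state SG sx (fun s T Ls => Ls T).
have [om [som omA om_return]] := trace_extension SG schi chi_u chi_ind simpleA.
have [psi [spsi psi_le psi_x]] := boundary_state som.
have lpsi := spsi.1; set f := (g^-1 * s * g)%g in Sf.
pose P := return_proj R stabilizer f.
have bE (t : G) : bounded_real (\1_(returns stabilizer t) : G -> R) by exact: bounded_indic.
(* By [cover] the return sets of the conjugates by [g] exhaust the group, and those coming from [ss]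
   have mass zero under [psi]. *)
have P_ge1 : 1 <= psi P.
  pose W (us : seq G) k : R := \sum_(t <- us) \1_(returns stabilizer (g^-1 * t * g)%g) k.
  have [bW W0] : bounded_real (W ss) /\ psi (mulop (W ss)) = 0.
    rewrite /W; elim: (ss) (gss) => [|t r IHr] rP.
      under eq_fun do rewrite big_nil.
      by split; [exact: bounded_real_cst|rewrite rstate_mulop_cst].
    under eq_fun do rewrite big_cons -[\1_ _ _]mul1r.
    have [|bW W0] := IHr; first by move=> u ur; apply: rP; rewrite inE ur orbT.
    split; first exact: bounded_realP.
    rewrite rstate_mulopP// W0 addr0 mul1r.
    by apply: (vanish_return spsi psi_x); apply: rP; rewrite mem_head.
  rewrite -[leRHS]mul1r -[leRHS]addr0 -W0 -rstate_mulopP// -[leLHS](rstate_mulop_cst 1 spsi).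
  apply: rstate_mulop_le => // [||k]; [exact: bounded_real_cst|exact: bounded_realP|].
  have W_ge0 (us : seq G) : 0 <= W us k by apply: sumr_ge0 => t _; rewrite indicE ler0n.
  have [t tss] := cover k; rewrite invgM !mulgA => St; rewrite mul1r.
  move: tss; rewrite inE => /orP[/eqP ts|tss].
    by rewrite indicE mem_set ?lerDl// /returns /= /f -ts !mulgA.
  apply: (@le_trans _ _ (W ss k)); last by rewrite lerDr indicE ler0n.
  rewrite /W (big_rem t)//= indicE mem_set ?lerDl; first by apply: sumr_ge0 => u _; rewrite indicE ler0n.
  by rewrite /returns /= !mulgA.
have Padj : adj P = P by apply: mulop_adj; exact: bE.
have PP : P * P = P by exact: mulop_indic_proj.
have nP Y : psi ((1 - P) * Y) = 0.
  rewrite -[1 - P]adjK; apply: rstate_null_l => //.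
  rewrite adjK adjB adj1 Padj mulrBr mulr1 mulrBl mul1r PP subrr subr0.
  apply/eqP; rewrite eq_le (real_linearB _ _ lpsi) rstate1// subr_le0 P_ge1 subr_ge0.
  rewrite -[leRHS](rstate_mulop_cst 1 spsi); apply: (rstate_mulop_le spsi) => [||k].
  - exact: bE.
  - exact: bounded_real_cst.
  by rewrite indicE lern1 leq_b1.
(* Conjugates of [P * (lreg f - 1)] are of the same kind for another group element, so [om] vanishes
   on its whole orbit and [psi] inherits this. *)
have fix_P : psi (P * lreg f) = psi P.
  have le0 (c : R) : psi (c%:C *: (P * (lreg f - 1))) <= 0.
    apply: psi_le => h; rewrite cnjZ cnjM cnj_return_proj cnjD cnjN cnj1 cnj_lreg.
    by rewrite om_return.
  have := le0 1; have := le0 (-1); rewrite !lpsi.2 mul1r mulN1r oppr_le0 => h1 h2.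
  have : psi (P * (lreg f - 1)) = 0 by apply/eqP; rewrite eq_le h1 h2.
  by rewrite mulrBr mulr1 (real_linearB _ _ lpsi) => /eqP; rewrite subr_eq0 => /eqP.
have u_le0 : psi (lreg f) <= 0.
  apply: psi_le => h; rewrite cnj_lreg omA; last exact: reduced_cstar_lreg.
  rewrite trace_lreg; case: eqP => // h1; exfalso; apply: (ss1 s (mem_head _ _)).
  move/(congr1 (fun u => (g * h) * u * (g * h)^-1)%g): h1.
  by rewrite /f invgM mulg1 !mulgA !mulgK mulgV mul1g.
have := nP (lreg f); rewrite mulrBl mul1r (real_linearB _ _ lpsi) fix_P.
by move: u_le0 P_ge1; lra.
Qed.

(** A state at least [e] on all conjugates of [y] would pass this bound to [psi], which vanishes at
    a conjugate of [y] whose support avoids the stabilizer. *)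
Lemma powers_averaging_of_extreme : powers_averaging R [set: G].
Proof.
apply: (powers_averaging_of_states (@subgroupT G)) => y phi e [l [l1 yE]] sphi e0 phi_ge.
have [psi [spsi psi_le psi_x]] := boundary_state sphi; have lpsi := spsi.1.
have [|g gP] := @avoid_stabilizer [seq a.2 | a <- l].
  by move=> _ /mapP[a al ->]; exact: l1.
suff psi0 : psi (cnj g y) = 0.
  have : psi (- cnj g y) <= - e.
    apply: psi_le => h; rewrite cnjN cnj_cnj real_linearN; last exact: sphi.1.
    by rewrite lerN2 phi_ge.
  by rewrite real_linearN// psi0; lra.
rewrite yE cnj_sum real_linear_sum// big_seq big1// => a al.
rewrite cnjZ cnj_lreg; apply: (vanish_lreg spsi psi_x).
by apply: gP; apply/mapP; exists a.
Qed.

End SimplePowers.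

Lemma powers_averaging_of_simple (R : realType) (G : groupType) :
  cstar_simple R G -> powers_averaging R [set: G].
Proof.
move=> simpleA; have [p [sp p_inv p_nsup p_min]] := minimal_invariant R G.
have [x [lx xp x_ext]] := extreme_exists sp.
exact: (@powers_averaging_of_extreme R G p x).
Qed.

(** * Comparison of the l2 spaces of a group and of a larger one *)

Section Transfer.
Context (R : realType) (K G : groupType) (i : K -> G).
Hypotheses (i_inj : injective i) (iM : forall h k, i (h * k)%g = (i h * i k)%g).
Local Notation C := R[i].

Let i1 : i 1%g = 1%g.
Proof. by apply: (mulgI (i 1%g)); rewrite -iM !mulg1. Qed.

Let iV h : i h^-1%g = (i h)^-1%g.
Proof. by apply: (mulgI (i h)); rewrite -iM !mulgV. Qed.

Let rep (k : G) : G := xget 1%g [set r | exists h, k = (i h * r)%g].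

Let repP k : exists h, k = (i h * rep k)%g.
Proof.
rewrite /rep; case: xgetP => [r _ //|/(_ k) n]; exfalso; apply: n.
by exists 1%g; rewrite i1 mul1g.
Qed.

Let repM h k : rep (i h * k)%g = rep k.
Proof.
rewrite /rep; congr xget; apply/seteqP; split=> r [h' E].
  by exists (h^-1 * h')%g; rewrite iM iV -mulgA -E mulKg.
by exists (h * h')%g; rewrite iM -mulgA -E.
Qed.

Let coset_bij : set_bij (range rep `*`` fun=> [set: K]) [set: G]
  (fun p : G * K => (i p.2 * p.1)%g).
Proof.
have rr r : range rep r -> rep r = r.
  by move=> [k _ <-]; have [h E] := repP k; rewrite {2}E repM.
split=> //.
  move=> [r h] [r' h'] /set_mem[/= Rr _] /set_mem[/= Rr' _] E.
  have rE : r = r' by rewrite -(rr _ Rr) -(rr _ Rr') -(repM h) E repM.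
  by move: E; rewrite rE => /mulIg/i_inj ->.
move=> k _; have [h E] := repP k; exists (rep k, h) => //=.
by split=> //; exists k.
Qed.

Let fiber_fun (x : ell2 R G) r : K -> C := fun h => x (i h * r)%g.

Let sqnorm_cosets (x : ell2 R G) :
  sqnorm x = (\esum_(r in range rep) sqnorm (fiber_fun x r))%E.
Proof.
rewrite /sqnorm esum_esum => [|r h _ _]; last by rewrite lee_fin sqr_ge0.
by rewrite (reindex_esum _ _ _ _ coset_bij).
Qed.

Let fiber_summable x r : square_summable (fiber_fun x r).
Proof.
have h_inj : set_inj [set: K] (fun h => (i h * r)%g).
  by move=> h h' _ _ /mulIg/i_inj.
rewrite /square_summable; apply: (@le_lt_trans _ _ (sqnorm x)); last by case: x.
rewrite /sqnorm.
rewrite -[leLHS](esum_image [set: K] (fun h => (i h * r)%g) (fun k => ((normc (x k)) ^+ 2)%:E) h_inj).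
rewrite esum_mkcond; apply: le_esum => k _.
by case: ifP => // _; rewrite lee_fin sqr_ge0.
Qed.

(** The subgroup is a group type with an l2 space of its own. The larger l2 space splits over right
    cosets, and on each fiber the operator acts as it does on the small space. *)
Lemma opnorm_transfer (l : seq (C * K)) :
  opnorm (\sum_(a <- l) a.1 *: lreg R (i a.2)) <= opnorm (\sum_(a <- l) a.1 *: lreg R a.2).
Proof.
set S := \sum_(a <- l) _; set T := \sum_(a <- l) _.
pose fiber x r := Ell2 (fiber_summable x r).
have fiberE x r h : fiber_fun (S x) r h = T (fiber x r) h.
  rewrite /fiber_fun /S /T !bop_sumE !ell2_sumE; apply: eq_bigr => a _.
  rewrite -[LHS]/(a.1 * lreg R (i a.2) x _) -[RHS]/(a.1 * lreg R a.2 (fiber x r) _).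
  by rewrite !lregE /= /fiber_fun iM iV mulgA.
apply: opnorm_le_bound; first exact: opnorm_ge0.
move=> x; rewrite -(@ler_pXn2r _ 2)// ?nnegrE ?mulr_ge0 ?opnorm_ge0 ?ell2norm_ge0//.
rewrite exprMn -lee_fin (EFinM (opnorm T ^+ 2)) !ell2norm_sqr sqnorm_cosets.
apply: (@le_trans _ _ (\esum_(r in range rep) ((opnorm T ^+ 2)%:E * sqnorm (fiber x r)))%E).
  apply: le_esum => r _.
  have -> : sqnorm (fiber_fun (S x) r) = sqnorm (T (fiber x r)).
    by apply: eq_esum => h _; rewrite fiberE.
  rewrite -!ell2norm_sqr -EFinM lee_fin -exprMn.
  by rewrite ler_pXn2r ?nnegrE ?mulr_ge0 ?opnorm_ge0 ?ell2norm_ge0// opnorm_bound.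
rewrite esum_mkcond (sqnorm_cosets x) [X in (_ <= _ * X)%E]esum_mkcond.
apply: le_trans (esumZ_le (sqr_ge0 _) _); last first.
  by move=> r; case: ifP => // _; exact: sqnorm_ge0.
by apply: le_esum => r _; case: ifP => // _; rewrite mule0.
Qed.

Lemma powers_transfer (e : R) (ss : seq K) : powers_averaging R [set: K] ->
  0 < e -> (forall s, s \in ss -> s <> 1%g) ->
  exists ts : seq K, ts != [::] /\
    forall s, s \in ss -> opnorm (avg (map i ts) (lreg R (i s))) < e.
Proof.
move=> powers e0 ss1.
have [ts [ts0 _ tsP]] := powers_list powers ss1 e0.
exists ts; split=> // s /tsP; apply: le_lt_trans.
have lregs (k : K) : (i k)^-1%g = i k^-1%g by rewrite iV.
rewrite /avg size_map big_map !opnormZ ler_wpM2l ?normc_ge0//.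
have := opnorm_transfer [seq (1, (t^-1 * s * t)%g) | t <- ts]; rewrite !big_map /=.
have -> : \sum_(t <- ts) 1 *: lreg R (i (t^-1 * s * t)%g) = \sum_(t <- ts) cnj (i t) (lreg R (i s)).
  by apply: eq_bigr => t _; rewrite scale1r cnj_lreg !iM iV.
have -> // : \sum_(t <- ts) 1 *: lreg R (t^-1 * s * t)%g = \sum_(t <- ts) cnj t (lreg R s).
by apply: eq_bigr => t _; rewrite scale1r cnj_lreg.
Qed.

End Transfer.

(** * Relative conjugacy classes and relative commutants *)

Section FiniteIndex.
Context (R : realType) (G : groupType).
Local Notation C := R[i].
Local Notation B := (bop R G).
Local Notation lreg := (@lreg R G).
Variables (L : set G) (LG : subgroup L).
Local Notation A := (@reduced_cstar R G [set: G]).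
Implicit Types (T S Y Z : B) (s t g h : G).

Let TG := @subgroupT G.
Let L1 : L 1%g. Proof. by case: LG. Qed.
Let LM s t : L s -> L t -> L (s * t)%g. Proof. by case: LG => _ + _; apply. Qed.
Let LV s : L s -> L s^-1%g. Proof. by case: LG => _ _; apply. Qed.

Definition cj g s : G := (g^-1 * s * g)%g.

Lemma cj_cj g h s : cj h (cj g s) = cj (g * h)%g s.
Proof. by rewrite /cj invgM !mulgA. Qed.

Lemma cj1 s : cj 1%g s = s.
Proof. by rewrite /cj invg1 mul1g mulg1. Qed.

Definition rel_class s : set G := [set cj g s | g in L].

(* Translating by the finitely many elements which move the points of [E] off
   [E] reduces the avoidance of [E] by [s :: F] to the avoidance by [F]. *)
Lemma avoid_finite (F : seq G) : (forall s, s \in F -> infinite_set (rel_class s)) ->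
  forall E : seq G, exists2 g, L g & forall s, s \in F -> cj g s \notin E.
Proof.
elim: F => [|s F IH] Finf E; first by exists 1%g.
(* [X e] moves [e] off [E]; it corrects [g] in case [g] happens to send [s] into [E]. *)
have /choice[X XP] : forall e, exists x, L x /\ (infinite_set (rel_class e) -> cj x e \notin E).
  move=> e; have [einf|fin] := pselect (infinite_set (rel_class e)); last by exists 1%g.
  have [x Lx xE] : exists2 x, L x & cj x e \notin E.
    apply: contrapT => H; apply: einf; apply: (@sub_finite_set _ _ [set` E]); last exact: finite_seq.
    move=> _ [x Lx <-]; apply: contrapT => xE; apply: H; exists x => //.
    by apply/negP.
  by exists x.
pose xs := 1%g :: map X E.
have [|g Lg gP] := IH _ [seq cj x^-1%g e | x <- xs, e <- E].
  by move=> t tF; apply: Finf; rewrite inE tF orbT.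
have xsP x t : x \in xs -> t \in F -> cj (g * x)%g t \notin E.
  move=> xxs tF; apply: contra (gP _ tF) => tE.
  apply/allpairsP; exists (x, cj (g * x)%g t); split=> //=.
  by rewrite cj_cj mulgK.
have [gE|gE] := boolP (cj g s \in E); last first.
  exists g => // t; rewrite inE => /orP[/eqP->//|tF].
  by have := xsP 1%g t; rewrite inE eqxx mulg1; apply.
have [LX XE] := XP (cj g s).
exists (g * X (cj g s))%g; first exact: LM.
move=> t; rewrite inE => /orP[/eqP->|tF].
  rewrite -cj_cj; apply: XE => fin; apply: (Finf s (mem_head _ _)).
  apply: sub_finite_set fin => _ [h Lh <-].
  exists (g^-1 * h)%g; first by apply: LM => //; exact: LV.
  by rewrite cj_cj mulVKg.
by apply: xsP => //; rewrite inE map_f ?orbT.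
Qed.

Lemma separated_conjugates (F : seq G) (m : nat) :
  (forall s, s \in F -> infinite_set (rel_class s)) ->
  exists gs : seq G, [/\ size gs = m, forall g, g \in gs -> L g &
    forall s, s \in F -> uniq [seq cj g s | g <- gs]].
Proof.
move=> Finf; elim: m => [|m [gs [gsm gsL gsP]]]; first by exists [::].
have [g Lg gP] := avoid_finite Finf [seq cj h s | h <- gs, s <- F].
exists (g :: gs); split=> /= [|h|s sF]; first by rewrite gsm.
  by rewrite inE => /orP[/eqP->|/gsL].
rewrite gsP// andbT; apply: contra (gP _ sF) => /mapP[h hgs ->].
by apply/allpairsP; exists (h, s).
Qed.

Lemma sqr_const_sub (a : R) T :
  (a%:C *: (1 : B) - T) * (a%:C *: (1 : B) - T) =
  (a ^+ 2)%:C *: (1 : B) - (2 * a)%:C *: T + T * T.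
Proof.
rewrite mulrBl (mulrBr T) (bopZl _ 1) mul1r scalerBr scalerA -rmorphM -expr2.
rewrite (bopZr _ T) mulr1 opprB -addrA -[RHS]addrA; congr (_ + _).
rewrite [- _ + (_ + _)]addrCA [RHS]addrC; congr (_ + _).
by rewrite -opprD -scalerDl -rmorphD -mulr2n mulr_natl.
Qed.

Section InfiniteClasses.
Hypothesis irr : cstar_irreducible (@reduced_cstar R G L) A.

Let cA : cstar_subalgebra A. Proof. exact: reduced_cstar_cstar. Qed.
Let A1 : A 1. Proof. exact: reduced_cstar1. Qed.

(* A selfadjoint element commuting with [L] is central in the simple algebra of
   the elements of [A] which commute with it. *)
Lemma relative_commutant_scalar (z : B) : A z -> adj z = z ->
  (forall s, L s -> lreg s * z = z * lreg s) -> exists c : R, z = c%:C *: (1 : B).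
Proof.
move=> Az za zL; have [[A0 AP AM AA] clA] := cA.
pose D : set B := [set T | A T /\ T * z = z * T].
have cD : cstar_subalgebra D.
  split; first split.
  - by split=> //; rewrite mul0r mulr0.
  - move=> c T S [AT Tz] [AS Sz]; split; first exact: AP.
    by rewrite mulrDl mulrDr Sz bopZl bopZr Tz.
  - by move=> T S [AT Tz] [AS Sz]; split; [exact: AM|rewrite -mulrA Sz !mulrA Tz].
  - move=> T [AT Tz]; split; first exact: AA.
    by have := congr1 (@adj R G) Tz; rewrite !adjM za.
  apply/bop_closedP => T TD; split.
    by move/bop_closedP: clA; apply => e /TD[S [AS _] TS]; exists S.
  apply/eqP; rewrite -subr_eq0; apply/eqP/opnorm0_eq0.
  apply: (@eq0_small _ _ (2 * opnorm z)); first exact: opnorm_ge0.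
  move=> e /TD[S [_ Sz] /ltW TS].
  have -> : T * z - z * T = (T - S) * z - z * (T - S).
    by rewrite mulrBl mulrBr Sz opprB addrA subrK.
  apply: le_trans (opnormD _ _) _; rewrite opnormN.
  apply: le_trans (lerD (opnormM _ _) (opnormM _ _)) _.
  have := ler_wpM2l (opnorm_ge0 z) TS; rewrite [_ * opnorm z]mulrC.
  by move: (opnorm z * opnorm _) => u; lra.
have D1 : D 1 by split=> //; rewrite mul1r mulr1.
have Dz : D z by [].
have LD : reduced_cstar L `<=` D.
  move=> T LT; apply: LT; split=> // _ [s Ls <-]; split; last exact: zL.
  exact: reduced_cstar_lreg.
have simpleD := irr cD LD (fun T => @proj1 _ _).
(* The shift makes the form nonnegative, so that the norm of [w] equals [nsup w]. *)
pose w := z + (opnorm z)%:C *: (1 : B).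
have wE x : form w x = form z x + opnorm z * ell2norm x ^+ 2.
  by rewrite /w formD formZ form1.
have wa : adj w = w by rewrite adjD adjZr adj1 za.
have w0 x : 0 <= form w x.
  rewrite wE -lerBlDr sub0r lerNl -formN; apply: le_trans (form_le_opnorm _ _) _.
  by rewrite opnormN.
set M := nsup w.
have M0 : 0 <= M by apply: le_trans (nsup_unit w (ell2norm_delta R (1%g : G))); exact: w0.
(* A state attaining the top of [w]: then [y] is a null vector of [f], and since [y] is central, [f]
   vanishes on the ideal it generates. *)
have [f [lf fn fC]] := cone_extension (nsup_sublinear R G) (ray_cone (@nsup R G) w)
  (fun v c => @ray_le _ _ (@nsup R G) w v c (nsup_sublinear R G)).
have sf : rstate f by [].
have fw : f w = M by apply/eqP; rewrite eq_le fn fC//; exact: ray1.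
have w_norm : opnorm w <= M.
  apply: opnorm_selfadj_le => // x; first exact: nsup_ub.
  by apply: (@le_trans _ _ 0); [rewrite oppr_le0|rewrite mulr_ge0 ?sqr_ge0].
pose y := M%:C *: (1 : B) - w.
have ya : adj y = y by rewrite adjB adjZr adj1 wa.
have fy : f (adj y * y) = 0.
  apply/eqP; rewrite eq_le rstate_sqr_ge0// andbT ya.
  have -> : y * y = (M ^+ 2)%:C *: (1 : B) - (2 * M)%:C *: w + w * w by exact: sqr_const_sub.
  rewrite lf.1 (real_linearB _ _ lf) !lf.2 rstate1// fw.
  have : f (w * w) <= M ^+ 2.
    apply: le_trans (rstate_le_opnorm sf _) _; apply: le_trans (opnormM _ _) _.
    by rewrite expr2 ler_pM ?opnorm_ge0.
  by move: (f _) => u; rewrite expr2; lra.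
have wE' : w = z - (- opnorm z)%:C *: (1 : B) by rewrite /w rmorphN scaleNr opprK.
have Dy : D y by apply: (starB cD.1); [exact: (starZ cD.1 _ D1)|rewrite wE'; exact: (starB cD.1 Dz (starZ cD.1 _ D1))].
have yz T : D T -> T * y = y * T.
  move=> [_ Tz]; rewrite /y /w mulrBr mulrBl mulrDr mulrDl Tz.
  by rewrite !bopZr !bopZl !mulr1 !mul1r.
have y0 : y = 0.
  apply: (simple_null cD D1 simpleD sf Dy) => Y b Db.
  by rewrite -mulrA -yz// mulrA; exact: rstate_null_r.
exists (M - opnorm z); move/eqP: y0; rewrite /y subr_eq0 => /eqP E.
by rewrite rmorphB scalerBl E /w addrK.
Qed.

Lemma infinite_classes t : t <> 1%g -> infinite_set (rel_class t).
Proof.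
move=> t1 /finite_fsetP[X XE].
pose h : B := \sum_(c <- X) lreg c.
have A_lreg s : A (lreg s) by exact: reduced_cstar_lreg.
have Ah : A h by exact: (star_sum cA.1).
have hL s : L s -> lreg s * h = h * lreg s.
  move=> Ls; rewrite -lreg_cnj /h cnj_sum; congr (_ * _).
  have -> : \sum_(c <- X) cnj s (lreg c) = \sum_(c <- map (cj s) X) lreg c.
    by rewrite big_map; apply: eq_bigr => c _; rewrite cnj_lreg.
  have inj_cj g : injective (cj g).
    by move=> a b ab; rewrite -(cj1 a) -(cj1 b) -(mulgV g) -!cj_cj ab.
  apply: perm_big; apply: uniq_perm; rewrite ?map_inj_uniq ?fset_uniq//.
  have memX c : c \in X <-> rel_class t c by rewrite XE.
  move=> c; apply/idP/mapP => [/memX[k Lk kc]|[d /memX[k Lk <-] ->]].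
    exists (cj s^-1%g c); last by rewrite cj_cj mulVg cj1.
    by apply/memX; exists (k * s^-1)%g; [apply: LM => //; exact: LV|rewrite -cj_cj kc].
  by apply/memX; exists (k * s)%g; [exact: LM|rewrite cj_cj].
have haL s : L s -> lreg s * adj h = adj h * lreg s.
  move=> Ls; have := congr1 (@adj R G) (hL s^-1%g (LV Ls)).
  by rewrite !adjM !adj_lreg invgK.
(* The adjoint is added for selfadjointness. It cannot cancel the coefficient at [t], as all
   coefficients are nonnegative. *)
have [||s Ls|c hc] := @relative_commutant_scalar (h + adj h).
- exact: (starD cA.1 Ah (star_adj cA.1 Ah)).
- by rewrite adjD adjK addrC.
- by rewrite mulrDr mulrDl hL// haL.
have : complex.Re ((h + adj h) (delta 1%g) t) = 0.
  rewrite hc -[_ t]/(c%:C * delta 1%g t) -[delta 1%g t]/((t == 1%g)%:R).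
  by case: eqP => // _; rewrite mulr0.
have lregt s : lreg s (delta 1%g) t = (t == s)%:R by rewrite lreg_delta mulg1.
rewrite -[(h + adj h) _ _]/(h (delta 1%g) t + adj h (delta 1%g) t) ReD.
have ge0 (r : seq G) (F : G -> G) : 0 <= complex.Re ((\sum_(d <- r) lreg (F d)) (delta 1%g) t).
  rewrite bop_sumE ell2_sumE; elim: r => [|d r IH]; first by rewrite big_nil.
  by rewrite big_cons ReD addr_ge0// lregt; case: eqP.
have h2 : 0 <= complex.Re (adj h (delta 1%g) t).
  rewrite /h adj_sum; have := ge0 X (fun d => d^-1)%g.
  by under eq_bigr do rewrite -adj_lreg.
have tX : t \in X.
  have : rel_class t t by exists 1%g => //; rewrite cj1.
  by rewrite XE.
have h1 : 1 <= complex.Re (h (delta 1%g) t).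
  have -> : h = lreg t + \sum_(d <- rem t X) lreg d by rewrite /h (big_rem t).
  rewrite -[(lreg t + _) _ _]/(lreg t (delta 1%g) t + (\sum_(d <- rem t X) lreg d) (delta 1%g) t).
  by rewrite ReD lregt eqxx /= lerDl (ge0 _ id).
by move: h1 h2; lra.
Qed.

End InfiniteClasses.

End FiniteIndex.

(** * Powers averaging for subgroups of finite index *)

Section FiniteIndexPowers.
Context (R : realType) (G : groupType).
Local Notation C := R[i].
Local Notation B := (bop R G).
Local Notation lreg := (@lreg R G).
Variables (L : set G) (LG : subgroup L).

Lemma sqr_sum_le (J : Type) (s : seq J) (F : J -> R) :
  (\sum_(j <- s) F j) ^+ 2 <= (size s)%:R * \sum_(j <- s) F j ^+ 2.
Proof.
elim: s => [|a s IH]; first by rewrite !big_nil expr0n mulr0.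
have : 0 <= \sum_(j <- s) F j ^+ 2 by apply: sumr_ge0 => j _; exact: sqr_ge0.
rewrite !big_cons /=; move: IH; rewrite -natr1.
move: (\sum_(j <- s) F j) (\sum_(j <- s) F j ^+ 2) (F a) => S Q b + Q0.
have [->|s0] := eqVneq (size s) 0%N.
  rewrite !mul0r add0r mul1r => S0; have -> : S = 0.
    by apply/eqP; rewrite -sqrf_eq0 eq_le S0 sqr_ge0.
  by rewrite addr0 lerDl.
have np : 0 < (size s)%:R :> R by rewrite ltr0n lt0n.
move: (size s)%:R np => n np IH {Q0}.
have : 0 <= (n * b - S) ^+ 2 by exact: sqr_ge0.
have -> : (n * b - S) ^+ 2 = n * (n * b ^+ 2 - 2 * b * S) + S ^+ 2 by ring.
move=> h; have : 0 <= n * (n * b ^+ 2 - 2 * b * S + Q) by rewrite mulrDr; lra.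
rewrite pmulr_rge0//; have -> : (b + S) ^+ 2 = b ^+ 2 + 2 * b * S + S ^+ 2 by ring.
have -> : (n + 1) * (b ^+ 2 + Q) = n * b ^+ 2 + n * Q + b ^+ 2 + Q by ring.
by move: (2 * b * S) (n * b ^+ 2) => u v; lra.
Qed.

Lemma ell2norm_sum (J : Type) (s : seq J) (F : J -> ell2 R G) :
  ell2norm (\sum_(j <- s) F j) <= \sum_(j <- s) ell2norm (F j).
Proof.
elim: s => [|a s IH]; first by rewrite !big_nil ell2norm0.
by rewrite !big_cons; apply: le_trans (ell2normD _ _) _; rewrite lerD2l.
Qed.

(** The Kadison-Schwarz inequality for the averaging map, obtained from the Cauchy-Schwarz
    inequality on vectors. *)
Lemma opnorm_avg_sqr (ts : seq G) (a : B) :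
  opnorm (avg ts a) ^+ 2 <= opnorm (avg ts (adj a * a)).
Proof.
set M := opnorm (avg ts (adj a * a)); have M0 : 0 <= M by exact: opnorm_ge0.
rewrite -(sqr_sqrtr M0) ler_pXn2r ?nnegrE ?opnorm_ge0 ?sqrtr_ge0//.
apply: opnorm_le_bound; first exact: sqrtr_ge0.
move=> x; rewrite -(@ler_pXn2r _ 2)// ?nnegrE ?mulr_ge0 ?sqrtr_ge0 ?ell2norm_ge0//.
rewrite exprMn (sqr_sqrtr M0); apply: le_trans _ (form_le_opnorm (avg ts (adj a * a)) x).
have cnj_sqr t : form (cnj t (adj a * a)) x = ell2norm (cnj t a x) ^+ 2.
  have -> : cnj t (adj a * a) = adj (cnj t a) * cnj t a.
    by rewrite cnjM; congr (_ * _); rewrite /cnj !adjM !adj_lreg invgK mulrA.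
  exact: form_sqr.
have formS (r : seq G) :
    form (\sum_(t <- r) cnj t (adj a * a)) x = \sum_(t <- r) ell2norm (cnj t a x) ^+ 2.
  elim: r => [|t r IH]; first by rewrite !big_nil /form dotp0l.
  by rewrite !big_cons formD cnj_sqr IH.
rewrite /avg formZ formS bopZ ell2normZ normc_real_ge0 ?invr_ge0// exprMn bop_sumE.
have [->|ts0] := eqVneq (size ts) 0%N; first by rewrite invr0 expr0n !mul0r.
have np : 0 < (size ts)%:R :> R by rewrite ltr0n lt0n.
rewrite expr2 -mulrA ler_wpM2l ?invr_ge0// ler_pdivrMl//.
apply: le_trans (sqr_sum_le _ _).
rewrite ler_pXn2r ?nnegrE ?ell2norm_ge0//; first exact: ell2norm_sum.
by apply: sumr_ge0 => t _; exact: ell2norm_ge0.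
Qed.

(** In the product of the sum with its adjoint, the diagonal contributes one unit per element of
    [fs]; off the diagonal stand the quotients, whose averages are small. *)
Lemma opnorm_avg_block (ts fs : seq G) (d : R) : 0 <= d -> uniq fs ->
  (forall f f', f \in fs -> f' \in fs -> f != f' -> opnorm (avg ts (lreg (f^-1 * f')%g)) <= d) ->
  opnorm (avg ts (\sum_(f <- fs) lreg f)) ^+ 2 <= (size fs)%:R + (size fs)%:R ^+ 2 * d.
Proof.
move=> d0 ufs fsd; apply: le_trans (opnorm_avg_sqr _ _) _.
rewrite adj_sum mulr_suml avg_sum; apply: le_trans (opnorm_sum _ _) _.
apply: (@le_trans _ _ (\sum_(f <- fs) (1 + (size fs)%:R * d))); last first.
  rewrite big_const_seq count_predT iter_addr addr0 -[leLHS]mulr_natl mulrDr mulr1.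
  by rewrite expr2 mulrA.
rewrite big_seq [leRHS]big_seq; apply: ler_sum => f ffs.
rewrite mulr_sumr avg_sum; apply: le_trans (opnorm_sum _ _) _.
rewrite (bigD1_seq f)//=; apply: lerD.
  rewrite adj_lreg lregVr; apply: le_trans (opnorm_avg _ _) _; exact: opnorm1_le.
apply: (@le_trans _ _ (\sum_(f' <- fs) d)); last first.
  by rewrite big_const_seq count_predT iter_addr addr0 mulr_natl.
rewrite big_mkcond big_seq [leRHS]big_seq; apply: ler_sum => f' f'fs.
by case: ifP => // ff'; rewrite adj_lreg -lregM fsd// eq_sym.
Qed.

Hypothesis powersL : forall (ss : seq G) (e : R), 0 < e ->
  (forall s, s \in ss -> L s /\ s <> 1%g) ->
  exists ts, [/\ ts != [::], forall t, t \in ts -> L t &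
    forall s, s \in ss -> opnorm (avg ts (lreg s)) < e].

Lemma powers_averaging_finite_index : finite_index L ->
  (forall t, t <> 1%g -> infinite_set (rel_class L t)) -> powers_averaging R L.
Proof.
move=> /finite_seqP[Xs XsE] inf; have [L1 LM LV] := LG.
apply: powers_averaging_seq => ss e e0 ss1.
pose coset (f : G) : set G := [set (f * h)%g | h in L].
have cosetP f : coset f \in undup Xs.
  rewrite mem_undup; have : [set [set (g * h)%g | h in L] | g in [set: G]] (coset f) by exists f.
  by rewrite XsE.
have cosetL f f' : coset f = coset f' -> L (f^-1 * f')%g.
  move=> E; have : coset f' f' by exists 1%g; rewrite ?mulg1.
  by rewrite -E => -[h Lh <-]; rewrite mulKg.
pose N := (size (undup Xs))%:R : R.
(* Each of the at most [N] cosets will contribute the square root of [2 * m.+1]; the total must stay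
   below [m.+1 * e]. *)
have [m mP] : exists m : nat, 2 * N ^+ 2 < e ^+ 2 * m.+1%:R.
  pose r := 2 * N ^+ 2 / e ^+ 2; have e2 : 0 < e ^+ 2 by rewrite exprn_gt0.
  have r0 : 0 <= r by rewrite divr_ge0 ?(ltW e2)// mulr_ge0// sqr_ge0.
  exists (Num.truncn r); rewrite -ltr_pdivrMl// mulrC.
  by have /andP[] := truncn_itv r0.
have m0 : 0 < m.+1%:R :> R by rewrite ltr0n.
have [gs [gsm gsL gsP]] := separated_conjugates LG m.+1 (fun s sss => inf s (ss1 s sss)).
pose fs s := [seq cj g s | g <- gs].
(* Quotients of two conjugates in the same left coset lie in [L], so averaging in [L] suffices. The
   tolerance [m.+1%:R^-1] makes the off-diagonal part of a block no larger than [m.+1]. *)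
have [||ts [ts0 tsL tsP]] := powersL
    (ss := [seq d <- flatten [seq [seq (f^-1 * f')%g | f <- fs s, f' <- fs s] | s <- ss]
      | (d != 1%g) && (d \in L)]) (e := m.+1%:R^-1).
- by rewrite invr_gt0.
- by move=> d; rewrite mem_filter => /andP[/andP[/eqP d1 /set_mem Ld] _].
exists [seq (g * t)%g | g <- gs, t <- ts]; split.
- by rewrite -size_eq0 size_allpairs gsm muln_eq0/= size_eq0.
- by move=> _ /allpairsP[[g t] /= [/gsL Lg /tsL Lt ->]]; exact: LM.
move=> s sss; rewrite -avg_comp.
have -> : avg gs (lreg s) = m.+1%:R^-1%:C *: \sum_(f <- fs s) lreg f.
  rewrite /avg gsm; congr (_ *: _); rewrite /fs big_map.
  by apply: eq_bigr => g _; rewrite cnj_lreg.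
rewrite avgZ opnormZ normc_real_ge0 ?invr_ge0// ltr_pdivrMl//.
have -> : \sum_(f <- fs s) lreg f =
    \sum_(X <- undup Xs) \sum_(f <- [seq f <- fs s | coset f == X]) lreg f.
  under [RHS]eq_bigr do rewrite big_filter big_mkcond.
  rewrite exchange_big; apply: eq_bigr => f _.
  rewrite (bigD1_seq (coset f)) ?undup_uniq//= eqxx big1 ?addr0// => X.
  by rewrite eq_sym => /negPf->.
rewrite avg_sum; apply: le_lt_trans (opnorm_sum _ _) _.
have block X : opnorm (avg ts (\sum_(f <- [seq f <- fs s | coset f == X]) lreg f)) <=
    Num.sqrt (2 * m.+1%:R).
  rewrite -(@ler_pXn2r _ 2)// ?nnegrE ?opnorm_ge0 ?sqrtr_ge0// sqr_sqrtr ?mulr_ge0//.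
  have dge0 : 0 <= m.+1%:R^-1 :> R by rewrite invr_ge0.
  apply: le_trans (opnorm_avg_block dge0 _ _) _.
  - by rewrite filter_uniq// gsP.
  - move=> f f'; rewrite !mem_filter => /andP[/eqP fX ffs] /andP[/eqP f'X f'fs] ff'.
    apply/ltW/tsP; rewrite mem_filter mem_set ?andbT; last by apply: cosetL; rewrite fX f'X.
    apply/andP; split.
      by apply: contra ff' => /eqP E; rewrite -[f']mul1g -(mulgV f) -mulgA E mulg1.
    by apply/flatten_mapP; exists s => //; apply/allpairsP; exists (f, f').
  - set k := size _; have km : k%:R <= m.+1%:R :> R.
      by rewrite ler_nat -gsm -(size_map (fun g => cj g s) gs) /k size_filter count_size.
    have : k%:R ^+ 2 <= m.+1%:R ^+ 2 :> R by rewrite ler_pXn2r// nnegrE.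
    rewrite -(ler_pM2r (x := m.+1%:R^-1)) ?invr_gt0// => h.
    apply: le_trans (lerD km h) _; rewrite expr2 mulfK ?gt_eqF//.
    by rewrite mulr_natl mulr2n.
apply: le_lt_trans (ler_sum _ (fun X _ => block X)) _.
rewrite big_const_seq count_predT iter_addr addr0 -[ltLHS]mulr_natl -/N.
rewrite -(@ltr_pXn2r _ 2)// ?nnegrE ?mulr_ge0 ?sqrtr_ge0 ?(ltW e0)// exprMn sqr_sqrtr ?mulr_ge0//.
have -> : (m.+1%:R * e) ^+ 2 = m.+1%:R * (e ^+ 2 * m.+1%:R) by ring.
have -> : N ^+ 2 * (2 * m.+1%:R) = m.+1%:R * (2 * N ^+ 2) by ring.
by rewrite ltr_pM2l.
Qed.

End FiniteIndexPowers.


Theorem theorem5p3 (R : realType) (Gamma : groupType) (P : pred Gamma)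
    (Lambda : subGroupType P) :
  let L : set Gamma := [set` P] in
  let B := reduced_cstar (R := R) L in
  let A := reduced_cstar (R := R) [set: Gamma] in
  let orbit phi := [set shift_functional s phi | s in L] in
  let cond_i := cstar_irreducible B A in
  let cond_ii :=
    exists (X : ptopologicalType) (act : Gamma -> X -> X),
      [/\ boundary_action R act, topologically_free act &
        forall mu : probability (borel X) R, radon mu ->
          exists2 x : borel X, acts_freely_on act x &
            weakstar_closure_measures (measure_orbit act L mu) \d_x] in
  let cond_iii :=
    forall phi, is_state A phi ->
      in_weakstar_closure A (orbit phi) canonical_trace in
  let cond_iv :=
    forall phi, is_state A phi ->
      in_weakstar_closure A (convex_hull (orbit phi)) canonical_trace in
  let cond_v := powers_averaging R L in
  let cond_vi := relative_dixmier B A in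
  cstar_simple R Lambda -> cstar_simple R Gamma ->
  [/\ cond_ii -> cond_iii,
      cond_iii -> cond_iv,
      cond_iv <-> cond_v,
      cond_v -> cond_vi &
      cond_vi -> cond_i]
  /\ (finite_index L -> cond_i -> cond_vi).
Proof.
move=> L B A orbit cond_i cond_ii cond_iii cond_iv cond_v cond_vi simpleL simpleG.
have lift s : L s -> exists2 h : Lambda, val h = s & True.
  by move=> Ls; exists (Sub s Ls); rewrite ?SubK.
have LG : subgroup L.
  split; first by have := valP (1%g : Lambda); rewrite val1.
    by move=> _ _ /lift[h <- _] /lift[k <- _]; have := valP (h * k)%g; rewrite valM.
  by move=> _ /lift[h <- _]; have := valP (h^-1)%g; rewrite gmulfV.
have v_vi : cond_v -> cond_vi by exact: dixmier_of_averaging.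
split; first split=> //.
- by move=> [X [act [bX _ contract]]] phi; exact: (states_of_boundary bX contract).
- move=> iii phi /iii; apply: closureS; apply: image_subset; exact: sub_convex_hull.
- by split; [exact: averaging_of_states|exact: states_of_averaging].
- exact: irreducible_of_dixmier.
move=> fin irr; apply/v_vi/(powers_averaging_finite_index LG) => //; last exact: (infinite_classes LG irr).
move=> ss e e0 ssP.
(* Simplicity of the subgroup's own algebra gives averaging in its own l2 space, which [val] carries
   to the larger one. *)
have [|ts [ts0 tsP]] := powers_transfer (i := val) val_inj (@valM _ _ Lambda)
    (ss := pmap insub ss) (powers_averaging_of_simple simpleL) e0.
  move=> s; rewrite mem_pmap_sub => /ssP[_ s1] E; apply: s1.
  by rewrite E val1.
exists (map val ts); split.
- by rewrite -size_eq0 size_map size_eq0.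
- by move=> _ /mapP[t _ ->]; exact: valP.
move=> s sss; have [/lift[h hs _] _] := ssP s sss.
by rewrite -hs; apply: tsP; rewrite mem_pmap_sub hs.
Qed.
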